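(* Assume (CV), (LACL) for $l$, and either (SC1) or (SC2). Then: (i) there is a unique nonnegative viscosity solution $W$ to (BVP$\mathcal K$), which turns out to be continuous. Moreover $\mathcal V\equiv-\log(1-W)$ and $Dom(\mathcal V)=\{x: W(x)<1\}$; (ii) $(\mathcal V,Dom(\mathcal V))$ is the unique nonnegative viscosity solution to (BVP) among the pairs $(u,\Omega)$, $\Omega=Dom(u)$, such that $\lim_{x\to\bar x}u(x)=+\infty$ for all $\bar x\in\partial Dom(u)$. Moreover, $\mathcal V$ is continuous. If (CV) is not satisfied (all the other hypotheses being kept), the uniqueness of the nonnegative viscosity solution $W$ to (BVP$\mathcal K$) asserted in (i) holds just among the continuous functions $W$, and the uniqueness of $(\mathcal V,Dom(\mathcal V))$ as nonnegative viscosity solution to (BVP) asserted in (ii) holds just among the pairs $(u,\Omega)$, $\Omega=Dom(u)$, with $u$ continuous in $\Omega$ and such that $\lim_{x\to\bar x}u(x)=+\infty$ for all $\bar x\in\partial Dom(u)$.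
   Context: Standing setting. $A\subset\mathbb R^m$ is compact; the target $\mathcal T\subset\mathbb R^n$ is closed with compact boundary; $\mathcal T^c=\mathbb R^n\setminus\mathcal T$, $\overset{\circ}{\mathcal T}$ is the interior of $\mathcal T$, $\mathbf d(x)=\mathrm{dist}(x,\mathcal T)$, $\mathbb R_+=[0,+\infty[$. The functions $f:\mathbb R^n\times A\to\mathbb R^n$ and $l:\mathbb R^n\times A\to\mathbb R_+$ are continuous; there is $M>0$ with $|f(x,a)|\le M(1+|x|)$ for all $(x,a)$, and for every $R>0$ there is $L_R>0$ with $|f(x_1,a)-f(x_2,a)|\le L_R|x_1-x_2|$ and $|l(x_1,a)-l(x_2,a)|\le L_R|x_1-x_2|$ whenever $|x_1|,|x_2|\le R$, $a\in A$. $\mathcal A$ is the set of measurable controls $\alpha:\mathbb R_+\to A$, and $y_x(\cdot,\alpha)$ is the solution on $\mathbb R_+$ of $\dot y(t)=f(y(t),\alpha(t))$, $y(0)=x$. Put $t_x(\alpha)=\inf\{t\ge0: y_x(t,\alpha)\in\mathcal T\}\le+\infty$, $\mathcal J(t,x,\alpha)=\int_0^t l(y_x(s,\alpha),\alpha(s))\,ds$, and $\mathcal A(x)=\{\alpha\in\mathcal A:\ \liminf_{t\to t_x(\alpha)^-}\mathbf d(y_x(t,\alpha))=0\}$. For $x\in\mathcal T^c$, $\mathcal V(x)=\inf_{\alpha\in\mathcal A(x)}\mathcal J(t_x(\alpha),x,\alpha)$ (with $\inf\emptyset=+\infty$); $\mathcal V=0$ on $\mathcal T$. For $u:\mathbb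 R^n\setminus\overset{\circ}{\mathcal T}\to\mathbb R\cup\{+\infty\}$, $Dom(u)=\{x\in\mathbb R^n\setminus\overset{\circ}{\mathcal T}: u(x)<+\infty\}$; when $Dom(u)$ is used as an open set $\Omega\supset\mathcal T$, it is identified with $Dom(u)\cup\mathcal T$, and $\partial Dom(u)$ is the boundary relative to $\mathbb R^n\setminus\overset{\circ}{\mathcal T}$. Hypotheses. (CV): for each $x\in\mathbb R^n$ the set $\{(\mu,\gamma)\in\mathbb R^{n+1}:\exists a\in A,\ \mu=f(x,a),\ l(x,a)\le\gamma\}$ is convex. (LACL) for a continuous $h:\mathbb R^n\times A\to\mathbb R_+$: there exists a local Minimum Restraint Function (MRF) for $h$, i.e. an open set $\Omega\supset\mathcal T$ and $U:\Omega\setminus\overset{\circ}{\mathcal T}\to\mathbb R_+$ continuous on $\Omega\setminus\overset{\circ}{\mathcal T}$, locally semiconcave, positive definite and proper on $\Omega\setminus\mathcal T$, such that for some $U_0\in\,]0,+\infty]$ one has $\lim_{x\to x_0,x\in\Omega}U(x)=U_0$ for all $x_0\in\partial\Omega$ and $U(x)<U_0$ for all $x\in\Omega\setminus\overset{\circ}{\mathcal T}$, and such that for some $k>0$, for every $x\in\Omega\setminus\mathcal T$, $\min_{a\in A}\{\langle p,f(x,a)\rangle+k\,h(x,a)\}<0$ for all $p\in D^*U(x)$. Here $D^*U(x)$ is the set of limits $p=\lim_k\nabla U(x_k)$ with $x_k\to x$, $x_k\ne x$ points of differentiability of $U$. (SC1): there exist $U:\mathbb R^n\setminus\overset{\circ}{\mathcal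 T}\to\mathbb R_+$ of class $C^1$, positive definite and proper on $\mathcal T^c$, and a continuous increasing $m:\,]0,+\infty[\,\to\,]0,+\infty[$ such that $\sup_{a\in A}\langle\nabla U(x),f(x,a)\rangle\le-m(\mathbf d(x))$ for all $x\in\mathcal T^c$. (SC2): there is a continuous increasing $c_2:\,]0,+\infty[\,\to\,]0,+\infty[$ with $l(x,a)\ge c_2(\mathbf d(x))$ for all $(x,a)\in\mathcal T^c\times A$. $U$ is positive definite on $\Omega\setminus\mathcal T$ if $U>0$ on $\Omega\setminus\mathcal T$ and $U=0$ on $\partial\mathcal T$; $U$ is proper if $U^{-1}(K)$ is compact for every compact $K\subset\mathbb R_+$ (for $\mathcal T^c$ take $\Omega=\mathbb R^n$). (BVP). Let $\mathcal H(x,p)=\sup_{a\in A}\{-\langle p,f(x,a)\rangle-l(x,a)\}$; $u_*$, $u^*$ denote lower and upper semicontinuous envelopes. A pair $(u,\Omega)$ with $u:\mathbb R^n\setminus\overset{\circ}{\mathcal T}\to\mathbb R\cup\{+\infty\}$ and $\Omega\supset\mathcal T$ open is a solution to (BVP) if: $u_*\ge0$ on $\partial\mathcal T$ and $u_*$ is a viscosity supersolution of $\mathcal H(x,Du(x))=0$ in $\mathbb R^n\setminus\mathcal T$; and $u$ restricted to $\Omega\setminus\overset{\circ}{\mathcal T}$ is real-valued, locally bounded, with $u^*\le0$ on $\partial\mathcal T$ and $u^*$ a viscosity subsolution of $\mathcal H(x,Du(x))=0$ in $\Omega\setminus\mathcal T$. (BVP$\mathcal K$). Let $\mathcal K(x,u,p)=\sup_{a\in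 A}\{-\langle p,f(x,a)\rangle-l(x,a)+l(x,a)u\}$, the Hamiltonian associated to the Kruzkov transform $W=1-e^{-u}$ (value $1$ where $u=+\infty$; $-\log0=+\infty$). A solution of (BVP$\mathcal K$) is a locally bounded $W:\mathbb R^n\setminus\overset{\circ}{\mathcal T}\to\,]-\infty,1]$ such that $W_*\ge0$ on $\partial\mathcal T$ and $W_*$ is a viscosity supersolution of $\mathcal K(x,W,DW)=0$ in $\mathbb R^n\setminus\mathcal T$, and $W^*\le0$ on $\partial\mathcal T$ and $W^*$ is a viscosity subsolution of $\mathcal K(x,W,DW)=0$ in $\mathbb R^n\setminus\mathcal T$. *)

(* Defs.v *)
From HB Require Import structures.
From mathcomp Require Import all_boot all_order all_algebra.
From mathcomp Require Import all_classical all_reals all_analysis.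

Set Implicit Arguments.
Unset Strict Implicit.
Unset Printing Implicit Defensive.

Import Order.TTheory GRing.Theory Num.Theory.
Import numFieldNormedType.Exports.

Local Open Scope classical_set_scope.
Local Open Scope ring_scope.

(* The norm carried by 'rV[R]_n in the library is the sup norm; the topology,
   differentiability and compactness of the library are used as they are, but
   every metric quantity is expressed with the Euclidean norm below.

   A function whose domain in the mathematics is a subset of R^n is a total
   function here; the definitions only look at its values on that subset. *)

Section Euclidean.
Context {R : realType} {n : nat}.
Implicit Types (x y p : 'rV[R]_n) (S O : set 'rV[R]_n).

Definition dot x y : R := \sum_(i < n) x 0 i * y 0 i.

Definition enorm x : R := Num.sqrt (dot x x).

Definition dist_to S x : R := inf [set enorm (x - y) | y in S].

Definition grad (u : 'rV[R]_n -> R) x : 'rV[R]_n :=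
  \row_(i < n) 'D_(delta_mx 0 i) u x.

Definition C1_on O (u : 'rV[R]_n -> R) : Prop :=
  forall x, O x -> differentiable u x /\ {for x, continuous (grad u)}.

Definition bdry S : set 'rV[R]_n := closure S `\` S°.

Definition rel_bdry O S : set 'rV[R]_n :=
  O `&` closure S `&` closure (O `\` S).

Definition locally_semiconcave O (u : 'rV[R]_n -> R) : Prop :=
  forall x0, O x0 -> exists r rho : R,
    [/\ 0 < r, 0 < rho, ball x0 r `<=` O &
        forall y z, ball x0 r y -> ball x0 r z ->
          u y + u z - 2 * u (2^-1 *: (y + z)) <= rho * enorm (y - z) ^+ 2].

(* D^* u (x) for u defined on the open set O *)
Definition limiting_gradients O (u : 'rV[R]_n -> R) x : set 'rV[R]_n :=
  [set p | exists xs : nat -> 'rV[R]_n,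
    [/\ forall k, [/\ O (xs k), xs k != x & differentiable u (xs k)],
        xs k @[k --> \oo] --> x &
        grad u (xs k) @[k --> \oo] --> p]].

(* Semicontinuous envelopes at x of the restriction of u to S; a point x of S
   belongs to all the neighbourhoods in play. *)
Definition lsc_env S (u : 'rV[R]_n -> \bar R) x : \bar R :=
  limf_einf u (within S (nbhs x)).

Definition usc_env S (u : 'rV[R]_n -> \bar R) x : \bar R :=
  limf_esup u (within S (nbhs x)).

Definition locally_bounded S (u : 'rV[R]_n -> \bar R) : Prop :=
  forall x, S x -> exists c : R,
    \forall y \near x, S y -> (`|u y| <= c%:E)%E.

(* F x r p plays the role of F(x, u(x), Du(x)). A function with values in the
   extended reals is only tested at the points where it is finite. *)
Definition viscosity_supersolution (F : 'rV[R]_n -> R -> 'rV[R]_n -> R) O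
    (v : 'rV[R]_n -> \bar R) : Prop :=
  forall phi : 'rV[R]_n -> R, C1_on O phi ->
  forall x, O x -> v x \is a fin_num ->
    (\forall y \near x, (v x - (phi x)%:E <= v y - (phi y)%:E)%E) ->
    0 <= F x (fine (v x)) (grad phi x).

Definition viscosity_subsolution (F : 'rV[R]_n -> R -> 'rV[R]_n -> R) O
    (v : 'rV[R]_n -> \bar R) : Prop :=
  forall phi : 'rV[R]_n -> R, C1_on O phi ->
  forall x, O x -> v x \is a fin_num ->
    (\forall y \near x, (v y - (phi y)%:E <= v x - (phi x)%:E)%E) ->
    F x (fine (v x)) (grad phi x) <= 0.

End Euclidean.

Section Problem.
Context {R : realType} {n m : nat}.
Variables (f : 'rV[R]_n -> 'rV[R]_m -> 'rV[R]_n)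
          (l : 'rV[R]_n -> 'rV[R]_m -> R)
          (A : set 'rV[R]_m) (T : set 'rV[R]_n).
Implicit Types (x p : 'rV[R]_n) (alpha : R -> 'rV[R]_m) (y : R -> 'rV[R]_n).

Definition outside : set 'rV[R]_n := ~` T°.

Definition standing_assumptions : Prop :=
  (compact A /\ A !=set0) /\
  [/\ T !=set0, closed T & compact (bdry T)] /\
  {within setT `*` A, continuous (fun z => f z.1 z.2)} /\
  {within setT `*` A, continuous (fun z => l z.1 z.2)} /\
  (forall x a, A a -> 0 <= l x a) /\
  (exists2 M : R, 0 < M &
     forall x a, A a -> enorm (f x a) <= M * (1 + enorm x)) /\
  (forall r : R, 0 < r -> exists2 L : R, 0 < L &
     forall x1 x2 a, enorm x1 <= r -> enorm x2 <= r -> A a ->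
       enorm (f x1 a - f x2 a) <= L * enorm (x1 - x2) /\
       `|l x1 a - l x2 a| <= L * enorm (x1 - x2)).

Definition controls : set (R -> 'rV[R]_m) :=
  [set alpha : R -> 'rV[R]_m |
    (forall i, measurable_fun (`[0, +oo[ : set R) (fun t : R => alpha t 0 i)) /\
    (forall t, 0 <= t -> A (alpha t))].

(* Caratheodory solutions on [0, +oo[, in integral form *)
Definition solves_ode x alpha y : Prop :=
  {within `[0, +oo[, continuous y} /\
  forall t, 0 <= t -> forall i : 'I_n,
    y t 0 i = x 0 i +
      \int[lebesgue_measure]_(s in `[0, t]) f (y s) (alpha s) 0 i.

(* Under the standing assumptions such a solution exists and its values on
   [0, +oo[ are unique. *)
Definition trajectory x alpha : R -> 'rV[R]_n :=
  get [set y | solves_ode x alpha y].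

Definition exit_time x alpha : \bar R :=
  ereal_inf [set t%:E | t in [set t | 0 <= t /\ T (trajectory x alpha t)]].

Definition cost (t : \bar R) x alpha : \bar R :=
  (\int[lebesgue_measure]_(s in [set s | (0 <= s)%R /\ s%:E < t])
     (l (trajectory x alpha s) (alpha s))%:E)%E.

(* Left neighbourhoods of t in ]0, +oo] *)
Definition left_nbhs (t : \bar R) : set_system R :=
  if t is r%:E then r^'- else pinfty_nbhs R.

Definition admissible x : set (R -> 'rV[R]_m) :=
  [set alpha | controls alpha /\
    limf_einf (fun t => (dist_to T (trajectory x alpha t))%:E)
              (left_nbhs (exit_time x alpha)) = 0%E].

Definition value x : \bar R :=
  if x \in T then 0%E
  else ereal_inf [set cost (exit_time x alpha) x alpha | alpha in admissible x].

Definition CV : Prop := forall x,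
  convex_set ([set z | exists2 a, A a & z.1 = f x a /\ l x a <= z.2]
              : set (convex_lmodType ('rV[R]_n * R^o)%type)).

Definition positive_definite (Om : set 'rV[R]_n) (U : 'rV[R]_n -> R) : Prop :=
  (forall x, (Om `\` T) x -> 0 < U x) /\ (forall x, bdry T x -> U x = 0).

Definition proper_on (Om : set 'rV[R]_n) (U : 'rV[R]_n -> R) : Prop :=
  forall K : set R, compact K -> K `<=` [set r | 0 <= r] ->
    compact ((Om `\` T°) `&` U @^-1` K).

Definition local_MRF (h : 'rV[R]_n -> 'rV[R]_m -> R)
    (Om : set 'rV[R]_n) (U : 'rV[R]_n -> R) : Prop :=
  (open Om /\ T `<=` Om) /\
  (forall x, (Om `\` T°) x -> 0 <= U x) /\
  {within Om `\` T°, continuous U} /\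
  locally_semiconcave (Om `\` T) U /\
  positive_definite Om U /\
  proper_on Om U /\
  (exists2 U0 : \bar R, (0 < U0)%E &
     (forall x0, bdry Om x0 -> (U x)%:E @[x --> within Om (nbhs x0)] --> U0) /\
     (forall x, (Om `\` T°) x -> ((U x)%:E < U0)%E)) /\
  (exists2 k : R, 0 < k &
     forall x, (Om `\` T) x -> forall p, limiting_gradients (Om `\` T) U x p ->
       exists2 a, A a &
         (forall b, A b -> dot p (f x a) + k * h x a <= dot p (f x b) + k * h x b)
         /\ dot p (f x a) + k * h x a < 0).

Definition LACL (h : 'rV[R]_n -> 'rV[R]_m -> R) : Prop :=
  exists Om U, local_MRF h Om U.

Definition comparison_function (c : R -> R) : Prop :=
  [/\ forall r, 0 < r -> 0 < c r,
      {within `]0, +oo[, continuous c} &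
      forall r s, 0 < r -> r < s -> c r < c s].

(* Class C^1 on the closed set R^n \ interior T means: restriction of a
   function of class C^1 on an open set containing it. *)
Definition SC1 : Prop :=
  exists (U : 'rV[R]_n -> R) (c : R -> R),
    [/\ forall x, outside x -> 0 <= U x,
        exists O, [/\ open O, outside `<=` O & C1_on O U],
        positive_definite setT U,
        proper_on setT U &
        comparison_function c /\
        forall x, ~ T x ->
          sup [set dot (grad U x) (f x a) | a in A] <= - c (dist_to T x)].

Definition SC2 : Prop :=
  exists2 c : R -> R, comparison_function c &
    forall x a, ~ T x -> A a -> c (dist_to T x) <= l x a.

Definition hamiltonian x p : R := sup [set - dot p (f x a) - l x a | a in A].

Definition kruzkov_hamiltonian x (r : R) p : R :=
  sup [set - dot p (f x a) - l x a + l x a * r | a in A].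

Definition Dom (u : 'rV[R]_n -> \bar R) : set 'rV[R]_n :=
  [set x | outside x /\ (u x < +oo)%E].

Definition BVP_solution (u : 'rV[R]_n -> \bar R) (Om : set 'rV[R]_n) : Prop :=
  (open Om /\ T `<=` Om) /\
  (forall x, outside x -> u x != -oo%E) /\
  (forall x, bdry T x -> (0 <= lsc_env outside u x)%E) /\
  viscosity_supersolution (fun x _ p => hamiltonian x p) (~` T)
    (lsc_env outside u) /\
  (forall x, (Om `\` T°) x -> u x \is a fin_num) /\
  locally_bounded (Om `\` T°) u /\
  (forall x, bdry T x -> (usc_env (Om `\` T°) u x <= 0)%E) /\
  viscosity_subsolution (fun x _ p => hamiltonian x p) (Om `\` T)
    (usc_env (Om `\` T°) u).

Definition BVPK_solution (W : 'rV[R]_n -> R) : Prop :=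
  (forall x, outside x -> W x <= 1) /\
  locally_bounded outside (EFin \o W) /\
  (forall x, bdry T x -> (0 <= lsc_env outside (EFin \o W) x)%E) /\
  viscosity_supersolution kruzkov_hamiltonian (~` T)
    (lsc_env outside (EFin \o W)) /\
  (forall x, bdry T x -> (usc_env outside (EFin \o W) x <= 0)%E) /\
  viscosity_subsolution kruzkov_hamiltonian (~` T)
    (usc_env outside (EFin \o W)).

Definition nonneg_BVPK_solution (W : 'rV[R]_n -> R) : Prop :=
  BVPK_solution W /\ (forall x, outside x -> 0 <= W x).

(* The pair (u, Om) with Om = Dom(u) identified with Dom(u) U T, for u
   nonnegative and blowing up at the boundary of its domain *)
Definition nonneg_blowup_BVP_solution (u : 'rV[R]_n -> \bar R) : Prop :=
  [/\ BVP_solution u (Dom u `|` T),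
      forall x, outside x -> (0 <= u x)%E &
      forall x0, rel_bdry outside (Dom u) x0 ->
        u x @[x --> within outside (nbhs x0)] --> +oo%E].

End Problem.

(* Main.v *)
(** The dynamic programming principle makes the Kruzkov transform
    [W = 1 - exp (- value)] a subsolution and a supersolution of (BVPK), in
    terms of its semicontinuous envelopes. The minimum restraint function gives
    [value <= U / k] near the target: pieces of constant controls along which
    [U] decreases are concatenated greedily, each one realizing at least half of
    the best possible decrease, so that [U] tends to 0; hence [W] vanishes
    continuously on the boundary of the target. A comparison principle for
    semicontinuous sub- and supersolutions then gives both the continuity and
    the uniqueness of [W]. It is proved by doubling the variables, with a
    coercive penalty that makes the difference strict away from the target:
    under (SC1) this is the given function, under (SC2) the logarithm of
    [1 + |x|^2], whose derivative along the dynamics is bounded.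

    For (BVP), viscosity tests transfer through [r |-> 1 - exp (- r)] by second
    order estimates of the exponential, and a solution [u] which blows up on the
    boundary of its domain, extended by [1] after the transform, remains a
    subsolution across that boundary. *)
Require Import Defs.
From HB Require Import structures.
From mathcomp Require Import all_boot all_order all_algebra.
From mathcomp Require Import all_classical all_reals all_analysis.
From mathcomp Require Import measurable_realfun.
From mathcomp Require Import ring lra.

Import Order.TTheory GRing.Theory Num.Theory.
Import numFieldNormedType.Exports.

Local Open Scope classical_set_scope.
Local Open Scope ring_scope.

Set Implicit Arguments.
Unset Strict Implicit.
Unset Printing Implicit Defensive.

(** The term [l * (1 - r)] of the Kruzkov Hamiltonian is monotone in [r] only as strongly as [l],
    which may vanish, so it cannot give comparison alone: the penalty supplies the missing
    strictness. The boundary condition and upper semicontinuity keep the maximum points away from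
    the target, near which the strictness degenerates. Comparison is run on the whole complement of
    the target rather than on the domain of a solution, because [+oo] becomes the ordinary value 1;
    in exchange, the supersolution is tested only below 1, since an infinite lower envelope carries
    no test in (BVP). The two problems are linked by [K(x, 1 - q, q p) = q H(x, p)]. The target may
    be reached only in the limit, in finite or infinite time, and statements on exit times cover
    both cases at once. In the viscosity tests the length of time is fixed before the starting point
    is chosen, because the envelopes at [x] are only approached at nearby points; all estimates must
    therefore be uniform in the starting point and in the control. *)

Definition shiftr (R : realType) (t : R) :
  measurableTypeR R -> measurableTypeR R := fun s => t + s.

Lemma measurable_shiftr (R : realType) (t : R) :
  measurable_fun [set: measurableTypeR R] (shiftr t).
Proof. by apply: measurable_funD => //; exact: measurable_cst. Qed.

HB.instance Definition _ (R : realType) (t : R) :=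
  isMeasurableFun.Build _ _ _ _ (shiftr t) (measurable_shiftr t).

(** * Integrals of locally bounded measurable functions and Gronwall's lemma *)

Section Integral.
Context {R : realType}.
Implicit Types (g h : R -> R) (s t : R).
Local Notation mu := (@lebesgue_measure R).

(** Unlike integrability, this class is closed under products, and it contains the dynamics and the
    running cost along every trajectory; linearity of [pint] then needs no further side
    condition. *)
Definition tame g : Prop :=
  measurable_fun (`[0, +oo[ : set R) g /\
  forall t, exists C : R, forall s, 0 <= s <= t -> `|g s| <= C.

Definition pint g t : R := \int[mu]_(s in `[0, t]) g s.

Lemma sub_itv_pos t : (`[0, t] : set R) `<=` `[0, +oo[.
Proof. by move=> s /=; rewrite !in_itv /= => /andP[->]. Qed.

Lemma tame_integrable g t (D : set R) : tame g -> measurable D ->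
  D `<=` `[0, t] -> mu.-integrable D (EFin \o g).
Proof.
move=> [mg bg] mD Dt; have [C hC] := bg t.
apply: measurable_bounded_integrable => //.
- have : (mu D <= mu `[0%R, t])%E by apply: le_measure; rewrite ?inE.
  move=> /le_lt_trans; apply; rewrite lebesgue_measure_itv /=.
  by case: ifP => _; rewrite -?EFinB ltry.
- by apply: measurable_funS mg => //; apply: subset_trans Dt (@sub_itv_pos t).
- exists C; split; first exact: num_real.
  move=> x Cx s Ds; apply: le_trans (ltW Cx).
  by apply: hC; have := Dt _ Ds; rewrite /= in_itv.
Qed.

Lemma tame_int g t : tame g -> mu.-integrable `[0, t] (EFin \o g).
Proof. by move=> tg; apply: (@tame_integrable g t). Qed.

Lemma tameD g h : tame g -> tame h -> tame (fun s => g s + h s).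
Proof.
move=> [mg bg] [mh bh]; split; first exact: measurable_funD.
move=> t; have [C hC] := bg t; have [C' hC'] := bh t.
by exists (C + C') => s st; apply: le_trans (ler_normD _ _) _; rewrite lerD ?hC ?hC'.
Qed.

Lemma tameM g h : tame g -> tame h -> tame (fun s => g s * h s).
Proof.
move=> [mg bg] [mh bh]; split; first exact: measurable_funM.
move=> t; have [C hC] := bg t; have [C' hC'] := bh t.
by exists (C * C') => s st; rewrite normrM ler_pM ?hC ?hC'.
Qed.

Lemma tame_cst c : tame (fun _ => c).
Proof. by split; [exact: measurable_cst | exists `|c|]. Qed.

Lemma tameZ c g : tame g -> tame (fun s => c * g s).
Proof. by move=> tg; apply: tameM => //; exact: tame_cst. Qed.

Lemma tameN g : tame g -> tame (fun s => - g s).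
Proof. by move=> /(tameZ (-1)); under eq_fun do rewrite mulN1r. Qed.

Lemma tameB g h : tame g -> tame h -> tame (fun s => g s - h s).
Proof. by move=> tg th; apply: tameD => //; exact: tameN. Qed.

Lemma tame_norm g : tame g -> tame (fun s => `|g s|).
Proof.
move=> [mg bg]; split; first by apply: measurableT_comp.
by move=> t; have [C hC] := bg t; exists C => s st; rewrite normr_id hC.
Qed.

Lemma tame_sum (I : Type) (r : seq I) (F : I -> R -> R) :
  (forall i, tame (F i)) -> tame (fun s => \sum_(i <- r) F i s).
Proof.
move=> tF; elim: r => [|i r ih].
  by under eq_fun do rewrite big_nil; exact: tame_cst.
by under eq_fun do rewrite big_cons; exact: tameD.
Qed.

Lemma tame_continuous g : {within `[0, +oo[, continuous g} -> tame g.
Proof.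
move=> cg; split; first by apply: subspace_continuous_measurable_fun.
move=> t; have [t0|t0] := leP 0 t; last first.
  by exists 0 => s /andP[s0 st]; have := le_trans s0 st; rewrite leNgt t0.
have cgt : {within `[0, t], continuous (fun s => `|g s|)}.
  move=> x; apply: (@continuous_comp _ _ _ (g : subspace `[0, t] -> R)).
    by apply: (continuous_subspaceW (@sub_itv_pos t) cg).
  exact: norm_continuous.
have [c _ hc] := EVT_max t0 cgt.
by exists `|g c| => s st; apply: hc; rewrite in_itv.
Qed.

Lemma pintD g h t : tame g -> tame h ->
  pint (fun s => g s + h s) t = pint g t + pint h t.
Proof. by move=> tg th; apply: RintegralD => //; exact: tame_int. Qed.

Lemma pintZ c g t : tame g -> pint (fun s => c * g s) t = c * pint g t.
Proof. by move=> tg; apply: RintegralZl => //; exact: tame_int. Qed.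

Lemma pintB g h t : tame g -> tame h ->
  pint (fun s => g s - h s) t = pint g t - pint h t.
Proof. by move=> tg th; apply: RintegralB => //; exact: tame_int. Qed.

Lemma pint_sum (I : Type) (r : seq I) (F : I -> R -> R) t :
  (forall i, tame (F i)) ->
  pint (fun s => \sum_(i <- r) F i s) t = \sum_(i <- r) pint (F i) t.
Proof.
move=> tF; elim: r => [|i r ih].
  rewrite big_nil /pint; under eq_Rintegral do rewrite big_nil.
  by rewrite Rintegral_cst // mul0r.
rewrite big_cons -ih -pintD //; last exact: tame_sum.
by apply: eq_Rintegral => s _; rewrite big_cons.
Qed.

Lemma eq_pint g h t : (forall s, 0 <= s <= t -> g s = h s) -> pint g t = pint h t.
Proof.
move=> gh; apply: eq_Rintegral => s; rewrite inE /= in_itv /=; exact: gh.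
Qed.

Lemma le_pint g h t : tame g -> tame h ->
  (forall s, 0 <= s <= t -> g s <= h s) -> pint g t <= pint h t.
Proof.
move=> tg th gh; apply: le_Rintegral; [by []|exact: tame_int..|].
by move=> s /=; rewrite in_itv /=; exact: gh.
Qed.

Lemma pint_cst c t : 0 <= t -> pint (fun _ => c) t = c * t.
Proof.
move=> t0; rewrite /pint Rintegral_cst //; congr (_ * _).
have := lebesgue_measure_itv `[0, t]; rewrite /= lte_fin; case: ltP => [t0' ->|t0' ->] /=.
- by rewrite subr0.
- by apply/esym/eqP; rewrite eq_le t0 t0'.
Qed.

Lemma pint0 g : pint g 0 = 0.
Proof. by rewrite /pint set_itv1 Rintegral_set1. Qed.

Lemma le_norm_pint g t : tame g -> `|pint g t| <= pint (fun s => `|g s|) t.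
Proof. by move=> tg; apply: le_normr_Rintegral => //; exact: tame_int. Qed.

Lemma pint_le_cst g t C : 0 <= t -> tame g ->
  (forall s, 0 <= s <= t -> g s <= C) -> pint g t <= C * t.
Proof.
move=> t0 tg gC; rewrite -pint_cst //; apply: le_pint => //; exact: tame_cst.
Qed.

Lemma pint_ge_cst g t C : 0 <= t -> tame g ->
  (forall s, 0 <= s <= t -> C <= g s) -> C * t <= pint g t.
Proof.
move=> t0 tg gC; rewrite -pint_cst //; apply: le_pint => //; exact: tame_cst.
Qed.

Lemma pint_norm_le g t C : 0 <= t -> tame g ->
  (forall s, 0 <= s <= t -> `|g s| <= C) -> `|pint g t| <= C * t.
Proof.
move=> t0 tg gC; apply: le_trans (le_norm_pint _ tg) _.
by apply: pint_le_cst => //; exact: tame_norm.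
Qed.

Lemma tame_expR c : tame (fun s => expR (c * s)).
Proof.
apply/tame_continuous/continuous_subspaceT => x.
by apply: continuous_comp; [exact: mulrl_continuous | exact: continuous_expR].
Qed.

Lemma pint_expR (c t : R) : 0 < c -> 0 <= t ->
  pint (fun s => expR (c * s)) t = (expR (c * t) - 1) / c.
Proof.
move=> c0; rewrite le_eqVlt => /predU1P[<-|t0].
  by rewrite pint0 mulr0 expR0 subrr mul0r.
have dF (x : R) : is_derive x 1 (fun s : R => expR (c * s) / c) (expR (c * x)).
  have h : is_derive x 1 (fun s : R => c * s) c.
    apply: (is_derive_eq (is_deriveM (is_derive_cst c x 1) (is_derive_id x 1))).
    by rewrite scaler0 addr0 /GRing.scale /= mulr1.
  have h2 := is_derive1_comp (is_derive_expR (c * x)) h.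
  apply: (is_derive_eq (is_deriveM h2 (is_derive_cst c^-1 x 1))).
  by rewrite scaler0 add0r /GRing.scale /= [expR _ * _]mulrC mulKf ?gt_eqF.
have cF : continuous (fun s : R => expR (c * s) / c).
  move=> x; apply: differentiable_continuous; apply/derivable1_diffP; apply: ex_derive.
rewrite /pint /Rintegral (continuous_FTC2 (F := fun s => expR (c * s) / c) t0) //=.
- by rewrite mulr0 expR0 mulrBl.
- apply/continuous_subspaceT => x.
  by apply: continuous_comp; [exact: mulrl_continuous | exact: continuous_expR].
- split; first by move=> x _; apply: ex_derive.
  + by apply: cvg_at_right_filter; exact: cF.
  + by apply: cvg_at_left_filter; exact: cF.
- by move=> x _; rewrite derive1E; apply: derive_val.
Qed.

Lemma tame_shift g t : 0 <= t -> tame g -> tame (fun s => g (t + s)).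
Proof.
move=> t0 [mg bg]; split.
  apply: (@measurable_comp _ _ _ (measurableTypeR R) (measurableTypeR R) _
    (`[0, +oo[ : set R) g (`[0, +oo[ : set R) (shiftr t)) => //.
    by move=> _ [s /= + <-]; rewrite !in_itv /= !andbT => s0; rewrite addr_ge0.
  by apply: measurable_funS (measurable_shiftr t).
move=> t'; have [C hC] := bg (t + t'); exists C => s /andP[s0 st].
by apply: hC; rewrite addr_ge0 // lerD2l.
Qed.

End Integral.

Lemma lebesgue_measure_shift (R : realType) (t : R) (D : set R) : measurable D ->
  pushforward (@lebesgue_measure R) (shiftr t) D = (@lebesgue_measure R) D.
Proof.
move=> mD; apply/esym/lebesgue_measure_unique => //= _ [[a b] _ <-].
rewrite /pushforward /=.
have -> : shiftr t @^-1` `]a, b] = `]a - t, b - t]%classic.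
  apply/seteqP; split => s /=; rewrite !in_itv /= /shiftr => /andP[h1 h2]; apply/andP; split; lra.
rewrite /= !lebesgue_measure_itv /= !lte_fin ltrD2r; case: ifP => // _.
by rewrite -!EFinB; congr EFin; ring.
Qed.

Lemma ge0_integral_shift (R : realType) (t : R) (D : set R) (g : R -> \bar R) :
  measurable D -> measurable_fun D g -> (forall s, D s -> (0 <= g s)%E) ->
  (\int[@lebesgue_measure R]_(s in D) g s =
   \int[@lebesgue_measure R]_(s in shiftr t @^-1` D) g (t + s)%R)%E.
Proof.
move=> mD mg g0.
rewrite -[RHS]/(\int[@lebesgue_measure R]_(s in _) (g \o shiftr t) s)%E.
rewrite -(ge0_integral_pushforward (measurable_shiftr t)) //.
  by apply: eq_measure_integral => E mE _; apply/esym; exact: lebesgue_measure_shift.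
by move=> s; rewrite inE; exact: g0.
Qed.

Section IntegralSplit.
Context {R : realType}.
Implicit Types (g h : R -> R) (s t : R).
Local Notation mu := (@lebesgue_measure R).

Lemma pint_split g t s : tame g -> 0 <= t -> 0 <= s ->
  pint g (t + s) = pint g t + pint (fun u => g (t + u)) s.
Proof.
move=> tg t0 s0.
have -> : pint g t = \int[mu]_(u in `[0, t[) g u.
  rewrite /pint -Rintegral_itv_bndo_bndc //; apply: (tame_integrable (t := t)) => //.
  by apply: subset_itvl; rewrite bnd_simp.
have -> : pint (fun u => g (t + u)) s = \int[mu]_(u in `[t, t + s]) g u.
  have pre : shiftr t @^-1` `[t, t + s] = `[0, s]%classic.
    apply/seteqP; split => u /=; rewrite !in_itv /= /shiftr => /andP[h1 h2]; apply/andP; split; lra.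
  have mg : measurable_fun (`[t, t + s] : set R) (EFin \o g).
    apply/measurable_EFinP; apply: measurable_funS tg.1 => //.
    by move=> u /=; rewrite !in_itv /= andbT => /andP[+ _]; exact: le_trans.
  (* The translation formula is proved for nonnegative functions, hence the passage through positive
     and negative parts. *)
  have mp := measurable_funepos mg; have mn := measurable_funeneg mg.
  have ep := @ge0_integral_shift R t _ _ (measurable_itv _) mp (fun _ _ => funepos_ge0 _ _).
  have en := @ge0_integral_shift R t _ _ (measurable_itv _) mn (fun _ _ => funeneg_ge0 _ _).
  rewrite pre in ep en; rewrite /pint /Rintegral; congr fine.
  rewrite integralE [RHS]integralE; congr (_ - _)%E.
    by rewrite [RHS]ep; apply: eq_integral => u _; rewrite !funeposE.
  by rewrite [RHS]en; apply: eq_integral => u _; rewrite !funenegE.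
have -> : pint g (t + s) = \int[mu]_(u in `[0, t[ `|` `[t, t + s]) g u.
  congr (Rintegral _ _ _); apply/seteqP; split => u /=; rewrite !in_itv /=.
    by move=> /andP[-> ->]; case: (ltP u t) => _; [left|right].
  case=> /andP[h1 h2]; apply/andP; split; lra.
rewrite Rintegral_setU //.
  apply: (tame_integrable (t := t + s)) => //; first exact: measurableU.
  move=> u /= [] /=; rewrite !in_itv /= => /andP[h1 h2]; apply/andP; split; lra.
rewrite disj_set2E; apply/eqP/seteqP; split => u //= []; rewrite !in_itv /=.
by move=> /andP[_ h1] /andP[h2 _]; move: (lt_le_trans h1 h2); rewrite ltxx.
Qed.

Lemma eq_pint_lt g h t : tame g -> tame h ->
  (forall s, 0 <= s < t -> g s = h s) -> pint g t = pint h t.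
Proof.
move=> tg th gh; rewrite /pint -!Rintegral_itv_bndo_bndc.
- by apply: eq_Rintegral => s; rewrite inE /= in_itv /=; exact: gh.
- apply: (tame_integrable (t := t)) => //.
  by apply: subset_itvl; rewrite bnd_simp.
- apply: (tame_integrable (t := t)) => //.
  by apply: subset_itvl; rewrite bnd_simp.
Qed.

(** In the norm weighted by [expR (- 2 L s)], integration followed by multiplication by [L]
    contracts by one half. This single estimate drives both the Picard iteration and uniqueness. *)
Lemma gronwall_step g (L C T : R) : 0 < L -> 0 <= C -> tame g ->
  (forall s, 0 <= s <= T -> g s <= C * expR (2 * L * s)) ->
  forall t, 0 <= t <= T -> L * pint g t <= C / 2 * expR (2 * L * t).
Proof.
move=> L0 C0 tg gC t /andP[t0 tT].
have h : pint g t <= C * pint (fun s => expR (2 * L * s)) t.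
  rewrite -pintZ; last exact: tame_expR.
  apply: le_pint => //; first exact/tameZ/tame_expR.
  by move=> s /andP[s0 st]; apply: gC; rewrite s0 (le_trans st).
have L20 : 0 < 2 * L by rewrite mulr_gt0.
rewrite pint_expR // in h.
have e : C * ((expR (2 * L * t) - 1) / (2 * L)) = (C / 2 * (expR (2 * L * t) - 1)) / L.
  by field; rewrite gt_eqF.
rewrite e ler_pdivlMr // mulrC in h.
by apply: le_trans h _; rewrite ler_wpM2l ?divr_ge0 //; lra.
Qed.

(** Iterating [gronwall_step] improves a bound [D] on [g] to [D / 2 ^+ k * expR (2 * L * t)] for
    every [k]. *)
Lemma gronwall0 g (L T : R) : 0 < L -> tame g ->
  (forall s, 0 <= g s) ->
  (forall t, 0 <= t <= T -> g t <= L * pint g t) ->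
  forall t, 0 <= t <= T -> g t = 0.
Proof.
move=> L0 tg g0 gL; have [D hD] := tg.2 T.
have D0 t : 0 <= t <= T -> 0 <= D by move=> /hD; apply: le_trans.
have h k : forall t, 0 <= t <= T -> g t <= D / 2 ^+ k * expR (2 * L * t).
  elim: k => [|k ih] t tT.
    rewrite expr0 divr1; apply: le_trans (le_trans (ler_norm _) (hD _ tT)) _.
    rewrite ler_peMr ?(D0 _ tT) // -expR0 ler_expR.
    by case/andP: tT => t0 _; rewrite !mulr_ge0 // ltW.
  apply: le_trans (gL _ tT) _.
  have := gronwall_step L0 _ tg ih tT.
  rewrite exprSr invfM mulrA; apply.
  by rewrite divr_ge0 ?(D0 _ tT) // exprn_ge0.
move=> t tT; apply/eqP; rewrite eq_le g0 andbT.
have c : (fun k => (D * expR (2 * L * t)) * (2^-1 : R) ^+ k) @ \oo --> (0 : R).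
  rewrite -[X in _ --> X](mulr0 (D * expR (2 * L * t))).
  apply: cvgM; first exact: cvg_cst.
  by apply: cvg_expr; rewrite ger0_norm // invf_lt1 // ltr1n.
apply: (ler_cvg_to (cvg_cst _) c); apply: nearW => k; have := h k _ tT.
by rewrite exprVn mulrAC.
Qed.

End IntegralSplit.

(** * Coordinates and the Euclidean scalar product *)

Section RowVectors.
Context {R : realType} {n : nat}.
Implicit Types (x y z p : 'rV[R]_n).

Lemma rv_norm_coord x i : `|x 0 i| <= `|x|.
Proof.
have -> : `|x| = mx_norm x by [].
by rewrite mx_normrE (le_bigmax _ (fun ij => `|x ij.1 ij.2|) (0, i)).
Qed.

Lemma rv_norm_le x c : 0 <= c -> (forall i, `|x 0 i| <= c) -> `|x| <= c.
Proof.
move=> c0 h; have -> : `|x| = mx_norm x by [].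
by rewrite mx_normrE bigmax_le // => -[i j] _ /=; rewrite ord1.
Qed.

Lemma rv_norm_ge0 x : 0 <= `|x|.
Proof. exact: normr_ge0. Qed.

Lemma dotC x y : dot x y = dot y x.
Proof. by apply: eq_bigr => i _; rewrite mulrC. Qed.

Lemma dotDl x y z : dot (x + y) z = dot x z + dot y z.
Proof. by rewrite -big_split; apply: eq_bigr => i _; rewrite mxE mulrDl. Qed.

Lemma dotZl c x z : dot (c *: x) z = c * dot x z.
Proof. by rewrite /dot mulr_sumr; apply: eq_bigr => i _; rewrite mxE mulrA. Qed.

Lemma dotNl x z : dot (- x) z = - dot x z.
Proof. by rewrite -scaleN1r dotZl mulN1r. Qed.

Lemma dotBl x y z : dot (x - y) z = dot x z - dot y z.
Proof. by rewrite dotDl dotNl. Qed.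

Lemma dotDr x y z : dot z (x + y) = dot z x + dot z y.
Proof. by rewrite dotC dotDl !(dotC z). Qed.

Lemma dotZr c x z : dot z (c *: x) = c * dot z x.
Proof. by rewrite dotC dotZl dotC. Qed.

Lemma dotNr x z : dot z (- x) = - dot z x.
Proof. by rewrite dotC dotNl dotC. Qed.

Lemma dotBr x y z : dot z (x - y) = dot z x - dot z y.
Proof. by rewrite dotDr dotNr. Qed.

Lemma dot0l z : dot 0 z = 0.
Proof. by rewrite /dot big1 // => i _; rewrite mxE mul0r. Qed.

Lemma dot_ge0 x : 0 <= dot x x.
Proof. by apply: sumr_ge0 => i _; rewrite -expr2 sqr_ge0. Qed.

Lemma le_norm_dot x y : `|dot x y| <= n%:R * (`|x| * `|y|).
Proof.
apply: le_trans (ler_norm_sum _ _ _) _.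
rewrite mulr_natl -[n in _ *+ n]card_ord -sumr_const ler_sum // => i _.
by rewrite normrM ler_pM ?rv_norm_coord.
Qed.

Lemma enorm_ge0 x : 0 <= enorm x.
Proof. exact: sqrtr_ge0. Qed.

Lemma sqr_enorm x : enorm x ^+ 2 = dot x x.
Proof. by rewrite sqr_sqrtr ?dot_ge0. Qed.

Lemma norm_le_enorm x : `|x| <= enorm x.
Proof.
apply: rv_norm_le (enorm_ge0 x) _ => i.
rewrite -(ler_pXn2r (_ : 0 < 2)%N) ?nnegrE ?enorm_ge0 //.
rewrite sqr_enorm real_normK ?num_real // /dot (bigD1 i) //= expr2 lerDl.
by apply: sumr_ge0 => j _; rewrite -expr2 sqr_ge0.
Qed.

Lemma sqr_norm_le_dot x : `|x| ^+ 2 <= dot x x.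
Proof. by rewrite -sqr_enorm ler_pXn2r ?nnegrE ?enorm_ge0 ?norm_le_enorm. Qed.

Lemma dot_le_norm x : dot x x <= n%:R * `|x| ^+ 2.
Proof.
apply: le_trans (ler_norm _) _; apply: le_trans (le_norm_dot _ _) _.
by rewrite expr2.
Qed.

Lemma enorm_le_norm x : enorm x <= n%:R * `|x|.
Proof.
rewrite -(ler_pXn2r (_ : 0 < 2)%N) ?nnegrE ?enorm_ge0 ?mulr_ge0 //.
rewrite sqr_enorm exprMn; apply: le_trans (dot_le_norm _) _.
rewrite ler_wpM2r ?sqr_ge0 //; case: (n) => [|k]; first by rewrite expr0n.
by rewrite expr2 ler_peMr // ler1n.
Qed.

Lemma rv_continuous (S : set R) (y : R -> 'rV[R]_n) :
  (forall t, S t -> exists C r : R, 0 < r /\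
     forall s, S s -> `|s - t| < r -> `|y s - y t| <= C * `|s - t|) ->
  {within S, continuous y}.
Proof.
move=> h; apply/subspace_continuousP => t St; have [C [r [r0 hC]]] := h t St.
apply/cvgrPdist_lt => e e0.
have d0 : 0 < Num.min r (e / (`|C| + 1)) by rewrite lt_min r0 divr_gt0 // ltr_wpDl.
rewrite /= near_withinE; apply/nbhs_ballP; exists (Num.min r (e / (`|C| + 1))) => //= s.
rewrite /ball /= distrC lt_min => /andP[sr se] Ss.
rewrite distrC; apply: le_lt_trans (hC _ Ss sr) _.
move: se; rewrite ltr_pdivlMr ?ltr_wpDl // => se; apply: le_lt_trans se.
by rewrite mulrC ler_wpM2l //; apply: le_trans (ler_norm _) _; rewrite lerDl.
Qed.

Lemma coord_within (S : set R) (y : R -> 'rV[R]_n) i :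
  {within S, continuous y} -> {within S, continuous (fun t => y t 0 i)}.
Proof.
move=> cy t; apply: (@continuous_comp _ _ _ (y : subspace S -> 'rV[R]_n) (fun M : 'rV[R]_n => M 0 i)); first exact: cy.
exact: coord_continuous.
Qed.

End RowVectors.

(** * Measurability of continuous functions of measurable vector functions *)

Section MeasurableComposition.
Context {R : realType} {n m : nat}.

(** Balls of the sup norm are boxes, hence finite intersections of conditions on single
    coordinates. *)
Lemma measurable_box (k : nat) (D : set R) (v : R -> 'rV[R]_k) (c : 'rV[R]_k) (r : R) :
  measurable D -> (forall i, measurable_fun D (fun s => v s 0 i)) ->
  measurable (D `&` [set s | ball c r (v s)]).
Proof.
move=> mD mv; have [r0|r0] := ltP 0 r; last first.
  rewrite (_ : _ `&` _ = set0) //; apply/seteqP; split => // s [_ /=] [].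
  by rewrite ltNge r0.
rewrite (_ : _ `&` _ = D `&` \bigcap_(i in [set: 'I_k]) (D `&` (fun s => v s 0 i) @^-1` `]c 0 i - r, c 0 i + r[)).
  apply: measurableI => //; apply: fin_bigcap_measurable => // i _.
  exact: mv.
apply/seteqP; split => s [Ds /=].
  move=> [_ h]; split => // i _; split => //=; rewrite in_itv /=.
  by have := h 0 i; rewrite /ball /= ltr_distlC.
move=> h; split => //; split => // i j; rewrite ord1.
by have [_] := h j I; rewrite /= in_itv /= /ball /= ltr_distlC.
Qed.

Lemma rat_rv_dense (k : nat) (x : 'rV[R]_k) (e : R) : 0 < e ->
  exists q : 'rV[rat]_k, ball (map_mx ratr q : 'rV[R]_k) e x.
Proof.
move=> e0; have h i : {q : rat | ratr q \in `]x 0 i - e, x 0 i + e[}.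
  apply/cid/rat_in_itvoo; lra.
exists (\row_i sval (h i)); split => // i j; rewrite ord1 !mxE.
have := svalP (h j); rewrite in_itv /= /ball /= ltr_distl => /andP[h1 h2].
by apply/andP; split; lra.
Qed.

(** Continuity of [g] is only relative to [S], so the preimage of a ray is the trace on [S] of an
    open set [V] of the product. [V] is the union of the products of balls with rational centres and
    radius [1 / (k + 1)] that it contains; these are countably many, which reduces the claim to
    boxes. *)
Lemma measurable_comp_rv (D : set R) (v : R -> 'rV[R]_n) (w : R -> 'rV[R]_m)
  (S : set ('rV[R]_n * 'rV[R]_m)) (g : 'rV[R]_n * 'rV[R]_m -> R) :
  measurable D -> (forall i, measurable_fun D (fun s => v s 0 i)) ->
  (forall i, measurable_fun D (fun s => w s 0 i)) ->
  (forall s, D s -> S (v s, w s)) -> {within S, continuous g} ->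
  measurable_fun D (fun s => g (v s, w s)).
Proof.
move=> mD mv mw DS cg.
apply: (measurability _ (RGenOInfty.measurableE R)) => _ [_ [c ->] <-].
have : open ((g : subspace S -> R) @^-1` `]c, +oo[%classic).
  by move/continuousP : cg; apply; exact: interval_open.
move=> /open_subspaceP [V oV VS].
have -> : D `&` (fun s => g (v s, w s)) @^-1` `]c, +oo[ =
    D `&` [set s | V (v s, w s)].
  move/seteqP: VS => [VS1 VS2].
  apply/seteqP; split => s [Ds h]; split => //; have Ss := DS _ Ds.
    by have [] := VS2 (v s, w s) (conj h Ss).
  by have [] := VS1 (v s, w s) (conj h Ss).
pose I := ('rV[rat]_n * 'rV[rat]_m * nat)%type.
pose B (i : I) := D `&` [set s | ball (map_mx ratr i.1.1 : 'rV[R]_n) i.2.+1%:R^-1 (v s)] `&`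
   (D `&` [set s | ball (map_mx ratr i.1.2 : 'rV[R]_m) i.2.+1%:R^-1 (w s)]).
pose ok (i : I) := forall x y, ball (map_mx ratr i.1.1 : 'rV[R]_n) i.2.+1%:R^-1 x ->
  ball (map_mx ratr i.1.2 : 'rV[R]_m) i.2.+1%:R^-1 y -> V (x, y).
rewrite (_ : _ `&` _ = \bigcup_i (if `[< ok i >] then B i else set0)).
  apply: countable_bigcupT_measurable; first exact: countableP.
  move=> i; case: asboolP => // _; apply: measurableI; exact: measurable_box.
apply/seteqP; split => s /=.
  move=> [Ds Vs]; move: oV; rewrite openE => /(_ _ Vs) /nbhs_ballP [e /= e0 eV].
  pose k := Num.truncn (2 / e).
  have ke : (k.+1%:R^-1 : R) < e / 2.
    rewrite invf_plt ?posrE ?divr_gt0 // invf_div.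
    exact: truncnS_gt.
  have k0 : (0 : R) < k.+1%:R^-1 by rewrite invr_gt0.
  have [p hp] := rat_rv_dense (v s) k0; have [q hq] := rat_rv_dense (w s) k0.
  exists (p, q, k) => //; rewrite ifT; first by split; split.
  apply/asboolP => x y /= hx hy; apply: eV; split => /=.
    by rewrite (splitr e); apply: (ball_triangle (y := map_mx ratr p : 'rV[R]_n)); apply: le_ball (ltW ke) _ _; [exact: ball_sym|].
  by rewrite (splitr e); apply: (ball_triangle (y := map_mx ratr q : 'rV[R]_m)); apply: le_ball (ltW ke) _ _; [exact: ball_sym|].
move=> [i _]; case: asboolP => // oki [[Ds hv] [_ hw]]; split => //=.
exact: oki.
Qed.

End MeasurableComposition.

(** Subtracting and adding [2 * K / 2 ^+ k] to [u k] gives a nondecreasing and a nonincreasing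
    sequence that enclose the limit, so the rate comes together with the convergence. *)
Lemma cvg_geometric_step (R : realType) (u : nat -> R) (K : R) :
  (forall k, `|u k.+1 - u k| <= K / 2 ^+ k) ->
  forall k, `|u k - limn u| <= 2 * K / 2 ^+ k.
Proof.
move=> hu.
have K0 : 0 <= K by have := le_trans (normr_ge0 _) (hu 0%N); rewrite expr0 divr1.
pose a k := u k - 2 * K / 2 ^+ k; pose b k := u k + 2 * K / 2 ^+ k.
have step k : 2 * K / 2 ^+ k - 2 * K / 2 ^+ k.+1 = K / 2 ^+ k.
  by rewrite exprS; field; rewrite expf_neq0.
have ha : nondecreasing_seq a.
  apply/nondecreasing_seqP => k; rewrite /a; have := hu k; have := step k.
  rewrite ler_norml => + /andP[]; lra.
have hb : nonincreasing_seq b.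
  apply/nonincreasing_seqP => k; rewrite /b; have := hu k; have := step k.
  rewrite ler_norml => + /andP[]; lra.
have p0 k : 0 <= 2 * K / 2 ^+ k by rewrite divr_ge0 ?exprn_ge0 ?mulr_ge0.
have ab j k : a j <= b k.
  apply: (le_trans (ha _ _ (leq_maxl j k))).
  apply: (@le_trans _ _ (b (maxn j k))); last exact/hb/leq_maxr.
  by rewrite /a /b; have := p0 (maxn j k); lra.
pose L := sup (range a).
have hs : has_sup (range a) by split; [exists (a 0%N), 0%N | exists (b 0%N) => _ [j _ <-]].
have aL k : a k <= L by apply: ub_le_sup; [exact: hs.2 | exists k].
have Lb k : L <= b k by apply: sup_le_ub; [exact: hs.1 | move=> _ [j _ <-]].
have uL k : `|u k - L| <= 2 * K / 2 ^+ k.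
  by rewrite ler_norml; have := aL k; have := Lb k; rewrite /a /b => ? ?; apply/andP; split; lra.
suff -> : limn u = L by [].
apply/cvg_lim => //; apply/cvgrPdist_le => e e0.
have c : (fun k => (2 * K) * (2^-1 : R) ^+ k) @ \oo --> (0 : R).
  rewrite -[X in _ --> X](mulr0 (2 * K)).
  apply: cvgM; first exact: cvg_cst.
  by apply: cvg_expr; rewrite ger0_norm // invf_lt1 // ltr1n.
move/cvgrPdist_le : c => /(_ _ e0); apply: filterS => k.
rewrite sub0r normrN ger0_norm exprVn // distrC; exact: le_trans.
Qed.

Section Standing.
Context {R : realType} {n m : nat} {f : 'rV[R]_n -> 'rV[R]_m -> 'rV[R]_n}
  {l : 'rV[R]_n -> 'rV[R]_m -> R} {A : set 'rV[R]_m} {T : set 'rV[R]_n}.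
Context (sa : standing_assumptions f l A T).
Implicit Types (x : 'rV[R]_n) (alpha : R -> 'rV[R]_m) (y z : R -> 'rV[R]_n).

(** The hypotheses are stated with the Euclidean norm. This lemma and the next move them to the sup
    norm, at the cost of the factor [n] of [enorm_le_norm]. *)
Lemma f_growth : exists2 M : R, 0 < M &
  forall x a, A a -> `|f x a| <= M * (1 + `|x|).
Proof.
have [_ [_ [_ [_ [_ [[M M0 hM] _]]]]]] := sa.
exists (M * (n%:R + 1)) => [|x a Aa]; first by rewrite mulr_gt0 // ltr_wpDl.
apply: le_trans (norm_le_enorm _) _; apply: le_trans (hM _ _ Aa) _.
rewrite -mulrA ler_wpM2l ?(ltW M0) //.
have := enorm_le_norm x; have := rv_norm_ge0 x; have : 0 <= n%:R :> R by []; lra.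
Qed.

Lemma fl_lipschitz r : exists2 L : R, 0 < L & forall x1 x2 a,
  `|x1| <= r -> `|x2| <= r -> A a ->
  `|f x1 a - f x2 a| <= L * `|x1 - x2| /\ `|l x1 a - l x2 a| <= L * `|x1 - x2|.
Proof.
have [_ [_ [_ [_ [_ [_ hL]]]]]] := sa.
have r1 : 0 < n%:R * `|r| + 1 by rewrite ltr_wpDl // mulr_ge0.
have [L L0 {}hL] := hL _ r1.
exists (L * (n%:R + 1)) => [|x1 x2 a h1 h2 Aa]; first by rewrite mulr_gt0 // ltr_wpDl.
have e x : `|x| <= r -> enorm x <= n%:R * `|r| + 1.
  move=> xr; apply: le_trans (enorm_le_norm x) _.
  have : n%:R * `|x| <= n%:R * `|r| :> R.
    by rewrite ler_wpM2l //; apply: le_trans xr (ler_norm _).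
  lra.
have [hf hl] := hL _ _ _ (e _ h1) (e _ h2) Aa.
have E : L * enorm (x1 - x2) <= L * (n%:R + 1) * `|x1 - x2|.
  rewrite -mulrA ler_wpM2l ?(ltW L0) //; have := enorm_le_norm (x1 - x2).
  by have := rv_norm_ge0 (x1 - x2); lra.
split; last exact: le_trans hl E.
by apply: le_trans (norm_le_enorm _) _; apply: le_trans hf E.
Qed.

Lemma l_ge0 x a : A a -> 0 <= l x a.
Proof. by have [_ [_ [_ [_ [+ _]]]]] := sa; apply. Qed.

Lemma fl_within (x : 'rV[R]_n) : {within A, continuous (l x)} /\
  {within A, continuous (f x)}.
Proof.
have [_ [_ [cf [cl _]]]] := sa.
split; apply/subspace_continuousP => a Aa.
  move/subspace_continuousP: cl => /(_ (x, a)) /= => /(_ (conj I Aa)) h.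
  apply: cvg_trans h; move=> P /= [[U V] /= [hU hV] UV].
  rewrite /nbhs /= /within /=; apply: filterS hV => b Vb Ab.
  by apply: (UV (x, b)) => //; split => //=; exact: nbhs_singleton.
move/subspace_continuousP: cf => /(_ (x, a)) /= => /(_ (conj I Aa)) h.
apply: cvg_trans h; move=> P /= [[U V] /= [hU hV] UV].
rewrite /nbhs /= /within /=; apply: filterS hV => b Vb Ab.
by apply: (UV (x, b)) => //; split => //=; exact: nbhs_singleton.
Qed.

Lemma l_bounded r : exists2 C : R, 0 < C & forall x a, `|x| <= r -> A a -> l x a <= C.
Proof.
have [[cA A0] _] := sa.
have cl0 : {within A, continuous (l 0)} := (fl_within 0).1.
have [c _ hc] := compact_EVT_max A0 cA cl0.
have [L L0 hL] := fl_lipschitz `|r|.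
exists (`|l 0 c| + L * `|r| + 1) => [|x a xr Aa].
  by rewrite ltr_wpDl // addr_ge0 // mulr_ge0 // ltW.
have x0 : `|x| <= `|r| := le_trans xr (ler_norm r).
have [] := hL x 0 a x0 _ Aa; first by rewrite normr0.
move=> _; rewrite subr0 ler_norml => /andP[_ h].
have h2 := hc a (mem_set Aa); have h3 := ler_norm (l 0 c).
have h4 : L * `|x| <= L * `|r| by rewrite ler_wpM2l // ltW.
lra.
Qed.

Lemma tame_comp alpha y (g : 'rV[R]_n * 'rV[R]_m -> R) :
  controls A alpha -> {within `[0, +oo[, continuous y} ->
  {within setT `*` A, continuous g} ->
  (forall r, exists C : R, forall x a, `|x| <= r -> A a -> `|g (x, a)| <= C) ->
  tame (fun s => g (y s, alpha s)).
Proof.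
move=> [ma Aa] cy cg bg; split.
  apply: (measurable_comp_rv (S := setT `*` A)) => // [i|s /= ].
    have [h _] := tame_continuous (coord_within (i := i) cy); exact: h.
  by rewrite in_itv /= andbT => s0; split => //=; exact: Aa.
move=> t.
have [r hr] : exists r : R, forall s, 0 <= s <= t -> `|y s| <= r.
  have [r hr] : exists r : R, forall s, 0 <= s <= t -> \sum_(i < n) `|y s 0 i| <= r.
    have h : tame (fun s => \sum_(i < n) `|y s 0 i|).
      by apply: tame_sum => i; apply/tame_norm/tame_continuous/coord_within.
    by have [C hC] := h.2 t; exists C => s /hC; apply: le_trans; exact: ler_norm.
  exists r => s st; apply: le_trans (hr _ st); apply: rv_norm_le.
    exact: sumr_ge0.
  by move=> i; rewrite (bigD1 i) //= lerDl sumr_ge0.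
have [C hC] := bg r; exists C => s st; apply: hC; first exact: hr.
by apply: Aa; case/andP: st.
Qed.

Lemma tame_f alpha y i : controls A alpha -> {within `[0, +oo[, continuous y} ->
  tame (fun s => f (y s) (alpha s) 0 i).
Proof.
move=> ca cy; apply: (tame_comp (g := fun w => f w.1 w.2 0 i) ca cy).
  have [_ [_ [cf _]]] := sa.
  move=> z; apply: (@continuous_comp _ _ _ (_ : subspace _ -> 'rV[R]_n) (fun M : 'rV[R]_n => M 0 i)); first exact: cf.
  exact: coord_continuous.
have [M M0 hM] := f_growth; move=> r; exists (M * (1 + r)) => x a xr Aa.
apply: le_trans (rv_norm_coord _ _) _; apply: le_trans (hM _ _ Aa) _.
by rewrite ler_wpM2l ?(ltW M0) // lerD2l.
Qed.

Lemma tame_l alpha y : controls A alpha -> {within `[0, +oo[, continuous y} ->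
  tame (fun s => l (y s) (alpha s)).
Proof.
move=> ca cy; apply: (tame_comp (g := fun w => l w.1 w.2) ca cy).
  by have [_ [_ [_ [cl _]]]] := sa.
move=> r; have [C C0 hC] := l_bounded r; exists C => x a xr Aa /=.
by rewrite ger0_norm ?l_ge0 // hC.
Qed.

End Standing.

(** * Trajectories *)

Section ODE.
Context {R : realType} {n m : nat} {f : 'rV[R]_n -> 'rV[R]_m -> 'rV[R]_n}
  {l : 'rV[R]_n -> 'rV[R]_m -> R} {A : set 'rV[R]_m} {T : set 'rV[R]_n}.
Context (sa : standing_assumptions f l A T).
Implicit Types (x : 'rV[R]_n) (alpha : R -> 'rV[R]_m) (y z : R -> 'rV[R]_n).

Lemma pint_lip (g : R -> R) (t0 C s t : R) : tame g ->
  (forall u, 0 <= u <= t0 -> `|g u| <= C) -> 0 <= s <= t0 -> 0 <= t <= t0 ->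
  `|pint g s - pint g t| <= C * `|s - t|.
Proof.
move=> tg gC; wlog st : s t / s <= t.
  move=> h hs ht; have [st|/ltW ts] := leP s t; first exact: h.
  by rewrite distrC [`|s - t|]distrC; exact: h.
move=> /andP[s0 s1] /andP[t00 t1]; rewrite distrC [`|s - t|]distrC.
have ts0 : 0 <= t - s by rewrite subr_ge0.
rewrite -[t in pint g t](subrKC s) pint_split // addrAC subrr add0r.
rewrite (ger0_norm ts0); apply: pint_norm_le => //; first exact: tame_shift.
by move=> u /andP[u0 u1]; apply: gC; rewrite addr_ge0 //=; lra.
Qed.

Definition picard x alpha y : R -> 'rV[R]_n :=
  fun t => \row_i (x 0 i + pint (fun s => f (y s) (alpha s) 0 i) t).

Section Picard.
Context (x : 'rV[R]_n) (alpha : R -> 'rV[R]_m) (M : R).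
Context (ca : controls A alpha) (M0 : 0 < M).
Context (hM : forall x a, A a -> `|f x a| <= M * (1 + `|x|)).

Let E t := (1 + `|x|) * expR (M * t).

(** The exponential bound is invariant under the Picard operator, so all the iterates stay in one
    ball on [[0, t0]] and share one Lipschitz constant there. *)
Let good y := {within `[0, +oo[, continuous y} /\ forall t, 0 <= t -> 1 + `|y t| <= E t.

Let E_homo s t : s <= t -> E s <= E t.
Proof.
move=> st; rewrite ler_wpM2l ?addr_ge0 ?rv_norm_ge0 // ler_expR.
by rewrite ler_wpM2l // ltW.
Qed.

Let good_f y s : good y -> 0 <= s -> `|f (y s) (alpha s)| <= M * E s.
Proof.
move=> [_ h] s0; apply: le_trans (hM _ (ca.2 _ s0)) _.
by rewrite ler_wpM2l ?(ltW M0) // h.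
Qed.

Lemma picard_lip y t0 s t : good y -> 0 <= s <= t0 -> 0 <= t <= t0 ->
  `|picard x alpha y s - picard x alpha y t| <= M * E t0 * `|s - t|.
Proof.
move=> gy hs ht.
have ME : 0 <= M * E t0 by rewrite !mulr_ge0 ?(ltW M0) ?addr_ge0 ?expR_ge0.
apply: rv_norm_le; first by rewrite mulr_ge0.
move=> i; rewrite !mxE opprD addrACA subrr add0r.
apply: (pint_lip (t0 := t0)) => //; first exact: (tame_f sa _ ca gy.1).
move=> u /andP[u0 u1]; apply: le_trans (rv_norm_coord _ _) _.
apply: le_trans (good_f gy u0) _.
by rewrite ler_wpM2l ?(ltW M0) // E_homo.
Qed.

Lemma picard_good y : good y -> good (picard x alpha y).
Proof.
move=> gy; split.
  apply: rv_continuous => t; rewrite /= in_itv /= andbT => t0.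
  exists (M * E (t + 1)), 1; split => // s; rewrite /= in_itv /= andbT => s0 st.
  apply: picard_lip => //; rewrite ?t0 ?s0 /= ?lerDl //.
  by move: st; rewrite ltr_norml; lra.
move=> t t0; rewrite -lerBrDl; apply: rv_norm_le.
  rewrite subr_ge0; apply: le_trans (_ : 1 <= 1 + `|x|) _; first by rewrite lerDl.
  by rewrite /E ler_peMr ?addr_ge0 // -[leLHS]expR0 ler_expR mulr_ge0 // ltW.
move=> i; rewrite !mxE; apply: le_trans (ler_normD _ _) _.
have tfi := tame_f sa i ca gy.1.
have h : `|pint (fun s => f (y s) (alpha s) 0 i) t| <= (1 + `|x|) * (expR (M * t) - 1).
  apply: le_trans (le_norm_pint _ tfi) _.
  apply: (@le_trans _ _ (pint (fun s => M * (1 + `|x|) * expR (M * s)) t)).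
    apply: le_pint; [exact: tame_norm | exact/tameZ/tame_expR |].
    move=> s /andP[s0 st]; apply: le_trans (rv_norm_coord _ _) _.
    by rewrite -mulrA; exact: good_f.
  rewrite pintZ ?pint_expR //; last exact: tame_expR.
  by rewrite le_eqVlt; apply/orP; left; apply/eqP; field; rewrite gt_eqF.
have hx := rv_norm_coord x i.
by rewrite /E; lra.
Qed.

Let yk k := iter k (picard x alpha) (fun _ => x).

Let yk_good k : good (yk k).
Proof.
elim: k => [|k ih]; last exact: picard_good.
split; first by apply: continuous_subspaceT => t; exact: cvg_cst.
move=> t t0; rewrite /E ler_peMr ?addr_ge0 //.
by rewrite -[leLHS]expR0 ler_expR mulr_ge0 // ltW.
Qed.

Lemma tame_rv_norm y : {within `[0, +oo[, continuous y} -> tame (fun s => `|y s|).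
Proof.
move=> cy; apply: tame_continuous => t.
by apply: (@continuous_comp _ _ _ (y : subspace _ -> 'rV[R]_n)); [exact: cy | exact: norm_continuous].
Qed.

Lemma tame_dist y z : {within `[0, +oo[, continuous y} ->
  {within `[0, +oo[, continuous z} -> tame (fun s => `|y s - z s|).
Proof.
move=> cy cz; apply: tame_rv_norm => t.
by apply: (@continuousB _ _ _ (y : subspace _ -> 'rV[R]_n)); [exact: cy | exact: cz].
Qed.

Lemma picard_dist (y z : R -> 'rV[R]_n) (r L t : R) :
  (forall x1 x2 a, `|x1| <= r -> `|x2| <= r -> A a ->
    `|f x1 a - f x2 a| <= L * `|x1 - x2|) ->
  {within `[0, +oo[, continuous y} -> {within `[0, +oo[, continuous z} ->
  (forall s, 0 <= s <= t -> `|y s| <= r /\ `|z s| <= r) -> 0 <= L -> 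
  `|picard x alpha y t - picard x alpha z t| <= L * pint (fun s => `|y s - z s|) t.
Proof.
move=> hL cy cz hr L0; have td := tame_dist cy cz.
apply: rv_norm_le.
  by rewrite mulr_ge0 // /pint Rintegral_ge0.
move=> i; rewrite !mxE opprD addrACA subrr add0r.
have t1 := tame_f sa i ca cy; have t2 := tame_f sa i ca cz.
rewrite -pintB //; apply: le_trans (le_norm_pint _ (tameB t1 t2)) _.
rewrite -pintZ //; apply: le_pint; [exact/tame_norm/tameB | exact: tameZ |].
move=> s st; have [h1 h2] := hr s st.
have := hL _ _ _ h1 h2 (ca.2 s (proj1 (andP st))); apply: le_trans.
by have := rv_norm_coord (f (y s) (alpha s) - f (z s) (alpha s)) i; rewrite !mxE.
Qed.

(** The weighted contraction holds on every [[0, t0]], so the iterates converge on the whole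
    half-line and no local solutions have to be continued. *)
Lemma ode_exists : exists y, solves_ode f x alpha y /\
  forall t, 0 <= t -> 1 + `|y t| <= (1 + `|x|) * expR (M * t).
Proof.
pose y t : 'rV[R]_n := \row_i limn (fun k => yk k t 0 i).
have E0 t : 0 <= E t by rewrite mulr_ge0 ?addr_ge0 ?expR_ge0.
have key t0 : exists2 K, 0 <= K & forall t k, 0 <= t <= t0 -> `|yk k t - y t| <= K / 2 ^+ k.
  have [L L0 hL] := fl_lipschitz sa (E t0).
  have bd k s : 0 <= s <= t0 -> `|yk k s| <= E t0.
    move=> /andP[s0 st]; apply: (@le_trans _ _ (E s)); last exact: E_homo.
    by apply: le_trans ((yk_good k).2 _ s0); rewrite lerDr.
  have st k : forall t, 0 <= t <= t0 -> `|yk k.+1 t - yk k t| <= 2 * E t0 / 2 ^+ k * expR (2 * L * t).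
    elim: k => [|k ih] t tt.
      rewrite expr0 divr1; apply: (@le_trans _ _ (2 * E t0)).
        by apply: le_trans (ler_normB _ _) _; rewrite mulr_natl mulr2n lerD // bd.
      rewrite ler_peMr ?mulr_ge0 // -[leLHS]expR0 ler_expR !mulr_ge0 ?(ltW L0) //.
      by case/andP: tt.
    have hs s : 0 <= s <= t -> 0 <= s <= t0.
      by case/andP: tt => _ h /andP[-> h2] /=; exact: le_trans h.
    apply: le_trans (picard_dist (r := E t0) (L := L) _ (yk_good k.+1).1 (yk_good k).1 _ _) _.
    - by move=> x1 x2 a h1 h2 Aa; have [] := hL _ _ _ h1 h2 Aa.
    - by move=> s /hs h; split; exact: bd.
    - exact: ltW.
    rewrite [2 ^+ k.+1]exprSr invfM [_ * (_^-1 * _^-1)]mulrA.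
    apply: gronwall_step tt => //; first by rewrite divr_ge0 ?exprn_ge0 ?mulr_ge0.
    exact: (tame_dist (yk_good k.+1).1 (yk_good k).1).
  (* The weight is bounded by its value at [t0], which makes the rate uniform on the interval. *)
  exists (2 * (2 * E t0 * expR (2 * L * t0))); first by rewrite !mulr_ge0 ?expR_ge0.
  move=> t k tt; apply: rv_norm_le.
    by rewrite divr_ge0 ?exprn_ge0 ?mulr_ge0 ?expR_ge0.
  move=> i; rewrite !mxE; apply: (cvg_geometric_step (u := fun k => yk k t 0 i)) => j.
  apply: (@le_trans _ _ (2 * E t0 / 2 ^+ j * expR (2 * L * t))).
    by apply: le_trans (st _ _ tt); have := rv_norm_coord (yk j.+1 t - yk j t) i; rewrite !mxE.
  rewrite mulrAC ler_wpM2r ?invr_ge0 ?exprn_ge0 // ler_wpM2l ?mulr_ge0 //.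
  by rewrite ler_expR ler_wpM2l ?mulr_ge0 ?(ltW L0) //; case/andP: tt.
have lim0 K (a b : R) : (forall k, a <= b + K / 2 ^+ k) -> a <= b.
  move=> h.
  have c : (fun k => b + K * (2^-1 : R) ^+ k) @ \oo --> b.
    rewrite -[X in _ --> X]addr0 -[X in _ --> _ + X](mulr0 K).
    apply: cvgD; first exact: cvg_cst.
    apply: cvgM; first exact: cvg_cst.
    by apply: cvg_expr; rewrite ger0_norm // invf_lt1 // ltr1n.
  apply: (ler_cvg_to (cvg_cst _) c); apply: nearW => k.
  by rewrite exprVn.
have bd t : 0 <= t -> 1 + `|y t| <= E t.
  move=> t0; have [K K0 hK] := key t; apply: (lim0 K) => k.
  have := hK t k; rewrite t0 lexx => /(_ isT) h.
  have h2 := (yk_good k).2 t t0.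
  have h3 := ler_normB (yk k t) (yk k t - y t); rewrite subKr in h3; lra.
have lip t0 s t : 0 <= s <= t0 -> 0 <= t <= t0 -> `|y s - y t| <= M * E t0 * `|s - t|.
  move=> hs ht; have [K K0 hK] := key t0; apply: (lim0 (2 * K)) => k.
  have hs1 := hK s k.+1 hs; have ht1 := hK t k.+1 ht.
  have h := picard_lip (yk_good k) hs ht.
  have -> : y s - y t = (yk k.+1 s - yk k.+1 t) - ((yk k.+1 s - y s) - (yk k.+1 t - y t)).
    by apply/rowP => i; rewrite !mxE; ring.
  apply: le_trans (ler_normB _ _) _.
  have h2 := ler_normB (yk k.+1 s - y s) (yk k.+1 t - y t).
  have h3 : 2 * K / 2 ^+ k = K / 2 ^+ k.+1 *+ 4 by rewrite exprS; field; rewrite expf_neq0.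
  have h4 : 0 <= K / 2 ^+ k.+1 by rewrite divr_ge0 ?exprn_ge0.
  apply: lerD; first exact: h.
  rewrite h3; lra.
have cy : {within `[0, +oo[, continuous y}.
  apply: rv_continuous => t; rewrite /= in_itv /= andbT => t0.
  exists (M * E (t + 1)), 1; split => // s; rewrite /= in_itv /= andbT => s0 st.
  apply: lip => //; rewrite ?t0 ?s0 /= ?lerDl //.
  by move: st; rewrite ltr_norml; lra.
exists y; split => //; split => // t t0 i.
(* The limit is a fixed point: [y t] and its Picard image are both compared with the iterate of
   index [k + 1]. *)
suff h : `|y t - picard x alpha y t| <= 0.
  by move: h; rewrite normr_le0 subr_eq0 => /eqP {1}->; rewrite mxE.
have [K K0 hK] := key t.
have [L L0 hL] := fl_lipschitz sa (E t).
apply: (lim0 (K + L * (K * t))) => k; rewrite add0r.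
have -> : y t - picard x alpha y t = (yk k.+1 t - picard x alpha y t) - (yk k.+1 t - y t).
  by apply/rowP => j; rewrite !mxE; ring.
apply: le_trans (ler_normB _ _) _.
have h1 : `|yk k.+1 t - y t| <= K / 2 ^+ k.
  have := hK t k.+1; rewrite t0 lexx => /(_ isT) /le_trans; apply.
  by rewrite ler_wpM2l // lef_pV2 ?posrE ?exprn_gt0 // exprS ler_peMl ?exprn_ge0 // ler1n.
have h2 : `|yk k.+1 t - picard x alpha y t| <= L * (K / 2 ^+ k * t).
  have bdE s : 0 <= s <= t -> `|yk k s| <= E t /\ `|y s| <= E t.
    move=> /andP[s0 st]; split; apply: (@le_trans _ _ (E s)); try exact: E_homo.
      by apply: le_trans ((yk_good k).2 _ s0); rewrite lerDr.
    by apply: le_trans (bd _ s0); rewrite lerDr.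
  apply: le_trans (picard_dist (r := E t) (L := L) _ (yk_good k).1 cy bdE (ltW L0)) _.
    by move=> x1 x2 a h1' h2' Aa; have [] := hL _ _ _ h1' h2' Aa.
  rewrite ler_wpM2l ?(ltW L0) //; apply: pint_le_cst => //.
    exact: (tame_dist (yk_good k).1 cy).
  by move=> s st; exact: hK.
apply: (le_trans (lerD h2 h1)).
by rewrite le_eqVlt; apply/orP; left; apply/eqP; ring.
Qed.

End Picard.

(** Two controls that agree before [t0] are allowed, so that uniqueness and causality are one
    statement; the integrals do not see the time [t0] itself. *)
Lemma ode_unique x alpha beta y z (t0 : R) : controls A alpha -> controls A beta ->
  (forall s, 0 <= s < t0 -> alpha s = beta s) ->
  solves_ode f x alpha y -> solves_ode f x beta z ->
  forall t, 0 <= t <= t0 -> y t = z t.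
Proof.
move=> ca cb ab [cy hy] [cz hz] t tt.
have [Cy hCy] := (tame_rv_norm cy).2 t0; have [Cz hCz] := (tame_rv_norm cz).2 t0.
pose r := Num.max Cy Cz.
have [L L0 hL] := fl_lipschitz sa r.
apply/eqP; rewrite -subr_eq0 -normr_eq0; apply/eqP.
apply: (gronwall0 (g := fun s => `|y s - z s|) (T := t0) L0) => //.
  exact: tame_dist.
move=> {tt}t /andP[t00 t1].
have -> : y t = picard x alpha y t by apply/rowP => i; rewrite mxE; exact: hy.
have -> : z t = picard x alpha z t.
  apply/rowP => i; rewrite mxE hz //; congr (_ + _).
  apply: eq_pint_lt; [exact: (tame_f sa _ cb cz) | exact: (tame_f sa _ ca cz)|].
  by move=> s /andP[s0 st]; rewrite ab // s0 (lt_le_trans st).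
apply: (picard_dist _ ca (r := r)) => //; last exact: ltW.
  by move=> x1 x2 a h1 h2 Aa; have [] := hL _ _ _ h1 h2 Aa.
move=> s /andP[s0 st]; have hs : 0 <= s <= t0 by rewrite s0 (le_trans st).
have := hCy _ hs; have := hCz _ hs; rewrite !normr_id /r !le_max => -> ->.
by rewrite orbT.
Qed.

Lemma trajectory_solves x alpha : controls A alpha ->
  solves_ode f x alpha (trajectory f x alpha).
Proof.
move=> ca; have [M M0 hM] := f_growth sa.
have [y [hy _]] := ode_exists x ca M0 hM.
by rewrite /trajectory; apply: getPex; exists y.
Qed.

Lemma trajectoryE x alpha y : controls A alpha -> solves_ode f x alpha y ->
  forall t, 0 <= t -> trajectory f x alpha t = y t.
Proof.
move=> ca hy t t0.
apply: (ode_unique (t0 := t) ca ca _ (trajectory_solves _ ca) hy) => //.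
by rewrite t0 lexx.
Qed.

Lemma trajectory_bound : exists2 M : R, 0 < M & forall x alpha t, controls A alpha ->
  0 <= t -> 1 + `|trajectory f x alpha t| <= (1 + `|x|) * expR (M * t).
Proof.
have [M M0 hM] := f_growth sa; exists M => // x alpha t ca t0.
have [y [hy by_]] := ode_exists x ca M0 hM.
by rewrite (trajectoryE ca hy) // by_.
Qed.

Lemma trajectory_continuous x alpha : controls A alpha ->
  {within `[0, +oo[, continuous (trajectory f x alpha)}.
Proof. by move=> ca; exact: (trajectory_solves x ca).1. Qed.

Lemma trajectory_eq x alpha t i : controls A alpha -> 0 <= t ->
  trajectory f x alpha t 0 i = x 0 i +
    pint (fun s => f (trajectory f x alpha s) (alpha s) 0 i) t.
Proof. by move=> ca t0; exact: (trajectory_solves x ca).2. Qed.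

Lemma trajectory0 x alpha : controls A alpha -> trajectory f x alpha 0 = x.
Proof. by move=> ca; apply/rowP => i; rewrite trajectory_eq // pint0 addr0. Qed.

Lemma trajectory_causal x alpha beta t0 : controls A alpha -> controls A beta ->
  (forall s, 0 <= s < t0 -> alpha s = beta s) ->
  forall t, 0 <= t <= t0 -> trajectory f x alpha t = trajectory f x beta t.
Proof.
move=> ca cb ab; apply: (ode_unique ca cb ab); exact: trajectory_solves.
Qed.

End ODE.

(** * Dynamic programming *)

Section DynamicProgramming.
Context {R : realType} {n m : nat} {f : 'rV[R]_n -> 'rV[R]_m -> 'rV[R]_n}
  {l : 'rV[R]_n -> 'rV[R]_m -> R} {A : set 'rV[R]_m} {T : set 'rV[R]_n}.
Context (sa : standing_assumptions f l A T).
Implicit Types (x : 'rV[R]_n) (alpha beta : R -> 'rV[R]_m) (s t r : R).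
Local Notation mu := (@lebesgue_measure R).
Local Notation traj := (trajectory f).

Definition concat alpha t beta : R -> 'rV[R]_m :=
  fun s => if s < t then alpha s else beta (s - t).

Definition running_cost x alpha t : R := pint (fun s => l (traj x alpha s) (alpha s)) t.

Definition avoids x alpha t : Prop := forall s, 0 <= s <= t -> ~ T (traj x alpha s).

Lemma measurable_shift_fun (g : R -> R) t (D E : set R) : measurable E ->
  measurable_fun E g -> (forall s, D s -> E (t + s)) ->
  measurable_fun D (fun s => g (t + s)).
Proof.
move=> mE mg DE.
apply: (@measurable_comp _ _ _ (measurableTypeR R) (measurableTypeR R) _
    E g D (shiftr t)) => //.
  by move=> _ [s Ds <-]; exact: DE.
by apply: measurable_funS (measurable_shiftr t).
Qed.

Lemma controls_shift alpha t : 0 <= t -> controls A alpha ->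
  controls A (fun s => alpha (t + s)).
Proof.
move=> t0 [ma Aa]; split => [i|s s0]; last by apply: Aa; rewrite addr_ge0.
apply: (@measurable_shift_fun (fun s => alpha s 0 i) t _ `[0, +oo[) => //.
by move=> s /=; rewrite !in_itv /= !andbT => s0; rewrite addr_ge0.
Qed.

Lemma controls_cst a : A a -> controls A (fun _ => a).
Proof. by move=> Aa; split => // i; exact: measurable_cst. Qed.

Lemma controls_concat alpha t beta : 0 <= t -> controls A alpha ->
  controls A beta -> controls A (concat alpha t beta).
Proof.
move=> t0 [ma Aa] [mb Ab]; split => [i|s s0]; last first.
  by rewrite /concat; case: ltP => st; [exact: Aa | apply: Ab; rewrite subr_ge0].
have -> : `[0, +oo[%classic = (`[0, t[ `|` `[t, +oo[ : set R).
  apply/seteqP; split => s /=; rewrite !in_itv /= !andbT.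
    by move=> ->; case: ltP => st; [left|right].
  by case=> [/andP[]//|]; exact: le_trans.
apply/measurable_funU => //; split.
  apply: (eq_measurable_fun (fun s => alpha s 0 i)).
    by move=> s; rewrite inE /= in_itv /= /concat => /andP[_ ->].
  by apply: measurable_funS (ma i) => // s /=; rewrite !in_itv /= => /andP[->].
apply: (eq_measurable_fun (fun s => beta (- t + s) 0 i)).
  by move=> s; rewrite inE /= in_itv /= andbT /concat addrC ltNge => ->.
apply: (@measurable_shift_fun (fun s => beta s 0 i) (- t) _ `[0, +oo[) => //.
by move=> s /=; rewrite !in_itv /= !andbT addrC subr_ge0.
Qed.

Lemma concat_shift alpha t : concat alpha t (fun s => alpha (t + s)) = alpha.
Proof. by apply/funext => s; rewrite /concat subrKC; case: ifP. Qed.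

Lemma traj_concat_le x alpha t beta s : controls A alpha -> controls A beta ->
  0 <= s <= t -> traj x (concat alpha t beta) s = traj x alpha s.
Proof.
move=> ca cb /andP[s0 st]; have t0 := le_trans s0 st.
apply: (trajectory_causal sa x (controls_concat t0 ca cb) ca (t0 := t)).
  by move=> u /andP[_ ut]; rewrite /concat ut.
by rewrite s0.
Qed.

Lemma within_continuous_shift (V : topologicalType) (y : R -> V) t : 0 <= t ->
  {within `[0, +oo[, continuous y} -> {within `[0, +oo[, continuous (fun s => y (t + s))}.
Proof.
move=> t0 /subspace_continuousP cy; apply/subspace_continuousP => s.
rewrite /= in_itv /= andbT => s0.
have /= := cy (t + s); rewrite in_itv /= andbT addr_ge0 // => /(_ isT) h P /h.
rewrite /nbhs /= /within /= => /nbhs_ballP [e /= e0 he].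
apply/nbhs_ballP; exists e => //= u bu; rewrite in_itv /= andbT => u0.
apply: (he (t + u)); last by rewrite in_itv /= andbT addr_ge0.
by move: bu; rewrite /ball /= opprD addrACA subrr add0r.
Qed.

Lemma traj_concat_ge x alpha t beta s : controls A alpha -> controls A beta ->
  0 <= t -> 0 <= s ->
  traj x (concat alpha t beta) (t + s) = traj (traj x alpha t) beta s.
Proof.
move=> ca cb t0 s0; have cc := controls_concat t0 ca cb.
set Y := traj x (concat alpha t beta).
apply/esym/(@trajectoryE _ _ _ _ _ _ _ sa _ _ (fun s => Y (t + s)) cb) => //.
split; first by apply: within_continuous_shift => //; exact: trajectory_continuous sa _ _ cc.
move=> u u0 i; have cY := trajectory_continuous sa (x := x) cc.
rewrite /Y (trajectory_eq sa) // ?addr_ge0 //.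
have tF := tame_f sa i cc cY.
rewrite pint_split // addrA -(trajectory_eq sa) //.
rewrite traj_concat_le // ?t0 ?lexx //; congr (_ + _).
apply: eq_pint => v /andP[v0 _].
by rewrite /concat ltNge lerDl v0 /= addrAC subrr add0r.
Qed.

Lemma traj_shift x alpha t s : controls A alpha -> 0 <= t -> 0 <= s ->
  traj (traj x alpha t) (fun u => alpha (t + u)) s = traj x alpha (t + s).
Proof.
move=> ca t0 s0; rewrite -traj_concat_ge ?concat_shift //; exact: controls_shift.
Qed.

Lemma exit_time_ge0 x alpha : (0 <= exit_time f T x alpha)%E.
Proof. by apply: le_ereal_inf_tmp => _ [s [s0 _] <-]; rewrite lee_fin. Qed.

(** The inequality is strict because the target is closed: the trajectory is still off it during a
    short interval after [t]. *)
Lemma avoids_lt_exit_time x alpha t : controls A alpha -> 0 <= t -> avoids x alpha t ->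
  (t%:E < exit_time f T x alpha)%E.
Proof.
move=> ca t0 av; have [_ [[_ cT _] _]] := sa.
have nT : nbhs (traj x alpha t) (~` T).
  by apply: open_nbhs_nbhs; split; [exact: closed_openC | apply: av; rewrite t0 lexx].
have /subspace_continuousP := trajectory_continuous sa (x := x) ca.
have t0' : `[0, +oo[%classic t by rewrite /= in_itv /= andbT.
move=> /(_ t t0') /(_ _ nT).
rewrite /nbhs /= /within /= => /nbhs_ballP [e /= e0 he].
apply: (@lt_le_trans _ _ (t + e)%:E); first by rewrite lte_fin ltrDl.
apply: le_ereal_inf_tmp => _ [s [s0 Ts] <-]; rewrite lee_fin leNgt; apply/negP => se.
have [st|ts] := leP s t; first by apply: (av s) => //; rewrite s0.
apply: (he s) => //; last by rewrite in_itv /= andbT.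
rewrite /ball /= ltr0_norm ?subr_lt0 //; lra.
Qed.

Lemma exit_time_concat x alpha t beta : controls A alpha -> controls A beta ->
  0 <= t -> avoids x alpha t ->
  exit_time f T x (concat alpha t beta) = (t%:E + exit_time f T (traj x alpha t) beta)%E.
Proof.
move=> ca cb t0 av; apply/le_anti/andP; split.
  rewrite -leeBlDl //; apply: le_ereal_inf_tmp => _ [s [s0 Ts] <-].
  rewrite leeBlDl // -EFinD; apply: ereal_inf_lbound; exists (t + s) => //.
  by split; [rewrite addr_ge0 | rewrite traj_concat_ge].
apply: le_ereal_inf_tmp => _ [s [s0 Ts] <-].
have [st|ts] := leP s t.
  by exfalso; apply: (av s); rewrite ?s0 // -(@traj_concat_le x alpha t beta) ?s0.
have e : s = t + (s - t) by rewrite subrKC.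
rewrite e EFinD leeD2l //; apply: ereal_inf_lbound; exists (s - t) => //.
by split; [rewrite subr_ge0 ltW | rewrite -traj_concat_ge // -?e // subr_ge0 ltW].
Qed.

Lemma dist_to_ge0 x : 0 <= dist_to T x.
Proof.
have [_ [[[y Ty] _ _] _]] := sa.
apply: lb_le_inf; first by exists (enorm (x - y)), y.
by move=> _ [z _ <-]; exact: enorm_ge0.
Qed.

Lemma dist_to_le x y : T y -> dist_to T x <= enorm (x - y).
Proof.
move=> Ty; apply: ge_inf; last by exists y.
by exists 0 => _ [z _ <-]; exact: enorm_ge0.
Qed.

Lemma dist_to_lt x e : dist_to T x < e -> exists2 y, T y & enorm (x - y) < e.
Proof.
have [_ [[[y Ty] _ _] _]] := sa.
move=> /inf_lt [|_ [z Tz <-] ze]; last by exists z.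
by exists (enorm (x - y)), y.
Qed.

(** This removes the filter [left_nbhs]: finite and infinite exit times obey the same criterion, in
    which [b] stands for any time before the exit. *)
Lemma admissibleP x alpha : controls A alpha ->
  admissible f A T x alpha <->
  forall (e b : R), 0 < e -> (b%:E < exit_time f T x alpha)%E ->
    exists s, [/\ b < s, (s%:E < exit_time f T x alpha)%E &
                  dist_to T (traj x alpha s) < e].
Proof.
move=> ca; rewrite /admissible /= limf_einfE.
set d := fun t => (dist_to T (traj x alpha t))%:E.
have := exit_time_ge0 x alpha; set E := exit_time _ _ _ _ => E0.
split => [[_ h] e b e0 bE|h].
  pose V := [set s : R | b < s /\ (s%:E < E)%E].
  have hV : left_nbhs E V.
    rewrite /V; case: (E) bE => [r||]//=.
      rewrite lte_fin => br; near=> s; split; first by near: s; exact: nbhs_left_gt.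
      by rewrite lte_fin; near: s; exact: nbhs_left_lt.
    by move=> _; exists b; split; [exact: num_real | move=> s bs; split => //; exact: ltry].
  have : (ereal_inf (d @` V) < e%:E)%E.
    apply: le_lt_trans (_ : (0 < e%:E)%E); last by rewrite lte_fin.
    by rewrite -h; apply: ereal_sup_ubound; exists V.
  by move=> /ereal_inf_lt [_ [s [bs sE] <-] se]; exists s; split.
split => //; apply/le_anti/andP; split.
  apply: ge_ereal_sup => _ [V FV <-].
  apply/lee_addgt0Pr => e e0; rewrite add0e.
  have [b bE hb] : exists2 b : R, (b%:E < E)%E & forall s, b < s -> (s%:E < E)%E -> V s.
    case: (E) E0 FV => [r _||]//=.
      rewrite /at_left /within /= => /nbhs_ballP [g /= g0 hg].
      exists (r - g); first by rewrite lte_fin; lra.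
      move=> s bs; rewrite lte_fin => sr; apply: hg => //.
      rewrite /ball /= gtr0_norm ?subr_gt0 //; lra.
    by move=> _ [M [_ hM]]; exists M => [|s Ms _]; [exact: ltry | exact: hM].
  have [s [bs sE se]] := h _ _ e0 bE.
  apply: (@le_trans _ _ (d s)); last by rewrite lee_fin ltW.
  by apply: ereal_inf_lbound; exists s => //; exact: hb.
apply: ereal_sup_ge; exists (ereal_inf (d @` setT)).
  exists setT => //; case: (E) => [r||]; exact: filterT.
by apply: le_ereal_inf_tmp => _ [s _ <-]; rewrite lee_fin dist_to_ge0.
Unshelve. all: by end_near.
Qed.

Lemma admissible_concat x alpha t beta : controls A alpha -> controls A beta ->
  0 <= t -> avoids x alpha t ->
  admissible f A T x (concat alpha t beta) <-> admissible f A T (traj x alpha t) beta.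
Proof.
move=> ca cb t0 av; have cc := controls_concat t0 ca cb.
have exc := exit_time_concat ca cb t0 av; move: exc.
set E := exit_time _ _ _ beta; have E0 : (0 <= E)%E := exit_time_ge0 _ _.
have hE (s : R) : ((t + s)%:E < t%:E + E)%E = (s%:E < E)%E by rewrite EFinD lteD2lE.
move=> exc; split => [/(admissibleP _ cc)|/(admissibleP _ cb)] h.
  rewrite exc in h; apply/(admissibleP _ cb) => e b e0 bE.
  (* A negative [b] would allow a time before [t], hence [Num.max 0 b]. When [b < 0] the claim is
     [0 < E], which holds because the point reached at [t] is off the closed target. *)
  have bE' : ((t + Num.max 0 b)%:E < t%:E + E)%E.
    rewrite hE; case: (leP 0 b) => // b0.
    have := avoids_lt_exit_time (x := traj x alpha t) (t := 0) cb (lexx _).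
    apply=> s /le_anti <-; rewrite (trajectory0 sa) //; apply: av.
    by rewrite t0 lexx.
  have [s [bs sE se]] := h _ _ e0 bE'.
  have st : 0 <= s - t.
    by rewrite subr_ge0; apply: ltW; apply: le_lt_trans bs; rewrite lerDl le_max lexx.
  have es : s = t + (s - t) by rewrite subrKC.
  exists (s - t); split.
  - by rewrite ltrBrDl; apply: le_lt_trans bs; rewrite lerD2l le_max lexx orbT.
  - by rewrite -hE -es.
  - by rewrite -traj_concat_ge // -es.
apply/(admissibleP _ cc) => e b e0; rewrite exc => bE.
have bE' : ((Num.max 0 (b - t))%:E < E)%E.
  case: (leP 0 (b - t)) => b0.
    by rewrite -hE subrKC.
  have := avoids_lt_exit_time (x := traj x alpha t) (t := 0) cb (lexx _).
  apply=> s /le_anti <-; rewrite (trajectory0 sa) //; apply: av.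
  by rewrite t0 lexx.
have [s [bs sE se]] := h _ _ e0 bE'.
have s0 : 0 <= s by apply: ltW; apply: le_lt_trans bs; rewrite le_max lexx.
exists (t + s); split.
- by rewrite -ltrBlDl; apply: le_lt_trans bs; rewrite le_max lexx orbT.
- by rewrite hE.
- by rewrite traj_concat_ge.
Qed.

Lemma tame_running x alpha : controls A alpha ->
  tame (fun s => l (traj x alpha s) (alpha s)).
Proof. move=> ca; apply: (tame_l sa) => //; exact: (trajectory_continuous sa). Qed.

Lemma running_cost_ge0 x alpha t : controls A alpha -> 0 <= running_cost x alpha t.
Proof.
move=> ca; apply: Rintegral_ge0 => s; rewrite /= in_itv /= => /andP[s0 _].
apply: (l_ge0 sa); exact: ca.2.
Qed.

Lemma measurable_before (e : \bar R) : measurable [set s : R | 0 <= s /\ (s%:E < e)%E].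
Proof.
case: e => [r||].
- rewrite (_ : mkset _ = `[0, r[%classic) //; apply/seteqP.
  by split => s /=; rewrite in_itv /= lte_fin; [move=> [-> ->] | move=> /andP].
- rewrite (_ : mkset _ = `[0, +oo[%classic) //; apply/seteqP.
  by split => s /=; rewrite in_itv /= andbT; [case | rewrite ltry].
- by rewrite (_ : mkset _ = set0) //; apply/seteqP; split => s //= [].
Qed.

Lemma integral_running_cost x alpha t : controls A alpha ->
  (\int[mu]_(s in `[0%R, t[) (l (traj x alpha s) (alpha s))%:E = (running_cost x alpha t)%:E)%E.
Proof.
move=> ca; have tl := tame_running x ca.
have it : mu.-integrable `[0, t[ (EFin \o (fun s => l (traj x alpha s) (alpha s))).
  by apply: (tame_integrable (t := t)) => //; apply: subset_itvl; rewrite bnd_simp.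
rewrite /running_cost /pint -Rintegral_itv_bndo_bndc //.
rewrite /Rintegral fineK //; exact: (integrable_fin_num _ it).
Qed.

Lemma cost_concat x alpha t beta : controls A alpha -> controls A beta ->
  0 <= t -> avoids x alpha t ->
  cost f l (exit_time f T x (concat alpha t beta)) x (concat alpha t beta) =
  ((running_cost x alpha t)%:E +
    cost f l (exit_time f T (traj x alpha t) beta) (traj x alpha t) beta)%E.
Proof.
move=> ca cb t0 av; have cc := controls_concat t0 ca cb.
rewrite exit_time_concat // /cost.
set E := exit_time _ _ _ beta; have E0 : (0 <= E)%E := exit_time_ge0 _ _.
set g := fun s : R => (l (traj x (concat alpha t beta) s) (concat alpha t beta s))%:E.
have tg := tame_running x cc.
have mg (D : set R) : measurable D -> D `<=` `[0, +oo[ -> measurable_fun D g.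
  by move=> mD D0; apply/measurable_EFinP; exact: measurable_funS tg.1.
have g0 (s : R) : 0 <= s -> (0 <= g s)%E.
  by move=> s0; rewrite lee_fin; apply: (l_ge0 sa); exact: cc.2.
pose D2 := [set s : R | t <= s /\ (s%:E < t%:E + E)%E].
have mD2 : measurable D2.
  rewrite (_ : D2 = `[t, +oo[ `&` [set s : R | 0 <= s /\ (s%:E < t%:E + E)%E]).
    by apply: measurableI => //; exact: measurable_before.
  apply/seteqP; split => s /=; rewrite in_itv /= andbT.
    by move=> [ts sE]; split => //; split => //; exact: le_trans ts.
  by move=> [ts [_ sE]].
have tE (s : R) : s < t -> (s%:E < t%:E + E)%E.
  by move=> st; apply: (@lt_le_trans _ _ t%:E); rewrite ?lte_fin // leeDl.
have -> : [set s : R | 0 <= s /\ (s%:E < t%:E + E)%E] = `[0, t[ `|` D2.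
  apply/seteqP; split => s /=; rewrite in_itv /=.
    by move=> [s0 sE]; case: (ltP s t) => st; [left; rewrite s0 | right].
  case=> [/andP[s0 st]|[ts sE]]; split => //; first exact: tE.
  exact: le_trans ts.
rewrite ge0_integral_setU //=; last 3 first.
- apply: mg; first exact: measurableU.
  move=> s /= [|[ts _]]; rewrite !in_itv /= ?andbT; first by case/andP.
  exact: le_trans ts.
- move=> s [|[ts _]]; first by rewrite /= in_itv /= => /andP[/g0].
  exact/g0/(le_trans t0).
- rewrite disj_set2E; apply/eqP/seteqP; split => s //= []; rewrite !in_itv /=.
  by move=> /andP[_ h1] [h2 _]; move: (lt_le_trans h1 h2); rewrite ltxx.
congr (_ + _)%E.
  rewrite -integral_running_cost //; apply: eq_integral => s.
  rewrite inE /= in_itv /= => /andP[s0 st].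
  by rewrite /g traj_concat_le ?s0 ?ltW // /concat st.
rewrite (@ge0_integral_shift R t D2 g) //; last 2 first.
- by apply: mg => // s [ts _]; rewrite /= in_itv /= andbT (le_trans t0).
- by move=> s [ts _]; exact/g0/(le_trans t0).
have -> : shiftr t @^-1` D2 = [set s : R | 0 <= s /\ (s%:E < E)%E].
  apply/seteqP; split => s /=; rewrite /shiftr /D2 /= lerDl EFinD lteD2lE //.
apply: eq_integral => s; rewrite inE /= => -[s0 _].
by rewrite /g traj_concat_ge // /concat ltNge lerDl s0 /= addrAC subrr add0r.
Qed.

Lemma value_out x : ~ T x -> value f l A T x =
  ereal_inf [set cost f l (exit_time f T x alpha) x alpha | alpha in admissible f A T x].
Proof. by move=> Tx; rewrite /value; case: ifPn => //; rewrite inE. Qed.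

Lemma value_in x : T x -> value f l A T x = 0%E.
Proof. by move=> Tx; rewrite /value mem_set. Qed.

Lemma cost_ge0 x alpha e : controls A alpha -> (0 <= cost f l e x alpha)%E.
Proof.
move=> ca; apply: integral_ge0 => s [s0 _]; rewrite lee_fin; apply: (l_ge0 sa).
exact: ca.2.
Qed.

Lemma value_ge0 x : (0 <= value f l A T x)%E.
Proof.
have [Tx|Tx] := pselect (T x); first by rewrite value_in.
by rewrite value_out //; apply: le_ereal_inf_tmp => _ [a [ca _] <-]; exact: cost_ge0.
Qed.

(** Every control admissible from the point reached at [t] may be appended to [alpha]; the infimum
    is taken over the appended part. *)
Lemma value_le_dpp x alpha t : controls A alpha -> 0 <= t -> avoids x alpha t ->
  (value f l A T x <= (running_cost x alpha t)%:E + value f l A T (traj x alpha t))%E.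
Proof.
move=> ca t0 av.
have Tx : ~ T x by rewrite -(trajectory0 sa x ca); apply: av; rewrite lexx.
have Ty : ~ T (traj x alpha t) by apply: av; rewrite t0 lexx.
rewrite -leeBlDl // [X in (_ <= X)%E]value_out //.
apply: le_ereal_inf_tmp => _ [b ab <-]; rewrite leeBlDl // value_out //.
apply: ereal_inf_lbound; exists (concat alpha t b); last by rewrite cost_concat //; case: ab.
by apply/admissible_concat => //; case: ab.
Qed.

(** The bound concerns one control rather than an infimum, so that a single nearly optimal control
    later serves for all times [t]. *)
Lemma cost_ge_dpp x alpha t : admissible f A T x alpha -> 0 <= t -> avoids x alpha t ->
  ((running_cost x alpha t)%:E + value f l A T (traj x alpha t) <=
    cost f l (exit_time f T x alpha) x alpha)%E.
Proof.
move=> aa t0 av; have ca := aa.1.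
have Ty : ~ T (traj x alpha t) by apply: av; rewrite t0 lexx.
have cs := controls_shift t0 ca.
rewrite -{3 4}(concat_shift alpha t) cost_concat // leeD2l // value_out //.
have ab : admissible f A T (traj x alpha t) (fun s => alpha (t + s)).
  by have := (admissible_concat ca cs t0 av).1; rewrite concat_shift; apply.
apply: ereal_inf_lbound.
by apply: (imageP (fun b => cost f l (exit_time f T (traj x alpha t) b) (traj x alpha t) b) ab).
Qed.

End DynamicProgramming.

(** * Gradients and semiconcave functions *)

Section Gradient.
Context {R : realType} {n : nat}.
Implicit Types (u v phi : 'rV[R]_n -> R) (x y p h : 'rV[R]_n).

Lemma dot_sqrD x y : dot (x + y) (x + y) = dot x x + 2 * dot x y + dot y y.
Proof. by rewrite !dotDl !dotDr (dotC y x); ring. Qed.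

Lemma dot_delta p i : dot p (delta_mx 0 i) = p 0 i.
Proof.
rewrite /dot (bigD1 i) //= mxE !eqxx mulr1 big1 ?addr0 // => j ji.
by rewrite mxE eqxx (negbTE ji) mulr0.
Qed.

Lemma dot_is_linear p : linear (dot p : 'rV[R]_n -> R^o).
Proof. by move=> a x y; rewrite dotDr dotZr. Qed.

HB.instance Definition _ p :=
  GRing.isLinear.Build R 'rV[R]_n R^o *:%R (dot p) (@dot_is_linear p).

Lemma continuous_dot p : continuous (dot p).
Proof.
move=> x; apply/(@cvgrPdist_lt R R^o _ (nbhs x) _ (dot p) (dot p x)) => e e0.
have c0 : 0 < n%:R * `|p| + 1 by rewrite ltr_wpDl // mulr_ge0.
apply/nbhs_ballP; exists (e / (n%:R * `|p| + 1)) => /=; first by rewrite divr_gt0.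
move=> y; rewrite mx_norm_ball /ball_ /= => h.
rewrite -dotBr; apply: le_lt_trans (le_norm_dot _ _) _.
rewrite ltr_pdivlMr // in h; apply: le_lt_trans h.
by rewrite mulrA mulrC ler_wpM2l // lerDl.
Qed.

Lemma grad_dot u x h : differentiable u x -> dot (grad u x) h = 'd u x h.
Proof.
move=> du; rewrite [in RHS](row_sum_delta h) linear_sum /=.
by apply: eq_bigr => i _; rewrite linearZ /= mxE deriveE // mulrC.
Qed.

Lemma diff_expansion u x : differentiable u x -> forall e, 0 < e ->
  \forall y \near x, `|u y - u x - dot (grad u x) (y - x)| <= e * `|y - x|.
Proof.
move=> du e e0; have /diffP [_ h] := du.
have /eqaddoP /(_ e e0) := funext h; apply: filterS => y.
by rewrite !fctE lim_id // opprD addrA (grad_dot _ du).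
Qed.

(** Differentiability and the value of the gradient come together from a first order expansion; all
    the test functions below are differentiated in this way. *)
Lemma diff_of_expansion u x p : (forall e, 0 < e ->
  \forall y \near x, `|u y - u x - dot p (y - x)| <= e * `|y - x|) ->
  differentiable u x /\ grad u x = p.
Proof.
move=> hp.
pose df : {linear 'rV[R]_n -> R^o} := dot p.
have E : (u : 'rV[R]_n -> R^o) \o shift x = cst (u x) + df +o_ (0 : 'rV[R]_n) id.
  apply/eqaddoP => e e0.
  move: (hp e e0); rewrite (near_shift (0 : 'rV[R]_n)); apply: filterS => h.
  by rewrite !fctE /= subr0 addrK opprD addrA.
have du : differentiable u x.
  apply/diffP => /=.
  (* The differential is a chosen linear map; the choice satisfies its specification as soon as some
     map does, here [dot p]. *)
  apply: (@getPex _ (fun (df : {linear 'rV[R]_n -> R^o}) => continuous df /\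
    forall y, (u : _ -> R^o) y = u (lim (nbhs x)) + df (y - lim (nbhs x))
                  +o_(y \near x) (y - lim (nbhs x)))).
  exists df; split; first exact: continuous_dot.
  apply/funeqP/eqaddoP; rewrite lim_id //.
  move=> e e0; have := hp e e0; apply: filterS => y.
  by rewrite !fctE /= opprD addrA.
split => //; apply/rowP => i; rewrite mxE deriveE //.
have := diff_unique (@continuous_dot p) E => /(congr1 (fun g => g (delta_mx 0 i))) ->.
exact: dot_delta.
Qed.

End Gradient.

Lemma sqdist_diff (R : realType) (n : nat) (z0 x : 'rV[R]_n) :
  differentiable (fun y => dot (y - z0) (y - z0)) x /\
  grad (fun y => dot (y - z0) (y - z0)) x = 2 *: (x - z0).
Proof.
apply: diff_of_expansion => e e0.
have n0 : 0 < n%:R + 1 :> R by rewrite ltr_wpDl.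
apply/nbhs_ballP; exists (e / (n%:R + 1)) => /=; first by rewrite divr_gt0.
move=> y; rewrite mx_norm_ball /ball_ /= distrC => yx.
have -> : y - z0 = (x - z0) + (y - x) by apply/rowP => i; rewrite !mxE; ring.
rewrite dot_sqrD dotZl.
rewrite (_ : _ - _ = dot (y - x) (y - x)); last by ring.
rewrite ger0_norm ?dot_ge0 //; apply: le_trans (dot_le_norm _) _.
rewrite ltr_pdivlMr // in yx.
have t0 : 0 <= `|y - x| by exact: normr_ge0.
have := ler_wpM2r t0 (ltW yx); have := sqr_ge0 `|y - x|; lra.
Qed.

(** * Compactness arguments *)

Section Compactness.
Context {R : realType} {n : nat}.
Implicit Types (x y z : 'rV[R]_n).

Lemma nbhs_rvP x (P : set 'rV[R]_n) :
  nbhs x P <-> exists2 e : R, 0 < e & forall y, `|y - x| < e -> P y.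
Proof.
split.
  move=> /nbhs_ballP [e /= e0 h]; exists e => // y yx; apply: h.
  by rewrite mx_norm_ball /ball_ /= distrC.
move=> [e e0 h]; apply/nbhs_ballP; exists e => //= y.
by rewrite mx_norm_ball /ball_ /= distrC; exact: h.
Qed.

Lemma compact_closed_ball x (s : R) : compact [set y | `|y - x| <= s].
Proof.
apply: bounded_closed_compact.
  exists (`|x| + s); split; first exact: num_real.
  move=> M hM y /= yx; apply: le_trans (ltW hM).
  by rewrite -[y](subrK x) addrC; apply: le_trans (ler_normD _ _) _; rewrite lerD2l.
rewrite (_ : mkset _ = (fun y => `|y - x|) @^-1` [set r : R | r <= s]) //.
apply: closed_comp; last exact: closed_le.
move=> y _; apply: continuous_comp; last exact: norm_continuous.
by apply: continuousB; [exact: cvg_id | exact: cst_continuous].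
Qed.

(** Turns a constant that is uniform near each point into one that is uniform on [K]:
    counterexamples for the constants [1 / (k + 1)] would cluster at a point of [K], where the local
    constant contradicts them. *)
Lemma compact_uniform (K : set 'rV[R]_n) (P : 'rV[R]_n -> R -> Prop) : compact K ->
  (forall x (e e' : R), 0 < e' -> e' <= e -> P x e -> P x e') ->
  (forall x, K x -> exists2 e : R, 0 < e & exists2 d : R, 0 < d &
     forall y, K y -> `|y - x| < d -> P y e) ->
  exists2 e : R, 0 < e & forall x, K x -> P x e.
Proof.
move=> cK mono loc.
apply: contrapT => /forall2NP h.
have bad (k : nat) : exists x, K x /\ ~ P x k.+1%:R^-1.
  have [|] := h k.+1%:R^-1; first by rewrite invr_gt0 ltr0n.
  by move=> /existsNP [x /not_implyP]; exists x.
have [u hu] := choice bad.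
have Fu : ProperFilter (u @ \oo) by exact: fmap_proper_filter.
have [|x [Kx cx]] := cK (u @ \oo) Fu.
  by exists 0%N => // k _; have [] := hu k.
have [e e0 [d d0 hd]] := loc x Kx.
have V1 : (u @ \oo) [set y | exists k, [/\ y = u k, k.+1%:R^-1 <= e & K (u k)]].
  exists (Num.truncn e^-1) => // k /= hk; exists k; split => //; last by have [] := hu k.
  rewrite invf_ple ?posrE //; apply: ltW; apply: lt_le_trans (truncnS_gt _) _.
  by rewrite ler_nat.
have V2 : nbhs x [set y | `|y - x| < d] by apply/nbhs_rvP; exists d.
have [y [[k [-> ke Kk]] /= yd]] := cx _ _ V1 V2.
have [_] := hu k; apply; apply: mono (hd _ Kk yd) => //.
Qed.

Lemma compact_cluster_seq (K : set 'rV[R]_n) (u : nat -> 'rV[R]_n) : compact K ->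
  (forall k, K (u k)) -> exists2 x, K x & forall (e : R) (N : nat), 0 < e ->
    exists2 k, (N <= k)%N & `|u k - x| < e.
Proof.
move=> cK Ku; have Fu : ProperFilter (u @ \oo) by exact: fmap_proper_filter.
have [|x [Kx cx]] := cK (u @ \oo) Fu.
  by exists 0%N => // k _; exact: Ku.
exists x => // e N e0.
have V1 : (u @ \oo) [set y | exists2 k, y = u k & (N <= k)%N].
  by exists N => // k /= hk; exists k.
have V2 : nbhs x [set y | `|y - x| < e] by apply/nbhs_rvP; exists e.
by have [y [[k -> kN] yd]] := cx _ _ V1 V2; exists k.
Qed.

End Compactness.

Section Semiconcave.
Context {R : realType} {n : nat} (U : 'rV[R]_n -> R) (x0 : 'rV[R]_n) (r0 c : R).
Implicit Types (x y z q h : 'rV[R]_n).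
Context (c0 : 0 <= c) (cU : forall x, `|x - x0| < r0 -> {for x, continuous U}).
Context (sc : forall y z, `|y - x0| < r0 -> `|z - x0| < r0 ->
  U y + U z - 2 * U (2^-1 *: (y + z)) <= c * `|y - z| ^+ 2).

(** The difference quotients [D k] at the dyadic points [z + h / 2^k] tend to the derivative along
    [h]. Semiconcavity between [z] and such a point bounds the change from [D k] to [D k.+1] by
    [c |h|^2 / 2^k], and the sum of these errors is [2 c |h|^2]. *)
Lemma semiconcave_upper z y : `|z - x0| < r0 -> differentiable U z -> `|y - x0| < r0 ->
  U y <= U z + dot (grad U z) (y - z) + 2 * c * `|y - z| ^+ 2.
Proof.
move=> hz dz hy; pose h := y - z.
pose D k := 2 ^+ k * (U (z + (2 ^+ k)^-1 *: h) - U z).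
have inb k : `|z + (2 ^+ k)^-1 *: h - x0| < r0.
  have p1 : (2 ^+ k)^-1 <= 1 :> R by rewrite invf_le1 ?exprn_gt0 // exprn_ege1 // ler1n.
  have p0 : 0 < (2 ^+ k)^-1 :> R by rewrite invr_gt0 exprn_gt0.
  have -> : z + (2 ^+ k)^-1 *: h - x0 = (1 - (2 ^+ k)^-1) *: (z - x0) + (2 ^+ k)^-1 *: (y - x0).
    by apply/rowP => i; rewrite /h !mxE; ring.
  apply: le_lt_trans (ler_normD _ _) _; rewrite !normrZ.
  rewrite (ger0_norm (ltW p0)) ger0_norm ?subr_ge0 //.
  have : (2 ^+ k)^-1 * `|y - x0| < (2 ^+ k)^-1 * r0 by rewrite ltr_pM2l.
  have : (1 - (2 ^+ k)^-1) * `|z - x0| <= (1 - (2 ^+ k)^-1) * r0.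
    by rewrite ler_wpM2l ?subr_ge0 // ltW.
  lra.
have step k : D k <= D k.+1 + c * `|h| ^+ 2 / 2 ^+ k.
  have := sc (inb k) hz.
  have -> : 2^-1 *: (z + (2 ^+ k)^-1 *: h + z) = z + (2 ^+ k.+1)^-1 *: h.
    by apply/rowP => i; rewrite !mxE exprS; field; rewrite expf_neq0.
  rewrite (_ : z + (2 ^+ k)^-1 *: h - z = (2 ^+ k)^-1 *: h); last by rewrite [z + _]addrC addrK.
  rewrite normrZ ger0_norm ?invr_ge0 ?exprn_ge0 //.
  have p0 : 0 < 2 ^+ k :> R by rewrite exprn_gt0.
  rewrite /D exprS exprMn exprVn; set a := 2 ^+ k in p0 *.
  move=> H; have := ler_wpM2l (ltW p0) H.
  have -> : a * (c * ((a ^+ 2)^-1 * `|h| ^+ 2)) = c * `|h| ^+ 2 / a by field; rewrite gt_eqF.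
  lra.
have tel k : D 0%N <= D k + c * `|h| ^+ 2 * (2 - 2 / 2 ^+ k).
  elim: k => [|k ih]; first by rewrite expr0; lra.
  have s := step k; rewrite [2 ^+ k.+1]exprS.
  have p0 : 2 ^+ k != 0 :> R by rewrite expf_neq0.
  have -> : 2 - 2 / (2 * 2 ^+ k) = (2 - 2 / 2 ^+ k) + (2 ^+ k)^-1 :> R by field.
  rewrite mulrDr; lra.
have D0 : D 0%N = U y - U z by rewrite /D expr0 invr1 scale1r mul1r /h subrKC.
apply/ler_addgt0Pr => e e0.
have := diff_expansion dz (_ : 0 < e / (`|h| + 1)).
have h1 : 0 < `|h| + 1 by rewrite ltr_wpDl.
rewrite divr_gt0 // => /(_ isT) /nbhs_rvP [d d0 hd].
have [k hk] : exists k, (2 ^+ k)^-1 * `|h| < d.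
  have ct : (fun k => (2^-1 : R) ^+ k * `|h|) @ \oo --> (0 : R).
    rewrite -[X in _ --> X](mul0r `|h|); apply: cvgM; last exact: cvg_cst.
    by apply: cvg_expr; rewrite ger0_norm // invf_lt1 // ltr1n.
  have /cvgrPdist_lt /(_ _ d0) [k _ /(_ k (leqnn k))] := ct.
  rewrite sub0r normrN ger0_norm ?mulr_ge0 ?exprn_ge0 // exprVn.
  by exists k.
have := hd (z + (2 ^+ k)^-1 *: h).
have -> : z + (2 ^+ k)^-1 *: h - z = (2 ^+ k)^-1 *: h by rewrite [z + _]addrC addrK.
have p0 : 0 < 2 ^+ k :> R by rewrite exprn_gt0.
rewrite normrZ ger0_norm ?invr_ge0 ?(ltW p0) // => /(_ hk).
rewrite dotZr => H.
have := ler_wpM2l (ltW p0) H.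
rewrite -{1}(ger0_norm (ltW p0)) -normrM !mulrBr -mulrBr -/(D k) mulrA divff ?gt_eqF // mul1r.
have -> : 2 ^+ k * (e / (`|h| + 1) * ((2 ^+ k)^-1 * `|h|)) = e * (`|h| / (`|h| + 1)).
  by field; rewrite !gt_eqF.
have q1 : e * (`|h| / (`|h| + 1)) <= e.
  by rewrite ler_piMr ?(ltW e0) // ler_pdivrMr // mul1r lerDl.
move=> /(le_trans (ler_norm _)) H2; have := tel k; rewrite D0.
have c1 : 0 <= c * `|h| ^+ 2 by rewrite mulr_ge0 ?exprn_ge0.
have p2 : c * `|h| ^+ 2 * (2 - 2 / 2 ^+ k) <= c * `|h| ^+ 2 * 2.
  by rewrite ler_wpM2l // lerBlDr lerDl divr_ge0 // ltW.
rewrite -/h; lra.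
Qed.

(** The lower paraboloid at the reflected point [2 z - y], inserted in the semiconcavity inequality,
    becomes an upper bound at [y]; the two bounds agree to first order. *)
Lemma semiconcave_touched z q (C : R) : `|z - x0| < r0 -> 0 <= C ->
  (\forall y \near z, U z + dot q (y - z) - C * `|y - z| ^+ 2 <= U y) ->
  differentiable U z /\ grad U z = q.
Proof.
move=> hz C0 /nbhs_rvP [d d0 hd]; apply: diff_of_expansion => e e0.
have K0 : 0 < 4 * c + C + 1 by rewrite ltr_wpDl // addr_ge0 // mulr_ge0.
pose d1 := Num.min d (Num.min (r0 - `|z - x0|) (e / (4 * c + C + 1))).
have d10 : 0 < d1 by rewrite !lt_min d0 subr_gt0 hz divr_gt0.
apply/nbhs_rvP; exists d1 => // y; rewrite !lt_min => /and3P[yd yr ye].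
pose y' := z + z - y.
have ey : y' - z = - (y - z) by apply/rowP => i; rewrite /y' !mxE; ring.
have ly := hd y yd; have := hd y'; rewrite ey normrN => /(_ yd); rewrite dotNr => ly'.
have inb w : `|w - z| < r0 - `|z - x0| -> `|w - x0| < r0.
  move=> hw; have := ler_normD (w - z) (z - x0); rewrite addrA subrK; lra.
have := sc (inb y yr) (inb y' _); rewrite ey normrN => /(_ yr).
have -> : 2^-1 *: (y + y') = z by apply/rowP => i; rewrite /y' !mxE; field.
have -> : y - y' = 2 *: (y - z) by apply/rowP => i; rewrite /y' !mxE; ring.
rewrite normrZ exprMn ger0_norm //.
set t := `|y - z| in yd yr ye ly ly' *.
have t0 : 0 <= t by exact: normr_ge0.
move=> H; rewrite ltr_pdivlMr // in ye.
have H2 : t * (t * (4 * c + C + 1)) <= t * e by rewrite ler_wpM2l // ltW.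
have t2 : 0 <= t ^+ 2 by rewrite exprn_ge0.
have t3 : 0 <= c * t ^+ 2 by rewrite mulr_ge0.
have t4 : 0 <= C * t ^+ 2 by rewrite mulr_ge0.
rewrite ler_norml; apply/andP; split; lra.
Qed.

(** Adding a steep paraboloid centred at [z0] forces an interior minimum; there [U] is touched from
    below by a paraboloid, hence differentiable by [semiconcave_touched]. *)
Lemma semiconcave_dense z0 (s : R) : 0 < s ->
  (forall y, `|y - z0| <= s -> `|y - x0| < r0) ->
  exists2 z, `|z - z0| < s & differentiable U z.
Proof.
move=> s0 sub; pose B := [set y | `|y - z0| <= s].
have cB : compact B := @compact_closed_ball R n z0 s.
have B0 : B !=set0 by exists z0; rewrite /B /= subrr normr0 ltW.
have UB : {within B, continuous U}.
  by apply: continuous_in_subspaceT => y; rewrite inE => /sub; exact: cU.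
have [m _ hm] := compact_EVT_max B0 cB UB; have [m' _ hm'] := compact_EVT_min B0 cB UB.
(* [K * s ^+ 2] exceeds the oscillation of [U] on the ball by 1, so no point at distance [s] is a
   minimum. *)
pose K := (U m - U m' + 1) / s ^+ 2.
have z0B : z0 \in B by rewrite inE /B /= subrr normr0 ltW.
have mm : U m' <= U m := le_trans (hm' _ z0B) (hm _ z0B).
have K0 : 0 <= K by rewrite divr_ge0 ?exprn_ge0 ?(ltW s0) // addr_ge0 // subr_ge0.
pose F y := U y + K * dot (y - z0) (y - z0).
have FB : {within B, continuous F}.
  apply: continuous_in_subspaceT => y; rewrite inE => /sub /cU cy.
  apply: (@continuousD _ _ _ U (fun y => K * dot (y - z0) (y - z0)) y) => //.
  apply: continuousM; first exact: cst_continuous.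
  exact/differentiable_continuous/(sqdist_diff z0 y).1.
have [z zB hz] := compact_EVT_min B0 cB FB.
have zs : `|z - z0| <= s by move: zB; rewrite inE.
have zs' : `|z - z0| < s.
  rewrite lt_neqAle zs andbT; apply/negP => /eqP e.
  have := hz _ z0B; rewrite /F subrr dot0l mulr0 addr0.
  have := sqr_norm_le_dot (z - z0); rewrite e => h.
  have := ler_wpM2l K0 h; rewrite /K divfK ?expf_neq0 ?gt_eqF //.
  have := hm' _ zB; have := hm _ z0B; lra.
exists z => //.
apply: (semiconcave_touched (q := (- 2 * K) *: (z - z0)) (C := K * n%:R) (sub _ zs) _ _).1.
  by rewrite mulr_ge0.
apply/nbhs_rvP; exists (s - `|z - z0|); first by rewrite subr_gt0.
move=> y yz; have yB : y \in B.
  rewrite inE /B /=; have := ler_normD (y - z) (z - z0); rewrite addrA subrK; lra.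
have := hz _ yB; rewrite /F.
have -> : y - z0 = (z - z0) + (y - z) by apply/rowP => i; rewrite !mxE; ring.
rewrite (dot_sqrD (z - z0) (y - z)) dotZl.
have := ler_wpM2l K0 (dot_le_norm (y - z)); lra.
Qed.

(** The inequality of [semiconcave_upper] is tested at the points [z + h e_i] and [z - h e_i]. *)
Lemma semiconcave_grad_bound z (B h : R) : 0 < h ->
  (forall y, `|y - x0| < r0 -> `|U y| <= B) ->
  (forall y, `|y - z| <= h -> `|y - x0| < r0) -> differentiable U z ->
  `|grad U z| <= (2 * B + 2 * c * h ^+ 2) / h.
Proof.
move=> h0 hB sub dz; have zr : `|z - x0| < r0 by apply: sub; rewrite subrr normr0 ltW.
have B0 : 0 <= B := le_trans (normr_ge0 _) (hB z zr).
apply: rv_norm_le => [|i].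
  by rewrite divr_ge0 ?(ltW h0) // addr_ge0 ?mulr_ge0 ?exprn_ge0 // ltW.
have key (s : R) : `|s| = h -> - (s * grad U z 0 i) <= 2 * B + 2 * c * h ^+ 2.
  move=> sh; pose y := z + s *: delta_mx 0 i.
  have nd : `|s *: (delta_mx 0 i : 'rV[R]_n)| <= h.
    apply: rv_norm_le => [|j]; first exact: ltW.
    by rewrite !mxE eqxx /= normrM sh; case: eqP; rewrite ?normr1 ?normr0 ?mulr1 ?mulr0 // ltW.
  have yz : y - z = s *: delta_mx 0 i by rewrite /y [z + _]addrC addrK.
  have yr : `|y - x0| < r0 by apply: sub; rewrite yz.
  have := semiconcave_upper zr dz yr; rewrite yz dotZr.
  have -> : dot (grad U z) (delta_mx 0 i) = grad U z 0 i.
    exact: dot_delta.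
  have := hB y yr; have := hB z zr; rewrite !ler_norml => /andP[_ h1] /andP[h2 _].
  have : 2 * c * `|s *: (delta_mx 0 i : 'rV[R]_n)| ^+ 2 <= 2 * c * h ^+ 2.
    by rewrite ler_wpM2l ?mulr_ge0 // ler_pXn2r // ?nnegrE // ltW.
  lra.
rewrite ler_pdivlMr // -[X in _ * X](ger0_norm (ltW h0)) -normrM ler_norml.
have k1 := key h (ger0_norm (ltW h0)).
have := key (- h); rewrite normrN (ger0_norm (ltW h0)) => /(_ erefl) k2.
by apply/andP; split; lra.
Qed.

End Semiconcave.

Section Drift.
Context {R : realType} {n m : nat} {f : 'rV[R]_n -> 'rV[R]_m -> 'rV[R]_n}
  {l : 'rV[R]_n -> 'rV[R]_m -> R} {A : set 'rV[R]_m} {T : set 'rV[R]_n}.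
Context (sa : standing_assumptions f l A T).
Implicit Types (x p : 'rV[R]_n) (alpha : R -> 'rV[R]_m).
Local Notation traj := (trajectory f).

Lemma trajectory_drift (r : R) : exists2 C : R, 0 < C & forall x alpha t,
  controls A alpha -> `|x| <= r -> 0 <= t <= 1 ->
  `|traj x alpha t - x| <= C * t.
Proof.
have [M1 M10 hM1] := f_growth sa; have [M M0 hM] := trajectory_bound sa.
have E0 : 0 < (1 + `|r|) * expR M by rewrite mulr_gt0 ?expR_gt0 // ltr_pwDl.
exists (M1 * ((1 + `|r|) * expR M)) => [|x alpha t ca xr /andP[t0 t1]].
  by rewrite mulr_gt0.
apply: rv_norm_le => [|i]; first by rewrite !mulr_ge0 // ltW // expR_gt0.
rewrite !mxE (trajectory_eq sa x i ca t0) addrAC subrr add0r.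
apply: pint_norm_le => //.
  exact: (tame_f sa i ca (trajectory_continuous sa ca)).
move=> s /andP[s0 st]; apply: le_trans (rv_norm_coord _ _) _.
apply: le_trans (hM1 _ _ (ca.2 _ s0)) _; rewrite ler_wpM2l ?(ltW M10) //.
apply: le_trans (hM x alpha s ca s0) _; apply: ler_pM.
- by rewrite addr_ge0.
- exact: expR_ge0.
- by rewrite lerD2l; apply: le_trans xr (ler_norm _).
- rewrite ler_expR -[leRHS]mulr1 ler_wpM2l ?(ltW M0) //; exact: le_trans t1.
Qed.

Lemma trajectory_dot x p alpha t : controls A alpha -> 0 <= t ->
  dot p (traj x alpha t - x) = pint (fun s => dot p (f (traj x alpha s) (alpha s))) t.
Proof.
move=> ca t0; have tf i := tame_f sa i ca (trajectory_continuous sa (x := x) ca).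
rewrite /dot pint_sum; last by move=> i; exact: tameZ.
apply: eq_bigr => i _; rewrite pintZ //.
by rewrite !mxE (trajectory_eq sa x i ca t0) addrAC subrr add0r.
Qed.

Lemma tame_dot_f x p alpha : controls A alpha ->
  tame (fun s => dot p (f (traj x alpha s) (alpha s))).
Proof.
move=> ca; apply: tame_sum => i; apply: tameZ.
exact: (tame_f sa i ca (trajectory_continuous sa ca)).
Qed.

End Drift.

(** * The value near the target *)

Section MinimumRestraint.
Context {R : realType} {n m : nat} {f : 'rV[R]_n -> 'rV[R]_m -> 'rV[R]_n}
  {l : 'rV[R]_n -> 'rV[R]_m -> R} {A : set 'rV[R]_m} {T : set 'rV[R]_n}.
Context (sa : standing_assumptions f l A T).
Context {Om : set 'rV[R]_n} {U : 'rV[R]_n -> R}.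
Context (oOm : open Om) (TOm : T `<=` Om) (U0 : forall x, (Om `\` T°) x -> 0 <= U x).
Context (cU : {within Om `\` T°, continuous U}).
Context (sc : locally_semiconcave (Om `\` T) U).
Context (pd : positive_definite T Om U) (pr : proper_on T Om U).
Context (k : R) (k0 : 0 < k).
Context (decr : forall x, (Om `\` T) x -> forall p, limiting_gradients (Om `\` T) U x p ->
       exists2 a, A a & dot p (f x a) + k * l x a < 0).
Implicit Types (x p : 'rV[R]_n) (alpha : R -> 'rV[R]_m).
Local Notation traj := (trajectory f).
Local Notation D := (Om `\` T).

Let oD : open D.
Proof. have [_ [[_ cT _] _]] := sa.
by rewrite setDE; apply: openI => //; exact: closed_openC. Qed.

Let DOm : D `<=` Om `\` T°.
Proof. by move=> x [Ox Tx]; split => // /interior_subset. Qed.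

Let cUD x : D x -> {for x, continuous U}.
Proof.
move=> Dx; have /subspace_continuousP /(_ x (DOm Dx)) h := cU.
have e : nbhs x = within (Om `\` T°) (nbhs x).
  apply/seteqP; split => P; rewrite /within /=; first exact: filterS.
  move=> hP; have : nbhs x D by apply: open_nbhs_nbhs; split.
  by apply: filterS2 hP => y yP /DOm /yP.
by move=> P /h; rewrite -e.
Qed.

Let local_data x0 : D x0 -> exists r c B : R, [/\ 0 < r, 0 <= c,
  forall y, `|y - x0| < r -> D y /\ `|U y| <= B &
  forall y z, `|y - x0| < r -> `|z - x0| < r ->
    U y + U z - 2 * U (2^-1 *: (y + z)) <= c * `|y - z| ^+ 2].
Proof.
move=> Dx0; have [r [rho [r0 rho0 bD hs]]] := sc Dx0.
have /cvgrPdist_lt /(_ 1 ltr01) /nbhs_rvP [r1 r10 h1] := cUD Dx0.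
have bl y : `|y - x0| < Num.min r r1 -> ball x0 r y.
  by rewrite lt_min mx_norm_ball /ball_ /= distrC => /andP[].
exists (Num.min r r1), (rho * n%:R ^+ 2), (`|U x0| + 1); split.
- by rewrite lt_min r0.
- by rewrite mulr_ge0 ?exprn_ge0 // ltW.
- move=> y hy; split; first by apply: bD; exact: bl.
  have : `|y - x0| < r1 by move: hy; rewrite lt_min => /andP[].
  move=> /h1 /ltW; rewrite distrC => h.
  by have := ler_normD (U y - U x0) (U x0); rewrite subrK; lra.
- move=> y z /bl hy /bl hz; apply: le_trans (hs _ _ hy hz) _.
  rewrite -mulrA ler_wpM2l ?(ltW rho0) // -exprMn ler_pXn2r // ?nnegrE ?enorm_ge0 //.
  exact: enorm_le_norm.
Qed.

(** Limiting gradients at [x0] only see points other than [x0], so a differentiability point close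
    to [x] must be sought in a ball that misses [x0]. If [x = x0], the ball is moved towards a point
    of the target, which provides a nonzero direction. *)
Let near_away x0 x (e : R) : D x0 -> 0 < e -> exists z0 s, [/\ 0 < s &
  forall y, `|y - z0| <= s -> `|y - x| < e /\ y != x0].
Proof.
move=> [_ Tx0] e0; have [_ [[[t0 Tt0] _ _] _]] := sa.
have [xx0|xx0] := eqVneq x x0; last first.
  exists x, (Num.min (e / 2) (`|x0 - x| / 2)); split.
    by rewrite lt_min !divr_gt0 // normr_gt0 subr_eq0 eq_sym.
  have x00 : 0 < `|x0 - x| by rewrite normr_gt0 subr_eq0 eq_sym.
  move=> y; rewrite le_min => /andP[h1 h2]; split; first by lra.
  by apply/eqP => yx0; move: h2; rewrite yx0; lra.
have v0 : 0 < `|t0 - x0|.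
  by rewrite normr_gt0 subr_eq0; apply/eqP => h; apply: Tx0; rewrite -h.
exists (x0 + (e / 2 / `|t0 - x0|) *: (t0 - x0)), (e / 4); split; first by rewrite divr_gt0.
move=> y hy.
have nz : `|(e / 2 / `|t0 - x0|) *: (t0 - x0)| = e / 2.
  rewrite normrZ ger0_norm; last by rewrite !divr_ge0 // ltW.
  by rewrite divfK // gt_eqF.
set w := _ *: _ in hy nz *.
have e1 : y - x = (y - (x0 + w)) + w by rewrite xx0 opprD addrA subrK.
split.
  by rewrite e1; apply: le_lt_trans (ler_normD _ _) _; rewrite nz; lra.
apply/eqP => yx0; move: hy; rewrite yx0 opprD addrA subrr add0r normrN nz; lra.
Qed.

(** Strict decrease is assumed only for limiting gradients. If it were not uniform at the
    differentiability points around [x0], a bounded sequence of bad gradients would cluster at a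
    limiting gradient, and the control that is good for that limit would be good for late terms of
    the sequence. *)
Let decrease_nbhd x0 : D x0 -> exists r d G : R, [/\ 0 < r, 0 < d, 0 <= G &
  forall z, `|z - x0| < r -> z != x0 -> differentiable U z ->
    `|grad U z| <= G /\
    exists2 a, A a & dot (grad U z) (f z a) + k * l z a <= - d].
Proof.
move=> Dx0; have [r [c [B [r0 c0 hD hs]]]] := local_data Dx0.
have hB y : `|y - x0| < r -> `|U y| <= B by move=> /hD [].
have r4 : 0 < r / 4 by rewrite divr_gt0.
pose G := (2 * B + 2 * c * (r / 4) ^+ 2) / (r / 4).
have hU x : `|x - x0| < r -> {for x, continuous U} by move=> /hD [/cUD].
have gb z : `|z - x0| < r / 2 -> differentiable U z -> `|grad U z| <= G.
  move=> hz dz; apply: (semiconcave_grad_bound c0 hs r4 hB _ dz) => y hy.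
  have := ler_normD (y - z) (z - x0); rewrite addrA subrK; lra.
have G0 : 0 <= G.
  have B0 : 0 <= B by apply: le_trans (normr_ge0 _) (hB x0 _); rewrite subrr normr0.
  by rewrite divr_ge0 ?(ltW r4) // addr_ge0 ?mulr_ge0 ?exprn_ge0 // ltW.
clearbody G.
suff [e e0 he] : exists2 e : R, 0 < e & forall z, `|z - x0| < Num.min (r / 2) e ->
    z != x0 -> differentiable U z ->
    exists2 a, A a & dot (grad U z) (f z a) + k * l z a <= - e.
  exists (Num.min (r / 2) e), e, G; split => //; first by rewrite lt_min e0 divr_gt0.
  move=> z hz zx0 dz; split; last exact: he.
  by apply: gb => //; move: hz; rewrite lt_min => /andP[].
apply: contrapT => /forall2NP H.
have bad (j : nat) : exists z, [/\ `|z - x0| < r / 2, `|z - x0| < j.+1%:R^-1, z != x0,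
    differentiable U z & forall a, A a -> - j.+1%:R^-1 < dot (grad U z) (f z a) + k * l z a].
  have [|] := H j.+1%:R^-1; first by rewrite invr_gt0 ltr0n.
  move=> /existsNP [z /not_implyP [hz /not_implyP [zx0 /not_implyP [dz nz]]]].
  exists z; move: hz; rewrite lt_min => /andP[h1 h2]; split => // a Aa.
  by rewrite ltNge; apply/negP => h; apply: nz; exists a.
have [u hu] := choice bad.
have [p _ hp] := @compact_cluster_seq R n _ (fun j => grad U (u j))
  (@compact_closed_ball R n 0 G) (fun j => ltac:(rewrite /= subr0; have [h1 _ _ h4 _] := hu j; exact: gb)).
(* Extraction of indices along which the gradients converge; the points themselves tend to [x0] by
   their choice. *)
have [w hw] : exists w : nat -> nat, forall j, (j <= w j)%N /\ `|grad U (u (w j)) - p| < j.+1%:R^-1.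
  have /choice [w hw] : forall j, exists i, (j <= i)%N /\ `|grad U (u i) - p| < j.+1%:R^-1.
    by move=> j; have [|i ji h] := hp j.+1%:R^-1 j; [rewrite invr_gt0 ltr0n | exists i].
  by exists w.
have inv0 (e : R) : 0 < e -> \forall j \near \oo, j.+1%:R^-1 < e.
  move=> e0; exists (Num.truncn e^-1) => // j /= hj.
  rewrite invf_plt ?posrE //; apply: lt_le_trans (truncnS_gt _) _; by rewrite ler_nat.
have wle j : (w j).+1%:R^-1 <= j.+1%:R^-1 :> R.
  by rewrite lef_pV2 ?posrE ?ltr0n // ler_nat; have [] := hw j.
have cz : u (w j) @[j --> \oo] --> x0.
  apply/cvgrPdist_lt => e e0; apply: filterS (inv0 e e0) => j je.
  rewrite distrC; have [_ h _ _ _] := hu (w j).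
  exact: lt_trans (lt_le_trans h (wle j)) je.
have cg : grad U (u (w j)) @[j --> \oo] --> p.
  apply/cvgrPdist_lt => e e0; apply: filterS (inv0 e e0) => j je.
  by rewrite distrC; apply: lt_trans je; have [] := hw j.
have lg : limiting_gradients D U x0 p.
  exists (fun j => u (w j)); split => // j; have [h1 _ h3 h4 _] := hu (w j); split => //.
  by have [] := hD (u (w j)) _; first lra.
have [a Aa ha] := decr Dx0 lg.
have [L L0 hL] := fl_lipschitz sa (`|x0| + r).
pose b := - (dot p (f x0 a) + k * l x0 a).
have b0 : 0 < b by rewrite /b; lra.
(* [K] collects the errors made when [p] and [x0] are replaced by the gradient at [z] and by [z]:
   gradient error against [f x0 a], variation of [f], variation of [l]. *)
pose K := n%:R * `|f x0 a| + n%:R * G * L + k * L + 1.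
have K0 : 0 < K.
  rewrite /K ltr_wpDl //; apply: addr_ge0; [apply: addr_ge0|];
    by rewrite !mulr_ge0 ?(ltW L0) ?(ltW k0).
have [j hj] : exists j : nat, j.+1%:R^-1 < b / (K + 1).
  have e0 : 0 < b / (K + 1) by rewrite divr_gt0 // ltr_wpDl // ltW.
  by have [j _ /(_ j (leqnn j))] := inv0 _ e0; exists j.
have [h1 h2 _ h4 h5] := hu (w j); have := h5 a Aa; have [_ h6] := hw j.
set z := u (w j) in h1 h2 h4 h5 h6 *; set q := grad U z in h5 h6 *.
have zr : `|z| <= `|x0| + r.
  have := ler_normD (z - x0) x0; rewrite subrK; lra.
have xr : `|x0| <= `|x0| + r by rewrite lerDl ltW.
have [hf hl] := hL _ _ _ zr xr Aa.
have zj : `|z - x0| < j.+1%:R^-1 := lt_le_trans h2 (wle j).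
have d1 : dot q (f z a) - dot p (f x0 a) = dot q (f z a - f x0 a) + dot (q - p) (f x0 a).
  by rewrite dotBl dotBr; ring.
have d2 : `|dot q (f z a - f x0 a)| <= n%:R * G * L * j.+1%:R^-1.
  apply: le_trans (le_norm_dot _ _) _; rewrite -!mulrA ler_wpM2l //.
  apply: ler_pM => //; first by apply: gb.
  by apply: le_trans hf _; rewrite ler_wpM2l ?(ltW L0) // ltW.
have d3 : `|dot (q - p) (f x0 a)| <= n%:R * `|f x0 a| * j.+1%:R^-1.
  apply: le_trans (le_norm_dot _ _) _; rewrite -!mulrA ler_wpM2l // mulrC ler_wpM2l //.
  exact: ltW.
have d4 : k * (l z a - l x0 a) <= k * L * j.+1%:R^-1.
  rewrite -mulrA ler_wpM2l ?(ltW k0) //; apply: le_trans (ler_norm _) _.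
  by apply: le_trans hl _; rewrite ler_wpM2l ?(ltW L0) // ltW.
move=> d5; have d6 := wle j.
have := le_trans (ler_norm _) d2; have := le_trans (ler_norm _) d3.
move=> d7 d8.
have : b <= (K + 1) * j.+1%:R^-1.
  have i0 : 0 < j.+1%:R^-1 :> R by rewrite invr_gt0 ltr0n.
  move: i0 d6 d7 d8 d4 d5; rewrite /b /K; move: d1.
  move: (j.+1%:R^-1) ((w j).+1%:R^-1) => i i'; lra.
rewrite leNgt mulrC -ltr_pdivlMr; last by rewrite ltr_wpDl // ltW.
by rewrite hj.
Qed.

Definition descends x (e : R) : Prop := exists a t,
  [/\ A a, 0 <= t, forall s, 0 <= s <= t -> D (traj x (fun=> a) s) &
   U (traj x (fun=> a) t) + k * running_cost (f := f) (l := l) x (fun=> a) t + e <= U x].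

(** [U] need not be differentiable at [x], so the control is read off at a differentiability point
    [z] close to [x], and [semiconcave_upper] at [z] carries the decrease along the trajectory from
    [x]. The duration [t] depends on [x0] alone, hence the uniform gain [d * t / 2]. *)
Let local_descent x0 : D x0 -> exists2 e : R, 0 < e & exists2 d : R, 0 < d &
  forall x, `|x - x0| < d -> descends x e.
Proof.
move=> Dx0.
have [r1 [c [B [r10 c0 hD hs]]]] := local_data Dx0.
have [r2 [d [G [r20 d0 G0 hG]]]] := decrease_nbhd Dx0.
have hU x : `|x - x0| < r1 -> {for x, continuous U} by move=> /hD [/cUD].
pose r := Num.min r1 r2.
have r0 : 0 < r by rewrite lt_min r10.
have rr1 y : `|y - x0| < r -> `|y - x0| < r1 by rewrite lt_min => /andP[].
have rr2 y : `|y - x0| < r -> `|y - x0| < r2 by rewrite lt_min => /andP[].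
have [C C0 hC] := trajectory_drift sa (`|x0| + r).
have [L L0 hL] := fl_lipschitz sa (`|x0| + r).
(* Coefficient of [t^2] in the errors: [2 c (2 C t)^2] from semiconcavity, and the Lipschitz
   variation of [f] and [l] over the distance [2 C t]. *)
pose Q := 8 * c * C ^+ 2 + 2 * (n%:R * G + k) * L * C + 1.
have Q0 : 0 < Q.
  rewrite ltr_wpDl // !addr_ge0 // ?mulr_ge0 ?exprn_ge0 ?(ltW C0) ?(ltW L0) //.
  by rewrite addr_ge0 ?mulr_ge0 // ltW.
pose t := Num.min 1 (Num.min (r / (8 * C)) (d / (4 * Q))).
have t0 : 0 < t by rewrite !lt_min ltr01 !divr_gt0 // mulr_gt0.
have t1 : t <= 1 by rewrite /t ge_min lexx.
have tr : C * t <= r / 8.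
  have : t <= r / (8 * C) by rewrite /t !ge_min lexx orbT.
  by rewrite ler_pdivlMr ?mulr_gt0 //; lra.
have td : Q * t <= d / 4.
  have : t <= d / (4 * Q) by rewrite /t !ge_min lexx !orbT.
  by rewrite ler_pdivlMr ?mulr_gt0 //; lra.
exists (d * t / 2); first by rewrite divr_gt0 ?mulr_gt0.
exists (r / 4); first by rewrite divr_gt0.
move=> x xr.
have xr1 : `|x - x0| < r1 by apply: rr1; lra.
have e8 : 0 < d * t / 8 by rewrite divr_gt0 ?mulr_gt0.
have /cvgrPdist_lt /(_ _ e8) /nbhs_rvP [g g0 hg] := hU x xr1.
(* With [z] this close to [x], both [U z - U x] and [dot p (x - z)] cost at most [d * t / 8]; with
   the quarter lost to [Q], half of the decrease [d * t] remains. *)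
pose e := Num.min (Num.min g (C * t)) (d * t / (8 * (n%:R * G + 1))).
have nG0 : 0 < n%:R * G + 1 by rewrite ltr_wpDl // mulr_ge0.
have e0 : 0 < e by rewrite !lt_min g0 mulr_gt0 // divr_gt0 // mulr_gt0.
have eC : e <= C * t by rewrite /e !ge_min lexx orbT.
have eG : n%:R * G * e <= d * t / 8.
  have : e <= d * t / (8 * (n%:R * G + 1)) by rewrite /e !ge_min lexx orbT.
  rewrite ler_pdivlMr ?mulr_gt0 //; lra.
have eg : e <= g by rewrite /e !ge_min lexx.
have [z0 [s [s0 hz0]]] := near_away x Dx0 e0.
have [|z zz0 dz] := semiconcave_dense c0 hU hs s0 (z0 := z0).
  move=> y /hz0 [yx _]; apply: rr1.
  have := ler_normD (y - x) (x - x0); rewrite addrA subrK; lra.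
have [zx zx0] := hz0 z (ltW zz0).
have zr : `|z - x0| < r.
  have := ler_normD (z - x) (x - x0); rewrite addrA subrK; lra.
have [pG [a Aa ha]] := hG z (rr2 _ zr) zx0 dz.
set p := grad U z in pG ha.
have ca := controls_cst Aa.
have nr y : `|y - x0| < r -> `|y| <= `|x0| + r.
  have := ler_normD (y - x0) x0; rewrite subrK; lra.
have xr' : `|x - x0| < r by lra.
pose y := traj x (fun=> a).
have ys u : 0 <= u <= t -> `|y u - x| <= C * t.
  move=> /andP[u0 ut]; have := hC x _ u ca (nr _ xr').
  rewrite u0 (le_trans ut t1) => /(_ isT) /le_trans; apply.
  by rewrite ler_wpM2l ?(ltW C0).
have yr u : 0 <= u <= t -> `|y u - x0| < r.
  move=> /ys; have := ler_normD (y u - x) (x - x0); rewrite addrA subrK; lra.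
have yz u : 0 <= u <= t -> `|y u - z| <= 2 * (C * t).
  move=> /ys; have := ler_normB (y u - x) (z - x); rewrite opprB addrA subrK; lra.
exists a, t; split => //; first exact: ltW.
  by move=> u /yr /rr1 /hD [].
have tt : 0 <= t <= t by rewrite ltW /=.
have up := semiconcave_upper c0 hs (rr1 _ zr) dz (rr1 _ (yr _ tt)).
have pzx : `|dot p (x - z)| <= d * t / 8.
  apply: le_trans (le_norm_dot _ _) _; apply: le_trans eG; rewrite -mulrA ler_wpM2l //.
  by rewrite distrC; apply: ler_pM => //; exact: ltW.
have int : dot p (y t - x) + k * running_cost (f := f) (l := l) x (fun=> a) t <=
    (- d + (n%:R * G + k) * L * (2 * (C * t))) * t.
  rewrite /y (trajectory_dot sa x p ca (ltW t0)) /running_cost -pintZ; last exact: (tame_running sa x ca).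
  rewrite -pintD; [|exact: (tame_dot_f sa x p ca) | exact/tameZ/(tame_running sa x ca)].
  apply: pint_le_cst; first exact: ltW.
    apply: tameD; [exact: (tame_dot_f sa x p ca) | exact/tameZ/(tame_running sa x ca)].
  move=> u ut; rewrite -/y; have [hf hl] := hL _ _ _ (nr _ (yr _ ut)) (nr _ zr) Aa.
  have h1 : `|dot p (f (y u) a - f z a)| <= n%:R * (G * (L * (2 * (C * t)))).
    apply: le_trans (le_norm_dot _ _) _; rewrite ler_wpM2l //.
    apply: ler_pM => //; apply: le_trans hf _.
    by rewrite ler_wpM2l ?(ltW L0) // yz.
  have h2 : k * (l (y u) a - l z a) <= k * (L * (2 * (C * t))).
    rewrite ler_wpM2l ?(ltW k0) //; apply: le_trans (ler_norm _) _.
    by apply: le_trans hl _; rewrite ler_wpM2l ?(ltW L0) // yz.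
  have := le_trans (ler_norm _) h1; rewrite dotBr; lra.
have Uzx : U z <= U x + d * t / 8.
  have : `|z - x| < g by lra.
  by move=> /hg /ltW; rewrite ler_norml; lra.
have sq : 2 * c * `|y t - z| ^+ 2 <= 2 * c * (2 * (C * t)) ^+ 2.
  have h := yz t tt; have h' : 0 <= 2 * (C * t) by rewrite !mulr_ge0 ?(ltW C0) ?(ltW t0).
  by rewrite ler_wpM2l ?mulr_ge0 // ler_pXn2r ?nnegrE.
have e1 : dot p (y t - z) = dot p (y t - x) + dot p (x - z) by rewrite !dotBr; ring.
have Qt : Q * t * t <= d / 4 * t by rewrite ler_wpM2r // ltW.
have := le_trans (ler_norm _) pzx.
rewrite -/p in up; rewrite -/(y t) e1 in up *.
have := sqr_ge0 t; rewrite /Q in Qt; lra.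
Qed.

Let J x a t := running_cost (f := f) (l := l) x (fun=> a) t.

Let good_step x (v : 'rV[R]_m * R) : Prop :=
  [/\ A v.1, 0 <= v.2, forall s, 0 <= s <= v.2 -> D (traj x (fun=> v.1) s),
    U (traj x (fun=> v.1) v.2) + k * J x v.1 v.2 <= U x &
    forall e, descends x e -> U (traj x (fun=> v.1) v.2) + k * J x v.1 v.2 + e / 2 <= U x].

Let good_step_exists x : exists v, D x -> good_step x v.
Proof.
(* Off [D] nothing is required, and [(0, 0)] is a default that makes the choice total. *)
have [Dx|Dx] := pselect (D x); last by exists (0, 0).
have [e e0 [d d0 /(_ x)]] := local_descent Dx; rewrite subrr normr0 => /(_ d0) xe.
(* [U] and the cost are nonnegative, so the descents available from [x] are bounded by [U x]; their
   supremum is positive by [local_descent], and half of it is attained. *)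
have ub e' : descends x e' -> e' <= U x.
  move=> [a [t [Aa t0 tD h]]]; apply: le_trans h; rewrite lerDr addr_ge0 //.
    by apply/U0/DOm/tD; rewrite t0 lexx.
  by rewrite mulr_ge0 ?(ltW k0) //; apply: (running_cost_ge0 sa); exact: controls_cst.
have hs : has_sup [set e | descends x e] by split; [exists e | exists (U x) => e' /ub].
have s0 : 0 < sup [set e | descends x e].
  by apply: lt_le_trans e0 _; apply: ub_le_sup; [exact: hs.2 |].
have [e' [a [t [Aa t0 tD h]]] se'] := sup_adherent (divr_gt0 s0 (ltr0n _ 2)) hs.
have e'0 : 0 < e' by move: se'; lra.
exists (a, t) => _; split => //=; first by apply: le_trans h; rewrite lerDl ltW.
move=> e1 h1; apply: le_trans h; rewrite lerD2l.
have : e1 <= sup [set e | descends x e] by apply: ub_le_sup; [exact: hs.2 |].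
move: se'; lra.
Qed.

(** The inequalities of the greedy steps telescope, so [k] times the cost accumulated up to any
    switching time is at most [U x]. It remains to see that the concatenated control is admissible
    and that the switching times exhaust the time before the exit. *)
Lemma value_le_restraint x : D x -> (value f l A T x <= (U x / k)%:E)%E.
Proof.
move=> Dx; have [st hst] := choice good_step_exists.
have [[_ [a0 Aa0]] _] := sa.
pose nxt z := traj z (fun=> (st z).1) (st z).2.
pose X j := iter j nxt x.
have DX j : D (X j).
  elim: j => [//|j ih]; have [_ h0 h _ _] := hst _ ih.
  by apply: h; rewrite h0 lexx.
have XS j : U (X j.+1) + k * J (X j) (st (X j)).1 (st (X j)).2 <= U (X j).
  by have [] := hst _ (DX j).
have J0 j : 0 <= J (X j) (st (X j)).1 (st (X j)).2.
  by apply: (running_cost_ge0 sa); apply: controls_cst; have [] := hst _ (DX j).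
have Ule j : U (X j.+1) <= U (X j).
  by apply: le_trans (XS j); rewrite lerDl mulr_ge0 ?(ltW k0).
have UX i j : (i <= j)%N -> U (X j) <= U (X i).
  move=> /subnKC <-; elim: (j - i)%N => [|q ih]; first by rewrite addn0.
  by rewrite addnS; exact: le_trans (Ule _) ih.
have levels (a b : R) : 0 <= a -> compact [set z | (Om `\` T°) z /\ a <= U z <= b].
  move=> a00; have := pr (@segment_compact R a b) => /(_ _).
  rewrite (_ : mkset _ = (Om `\` T°) `&` U @^-1` `[a, b]).
    by apply=> z /=; rewrite in_itv /= => /andP[/(le_trans a00)].
  by apply/seteqP; split => z /=; rewrite in_itv.
have bT z : (Om `\` T°) z -> T z -> U z = 0.
  by move=> [_ Tz] Tz'; apply: pd.2; split => //; exact: subset_closure.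
(* On the compact band where [U] lies between [e] and [U x], some descent [g] is available
   everywhere, and each greedy step takes at least [g / 2]; [U] would become negative. *)
have U_to0 (e : R) : 0 < e -> exists j, U (X j) < e.
  move=> e0; apply: contrapT => /forallNP H.
  have {}H j : e <= U (X j) by rewrite leNgt; apply/negP; exact: H.
  have cK := levels e (U x) (ltW e0).
  have [| |g g0 hg] := compact_uniform (P := descends) cK.
  - move=> z e1 e2 _ le [a [t [h1 h2 h3 h4]]]; exists a, t; split => //.
    by apply: le_trans h4; rewrite lerD2l.
  - move=> z [hz /andP[ez _]].
    have Dz : D z.
      split; first by case: hz.
      by move=> Tz; move: ez; rewrite (bT _ hz Tz) leNgt e0.
    have [e1 e10 [d d0 hd]] := local_descent Dz; exists e1 => //; exists d => // y _.
    exact: hd.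
  have dec j : U (X j) + j%:R * (g / 2) <= U x.
    elim: j => [|j ih]; first by rewrite mul0r addr0.
    have [_ _ _ _ /(_ g)] := hst _ (DX j).
    have Kj : [set z | (Om `\` T°) z /\ e <= U z <= U x] (X j).
      by split; [exact/DOm/DX | rewrite H (UX 0%N j (leq0n j))].
    move=> /(_ (hg _ Kj)).
    have := J0 j; rewrite -/(nxt (X j)) (_ : X j.+1 = nxt (X j)) // -[j.+1%:R]natr1.
    have := ltW k0 => k00 j0; have := mulr_ge0 k00 j0; lra.
  pose N := Num.truncn (U x / (g / 2)).
  have := dec N.+1; have := U0 (DOm (DX N.+1)).
  have : U x / (g / 2) < N.+1%:R by exact: truncnS_gt.
  rewrite ltr_pdivrMr ?divr_gt0 //; lra.
have UX_small (e : R) : 0 < e -> exists N, forall j, (N <= j)%N -> U (X j) < e.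
  by move=> /U_to0 [N hN]; exists N => j /UX Nj; exact: le_lt_trans hN.
(* The points [X j] remain in a compact sublevel set, and [U] vanishes at their cluster points,
   which therefore belong to the target. *)
have [xb xbT hxb] : exists2 z, T z & forall (e : R) N, 0 < e -> exists2 j, (N <= j)%N & `|X j - z| < e.
  have [|z [hz _] cz] := @compact_cluster_seq R n _ X (levels 0 (U x) (lexx _)).
    by move=> j; split; [exact/DOm/DX | rewrite U0 ?(UX 0%N j (leq0n j)) //; exact/DOm/DX].
  exists z => //; apply: contrapT => Tz.
  have Dz : D z by split => //; case: hz.
  have Uz : 0 < U z by exact: pd.1.
  have U2 : 0 < U z / 2 by rewrite divr_gt0.
  have /cvgrPdist_lt /(_ _ U2) /nbhs_rvP [d d0 hd] := cUD Dz.
  have [N hN] := UX_small _ U2; have [j Nj jz] := cz d N d0.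
  by have := hd _ jz; have := hN _ Nj; have := ler_norm (U z - U (X j)); lra.
(* [ts j] is the j-th switching time, and [ga j] follows the first [j] pieces, then the arbitrary
   control value [a0] forever. *)
pose ts := fix ts j := if j is j'.+1 then ts j' + (st (X j')).2 else 0.
pose ga := fix ga j := if j is j'.+1 then
  concat (ga j') (ts j') (concat (fun=> (st (X j')).1) (st (X j')).2 (fun=> a0)) else fun=> a0.
have st0 j : 0 <= (st (X j)).2 by have [] := hst _ (DX j).
have ts0 j : 0 <= ts j by elim: j => //= j ih; rewrite addr_ge0.
have tsS j : ts j <= ts j.+1 by rewrite /= lerDl.
have ts_le i j : (i <= j)%N -> ts i <= ts j.
  move=> /subnKC <-; elim: (j - i)%N => [|q ih]; first by rewrite addn0.
  by rewrite addnS; exact: le_trans ih (tsS _).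
have cst j : controls A (fun=> (st (X j)).1) by apply: controls_cst; have [] := hst _ (DX j).
have cst' j : controls A (concat (fun=> (st (X j)).1) (st (X j)).2 (fun=> a0)).
  by apply: controls_concat => //; exact: controls_cst.
have cga j : controls A (ga j).
  by elim: j => [|j ih] /=; [exact: controls_cst | exact: controls_concat].
have ga_tail j s : ts j <= s -> ga j s = a0.
  case: j => [//|j] /= h; rewrite /concat ltNge (le_trans _ h) ?lerDl //=.
  by rewrite ltNge lerBrDl h.
have ga_agree i j s : (i <= j)%N -> s < ts i -> ga j s = ga i s.
  move=> /subnKC <- si; elim: (j - i)%N => [|q ih]; first by rewrite addn0.
  rewrite addnS /= {1}/concat (lt_le_trans si) //; apply: ts_le; exact: leq_addr.
have gaP j : [/\ traj x (ga j) (ts j) = X j,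
    forall s, 0 <= s <= ts j -> D (traj x (ga j) s) &
    k * running_cost (f := f) (l := l) x (ga j) (ts j) <= U x - U (X j)].
  elim: j => [|j [e1 e2 e3]].
    split; rewrite /= ?(trajectory0 sa) //; last by rewrite /running_cost pint0 mulr0 subrr.
    move=> s /le_anti <-; rewrite (trajectory0 sa) //.
  have tr u : 0 <= u <= (st (X j)).2 -> traj x (ga j.+1) (ts j + u) = traj (X j) (fun=> (st (X j)).1) u.
    move=> /andP[u0 u1] /=; rewrite (traj_concat_ge sa) // e1.
    by rewrite (traj_concat_le sa) ?u0 //; exact: controls_cst.
  have tr' s : 0 <= s <= ts j -> traj x (ga j.+1) s = traj x (ga j) s.
    by move=> hs /=; rewrite (traj_concat_le sa).
  have [_ _ hD _ _] := hst _ (DX j).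
  split.
  - by rewrite [ts j.+1]/= tr ?st0 ?lexx.
  - move=> s /andP[s0 s1]; have [sj|js] := leP s (ts j).
      by rewrite tr' ?s0 //; apply: e2; rewrite s0.
    have -> : s = ts j + (s - ts j) by rewrite subrKC.
    have hs : 0 <= s - ts j <= (st (X j)).2 by rewrite subr_ge0 (ltW js) lerBlDl.
    by rewrite tr //; exact: hD.
  - rewrite /running_cost [ts j.+1]/= pint_split //; last exact: (tame_running sa x (cga j.+1)).
    rewrite mulrDr (_ : U x - U (X j.+1) = (U x - U (X j)) + (U (X j) - U (X j.+1))); last by ring.
    apply: lerD.
      apply: le_trans e3; rewrite le_eqVlt; apply/orP; left; apply/eqP; congr (_ * _).
      apply: eq_pint_lt; [exact: (tame_running sa x (cga j.+1)) | exact: (tame_running sa x (cga j)) |].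
      move=> s /andP[s0 sj]; rewrite tr' ?s0 ?(ltW sj) //.
      by congr (l _ _); apply: ga_agree.
    have := XS j; rewrite addrC -lerBrDr; apply: le_trans.
    rewrite le_eqVlt; apply/orP; left; apply/eqP; congr (_ * _).
    apply: eq_pint_lt.
    + exact: (tame_shift _ (tame_running sa x (cga j.+1))).
    + exact: (tame_running sa (X j) (cst j)).
    + move=> u /andP[u0 u1]; rewrite tr ?u0 ?(ltW u1) //; congr (l _ _).
      by rewrite /= /concat ltNge lerDl u0 /= addrAC subrr add0r u1.
have lim_al s : exists v, forall j, s < ts j -> ga j s = v.
  have [[i hi]|/forallNP h] := pselect (exists i, s < ts i).
    exists (ga i s) => j hj; have [ij|/ltnW ji] := leqP i j; first exact: ga_agree.
    by rewrite (ga_agree j i).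
  by exists a0 => j hj; have := h j hj.
(* The controls [ga j] stabilize at each time before the supremum of the switching times. That
   supremum may be finite, and [a0] is then the default from it on. *)
have [al hal] : exists al, forall s, (forall j, s < ts j -> ga j s = al s) /\
    ((forall j, ts j <= s) -> al s = a0).
  have /choice [al hal] : forall s, exists v, (forall j, s < ts j -> ga j s = v) /\
    ((forall j, ts j <= s) -> v = a0).
    move=> s; have [[i hi]|/forallNP h] := pselect (exists i, s < ts i).
      have [v hv] := lim_al s; exists v; split => // /(_ i).
      by rewrite leNgt hi.
    by exists a0; split => // j hj; have := h j hj.
  by exists al.
have cal : controls A al.
  split => [i|s s0].
    (* [al] is the pointwise limit of the [ga j]; beyond all the switching times both are equal to
       [a0]. *)
    apply: (measurable_fun_cvg (h := fun j s => ga j s 0 i)); first by move=> j; exact: (cga j).1.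
    move=> s _; have [[N hN]|/forallNP h] := pselect (exists i, s < ts i).
      apply/cvgrPdist_lt => e e0; exists N => // j /= Nj.
      by rewrite (hal s).1 ?subrr ?normr0 // (lt_le_trans hN) // ts_le.
    have hle j : ts j <= s by rewrite leNgt; apply/negP; exact: h.
    rewrite (hal s).2 //; apply/cvgrPdist_lt => e e0.
    by apply: nearW => j; rewrite ga_tail // subrr normr0.
  have [[j hj]|/forallNP h] := pselect (exists i, s < ts i).
    by rewrite -((hal s).1 j hj); exact: (cga j).2.
  by rewrite (hal s).2 // => j; rewrite leNgt; apply/negP; exact: h.
set Y := traj x al.
have Yga j s : 0 <= s <= ts j -> Y s = traj x (ga j) s.
  apply: (trajectory_causal sa x cal (cga j)) => u /andP[_ uj].
  by rewrite ((hal u).1 j).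
have YX j : Y (ts j) = X j.
  by rewrite (Yga j) ?ts0 ?lexx //; have [] := gaP j.
have avY j : avoids x al (ts j) (T := T) (f := f).
  move=> s sj; rewrite -/Y (Yga j) //; have [_ h _] := gaP j.
  by have [] := h s sj.
pose E := exit_time f T x al.
have tsE j : ((ts j)%:E < E)%E by exact: (avoids_lt_exit_time sa).
(* If the switching times are bounded with supremum [S], continuity at [S] makes the trajectory pass
   through the cluster point [xb] of the target, so the exit occurs no later than [S]. *)
have bndE (b : R) : (b%:E < E)%E -> exists j, b < ts j.
  move=> bE; apply: contrapT => /forallNP h.
  have hle j : ts j <= b by rewrite leNgt; apply/negP; exact: h.
  have hs : has_sup (range ts) by split; [exists (ts 0%N), 0%N | exists b => _ [j _ <-]].
  pose S := sup (range ts).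
  have tS j : ts j <= S by apply: ub_le_sup; [exact: hs.2 | exists j].
  have S0 : 0 <= S := le_trans (ts0 0%N) (tS 0%N).
  have Sb : S <= b by apply: sup_le_ub; [exact: hs.1 | move=> _ [j _ <-]].
  have YS : Y S = xb.
    apply/eqP; rewrite -subr_eq0 -normr_eq0 eq_le normr_ge0 andbT.
    apply/ler_addgt0Pr => e e0; rewrite add0r.
    have e2 : 0 < e / 2 by rewrite divr_gt0.
    have /subspace_continuousP := trajectory_continuous sa (x := x) cal.
    have S0' : `[0, +oo[%classic S by rewrite /= in_itv /= andbT.
    move=> /(_ S S0') /cvgrPdist_lt /(_ _ e2).
    rewrite near_withinE => /nbhs_ballP [d /= d0 hd].
    have [_ [N _ <-] Nd] := sup_adherent d0 hs.
    have [j Nj jd] := hxb (e / 2) N e2.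
    have Sj : `|Y S - X j| < e / 2.
      rewrite -YX; apply: hd; last by rewrite /= in_itv /= andbT.
      rewrite /ball /= ger0_norm ?subr_ge0 //; have := ts_le _ _ Nj; move: Nd; rewrite -/S; lra.
    have := ler_normD (Y S - X j) (X j - xb); rewrite addrA subrK; lra.
  have : (E <= S%:E)%E by apply: ereal_inf_lbound; exists S => //; split => //; rewrite -/Y YS.
  by move=> /(lt_le_trans bE); rewrite lte_fin ltNge Sb.
have adm : admissible f A T x al.
  apply/(admissibleP sa x cal) => e b e0 bE.
  have [N hN] := bndE b bE.
  have n1 : 0 < n%:R + 1 :> R by rewrite ltr_wpDl.
  have [j Nj jd] := hxb (e / (n%:R + 1)) N (divr_gt0 e0 n1).
  exists (ts j); split => //; first exact: lt_le_trans hN (ts_le _ _ Nj).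
  rewrite -/Y YX; apply: le_lt_trans (dist_to_le _ xbT) _.
  apply: le_lt_trans (enorm_le_norm _) _.
  rewrite ltr_pdivlMr // in jd; apply: le_lt_trans jd.
  by rewrite mulrC ler_wpM2l // lerDl.
rewrite value_out; last by case: Dx.
apply: (@le_trans _ _ (cost f l E x al)); first by apply: ereal_inf_lbound; exists al.
rewrite /cost; pose F j := `[0, ts j[%classic.
(* The time before the exit is the increasing union of the intervals [[0, ts j[], and monotone
   convergence carries the telescoped bound to the full cost. *)
have -> : [set s | 0 <= s /\ (s%:E < E)%E] = \bigcup_j F j.
  apply/seteqP; split => s /=.
    by move=> [s0 /bndE [j hj]]; exists j => //; rewrite /F /= in_itv /= s0.
  move=> [j _]; rewrite /F /= in_itv /= => /andP[s0 sj]; split => //.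
  by apply: lt_trans (tsE j); rewrite lte_fin.
have tL := tame_running sa x cal.
have L0 s : 0 <= s -> 0 <= l (Y s) (al s) by move=> s0; apply: (l_ge0 sa); exact: cal.2.
have cv : (\int[lebesgue_measure]_(s in F i) (l (Y s) (al s))%:E)%E @[i --> \oo] -->
    (\int[lebesgue_measure]_(s in \bigcup_i F i) (l (Y s) (al s))%:E)%E.
  apply: ge0_nondecreasing_set_cvg_integral.
  - by move=> i j ij; apply/subsetPset; rewrite /F; apply: subset_itvl; rewrite bnd_simp ts_le.
  - by move=> i; exact: measurable_itv.
  - move=> i; apply/measurable_EFinP; apply: measurable_funS tL.1 => //.
    by move=> s; rewrite /F /= !in_itv /= => /andP[->].
  - by move=> i s; rewrite /F /= in_itv /= => /andP[s0 _]; rewrite lee_fin L0.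
apply: (cvge_le _ cv).
apply: nearW => j; rewrite (integral_running_cost sa) //= lee_fin ler_pdivlMr // mulrC.
have [_ _ h] := gaP j.
have -> : running_cost (f := f) (l := l) x al (ts j) = running_cost (f := f) (l := l) x (ga j) (ts j).
  apply: eq_pint_lt => //; first exact: (tame_running sa x (cga j)).
  move=> s /andP[s0 sj]; rewrite -/Y (Yga j) ?s0 ?(ltW sj) //.
  by rewrite ((hal s).1 j).
by apply: le_trans h _; rewrite gerBl U0 //; exact: DOm.
Qed.

Lemma value_small x0 (e : R) : bdry T x0 -> 0 < e ->
  \forall x \near x0, outside T x -> (value f l A T x <= e%:E)%E.
Proof.
move=> bx0 e0; have [_ [[_ cT _] _]] := sa.
have Tx0 : T x0 by case: bx0 => /cT.
have Ox0 : Om x0 by exact: TOm.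
have hx0 : (Om `\` T°) x0 by split => //; case: bx0.
have /subspace_continuousP /(_ x0 hx0) /cvgrPdist_lt /(_ (e * k)) := cU.
rewrite mulr_gt0 // => /(_ isT); rewrite near_withinE => h1.
have h2 : nbhs x0 Om by apply: open_nbhs_nbhs; split.
apply: filterS2 h1 h2 => x h Ox nx.
have [Tx|Tx] := pselect (T x); first by rewrite value_in // lee_fin ltW.
apply: le_trans (value_le_restraint (conj Ox Tx)) _.
rewrite lee_fin ler_pdivrMr //.
have h' : `|U x0 - U x| < e * k := h (conj Ox nx).
rewrite (pd.2 _ bx0) sub0r normrN in h'.
exact: le_trans (ler_norm _) (ltW h').
Qed.

End MinimumRestraint.

(** * Semicontinuous envelopes *)

Section Envelopes.
Context {R : realType} {n : nat}.
Implicit Types (S : set 'rV[R]_n) (u v : 'rV[R]_n -> \bar R) (x y : 'rV[R]_n).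

Lemma le_usc_env S u x : S x -> (u x <= usc_env S u x)%E.
Proof.
move=> Sx; rewrite /usc_env limf_esupE; apply: le_ereal_inf_tmp => _ [V SV <-].
by apply: ereal_sup_ubound; exists x => //; exact: (nbhs_singleton SV).
Qed.

Lemma usc_env_lt S u x (c : \bar R) : (usc_env S u x < c)%E ->
  \forall y \near x, (S y -> u y < c)%E /\ (usc_env S u y < c)%E.
Proof.
rewrite {1}/usc_env limf_esupE => /ereal_inf_lt [_ [V SV <-] Vc].
have : nbhs x (fun y => nbhs y (fun z => S z -> V z)) by exact/nbhs_interior.
apply: filterS => y hy; split.
  move=> Sy; apply: le_lt_trans Vc; apply: ereal_sup_ubound; exists y => //.
  exact: (nbhs_singleton hy).
apply: le_lt_trans Vc; rewrite /usc_env limf_esupE.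
by apply: ereal_inf_lbound; exists V.
Qed.

Lemma usc_env_gt S u x (c : \bar R) (N : set 'rV[R]_n) : (c < usc_env S u x)%E -> nbhs x N ->
  exists y, [/\ N y, S y & (c < u y)%E].
Proof.
rewrite /usc_env limf_esupE => cS Nx.
have : (c < ereal_sup (u @` (N `&` S)))%E.
  apply: lt_le_trans cS _; apply: ereal_inf_lbound; exists (N `&` S) => //.
  by rewrite /within /=; apply: filterS Nx => y Ny Sy; split.
by move=> /ereal_sup_gt [_ [y [Ny Sy] <-] cy]; exists y.
Qed.

Lemma usc_env_le S u x (c : \bar R) : (\forall y \near x, S y -> (u y <= c)%E) ->
  (usc_env S u x <= c)%E.
Proof.
move=> h; rewrite /usc_env limf_esupE; apply: ereal_inf_le.
exists (ereal_sup (u @` [set y | (u y <= c)%E])); first by exists [set y | (u y <= c)%E].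
by apply: ge_ereal_sup => _ [y /= yc <-].
Qed.

(** True by definition of the lower limit; every fact on lower envelopes follows from its upper
    counterpart by duality. *)
Lemma lsc_envE S u x : lsc_env S u x = (- usc_env S (fun y => - u y)%E x)%E.
Proof. by []. Qed.

Lemma lsc_env_le S u x : S x -> (lsc_env S u x <= u x)%E.
Proof. by move=> Sx; rewrite lsc_envE leeNl; exact: (@le_usc_env S (fun y => - u y)%E). Qed.

Lemma lsc_env_gt S u x (c : \bar R) : (c < lsc_env S u x)%E ->
  \forall y \near x, (S y -> c < u y)%E /\ (c < lsc_env S u y)%E.
Proof.
rewrite lsc_envE lteNr => /usc_env_lt; apply: filterS => y [h1 h2].
by rewrite lsc_envE lteNr; split => // /h1; rewrite lteN2.
Qed.

Lemma lsc_env_lt S u x (c : \bar R) (N : set 'rV[R]_n) : (lsc_env S u x < c)%E -> nbhs x N ->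
  exists y, [/\ N y, S y & (u y < c)%E].
Proof.
rewrite lsc_envE lteNl => h /(usc_env_gt h) [y [Ny Sy]].
by rewrite lteN2 => yc; exists y.
Qed.

Lemma lsc_env_ge S u x (c : \bar R) : (\forall y \near x, S y -> (c <= u y)%E) ->
  (c <= lsc_env S u x)%E.
Proof.
move=> h; rewrite lsc_envE leeNr; apply: usc_env_le; apply: filterS h => y h /h.
by rewrite leeN2.
Qed.

Lemma usc_env_fin S u x (a b : R) : S x ->
  (forall y, S y -> (a%:E <= u y <= b%:E)%E) ->
  (a%:E <= usc_env S u x <= b%:E)%E.
Proof.
move=> Sx ab; apply/andP; split.
  by apply: le_trans (le_usc_env _ Sx); case/andP: (ab x Sx).
by apply: usc_env_le; apply/nbhs_rvP; exists 1 => // y _ /ab /andP[].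
Qed.

Lemma lsc_env_fin S u x (a b : R) : S x ->
  (forall y, S y -> (a%:E <= u y <= b%:E)%E) ->
  (a%:E <= lsc_env S u x <= b%:E)%E.
Proof.
move=> Sx ab; apply/andP; split; last first.
  by apply: le_trans (lsc_env_le _ Sx) _; case/andP: (ab x Sx).
by apply: lsc_env_ge; apply/nbhs_rvP; exists 1 => // y _ /ab /andP[].
Qed.

End Envelopes.

Section SupImage.
Context {R : realType} {I : Type} (A : set I) (g : I -> R) (b : R).
Context (A0 : A !=set0) (gb : forall a, A a -> g a <= b).

Let hs : has_sup [set g a | a in A].
Proof. by split; [have [a Aa] := A0; exists (g a), a | exists b => _ [a Aa <-]; exact: gb]. Qed.

(** The bound [b] and the nonemptiness of [A] ensure that [sup] is a least upper bound and not its
    default value. *)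
Lemma sup_image_le c : sup [set g a | a in A] <= c <-> forall a, A a -> g a <= c.
Proof.
split=> h => [a Aa|]; last by apply: sup_le_ub; [exact: hs.1 | move=> _ [a Aa <-]; exact: h].
by apply: le_trans h; apply: ub_le_sup; [exact: hs.2 | exists a].
Qed.

Lemma sup_image_ge0 : 0 <= sup [set g a | a in A] <->
  forall d, 0 < d -> exists2 a, A a & - d < g a.
Proof.
split=> h => [d d0|].
  have [_ [a Aa <-] ha] := sup_adherent d0 hs; exists a => //; lra.
apply/ler_addgt0Pr => d d0; have [a Aa ha] := h d d0.
have : g a <= sup [set g a | a in A] by apply: ub_le_sup; [exact: hs.2 | exists a].
lra.
Qed.

End SupImage.

(** * Viscosity properties from dynamic programming *)

Section ViscosityDPP.
Context {R : realType} {n m : nat} {f : 'rV[R]_n -> 'rV[R]_m -> 'rV[R]_n}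
  {l : 'rV[R]_n -> 'rV[R]_m -> R} {A : set 'rV[R]_m} {T : set 'rV[R]_n}.
Context (sa : standing_assumptions f l A T).
Implicit Types (x y p : 'rV[R]_n) (alpha : R -> 'rV[R]_m) (phi : 'rV[R]_n -> R).
Local Notation traj := (trajectory f).
Local Notation J := (running_cost (f := f) (l := l)).
Local Notation K := (kruzkov_hamiltonian f l A).

(** The factor [q] treats the two Hamiltonians together: [q = 1] for the original one, [q = 1 - r]
    for the transformed one. *)
Lemma hamiltonian_bound x p (q : R) : exists b, forall a, A a ->
  - dot p (f x a) - l x a * q <= b.
Proof.
have [M M0 hM] := f_growth sa; have [C C0 hC] := l_bounded sa `|x|.
exists (n%:R * (`|p| * (M * (1 + `|x|))) + C * `|q|) => a Aa; apply: lerD.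
  rewrite -dotNl; apply: le_trans (ler_norm _) _; apply: le_trans (le_norm_dot _ _) _.
  by rewrite normrN ler_wpM2l // ler_wpM2l // hM.
apply: le_trans (ler_norm _) _; rewrite normrN normrM ler_wpM2r // ger0_norm ?(l_ge0 sa) //.
exact: hC.
Qed.

Let A0 : A !=set0. Proof. by have [[]] := sa. Qed.

Lemma kruzkovE x r p : K x r p = sup [set - dot p (f x a) - l x a * (1 - r) | a in A].
Proof.
congr sup; apply/seteqP; split => _ [a Aa <-]; exists a => //; ring.
Qed.

Lemma hamiltonianE x p : hamiltonian f l A x p = sup [set - dot p (f x a) - l x a * 1 | a in A].
Proof.
congr sup; apply/seteqP; split => _ [a Aa <-]; exists a => //; ring.
Qed.

Lemma kruzkov_le0 x r p : K x r p <= 0 <->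
  forall a, A a -> - dot p (f x a) - l x a * (1 - r) <= 0.
Proof.
by have [b hb] := hamiltonian_bound x p (1 - r); rewrite kruzkovE; exact: sup_image_le A0 hb _.
Qed.

Lemma kruzkov_ge0 x r p : 0 <= K x r p <->
  forall d, 0 < d -> exists2 a, A a & - d < - dot p (f x a) - l x a * (1 - r).
Proof.
by have [b hb] := hamiltonian_bound x p (1 - r); rewrite kruzkovE; exact: sup_image_ge0 A0 hb.
Qed.

Lemma hamiltonian_le0 x p : hamiltonian f l A x p <= 0 <->
  forall a, A a -> - dot p (f x a) - l x a * 1 <= 0.
Proof.
by have [b hb] := hamiltonian_bound x p 1; rewrite hamiltonianE; exact: sup_image_le A0 hb _.
Qed.

Lemma hamiltonian_ge0 x p : 0 <= hamiltonian f l A x p <->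
  forall d, 0 < d -> exists2 a, A a & - d < - dot p (f x a) - l x a * 1.
Proof.
by have [b hb] := hamiltonian_bound x p 1; rewrite hamiltonianE; exact: sup_image_ge0 A0 hb.
Qed.

Lemma expR_quad (s : R) : 0 <= s -> 0 <= expR (- s) - 1 + s <= s ^+ 2.
Proof.
move=> s0; have h1 := expR_ge1Dx (- s); apply/andP; split; first by lra.
have h2 := expR_ge1Dx s; have p := expR_gt0 (- s).
have e : expR (- s) * expR s = 1 by rewrite -expRD addNr expR0.
have : expR (- s) * (1 + s) <= 1 by rewrite -[leRHS]e ler_wpM2l // ltW.
set v := expR (- s) in h1 p *; move=> h3.
have h4 : v * s >= (1 - s) * s by rewrite ler_wpM2r //; lra.
lra.
Qed.

(** First order part of the transformed dynamic programming relation, with the state frozen at [x]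
    and only the control moving: a pointwise bound over [A] then integrates along any measurable
    control. *)
Definition frozen_cost x p (q : R) alpha t : R :=
  pint (fun s => dot p (f x (alpha s)) + q * l x (alpha s)) t.

Lemma tame_frozen x p q alpha : controls A alpha ->
  tame (fun s => dot p (f x (alpha s)) + q * l x (alpha s)).
Proof.
move=> ca; have cx : {within `[0, +oo[, continuous (fun _ : R => x)}.
  by apply: continuous_subspaceT; exact: cst_continuous.
apply: tameD; last exact/tameZ/(tame_l sa ca cx).
by apply: tame_sum => i; apply: tameZ; exact: (tame_f sa i ca cx).
Qed.

(** The radius [d] depends on [t], and the error [e * t] is uniform in the control. This order of
    quantifiers lets [t] be fixed first and [x'] be taken afterwards so close to [x] that [W x']
    differs from the envelope at [x] by less than a multiple of [t]. *)
Lemma short_time_expansion x phi (q : R) : ~ T x -> differentiable phi x -> 0 <= q <= 1 ->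
  forall (e r : R), 0 < e -> 0 < r -> exists2 t0 : R, 0 < t0 & forall t, 0 < t <= t0 ->
  exists2 d : R, 0 < d & forall x' alpha, `|x' - x| < d -> controls A alpha ->
  [/\ avoids x' alpha t (f := f) (T := T), `|traj x' alpha t - x| < r &
     `|expR (- J x' alpha t) * (q - (phi (traj x' alpha t) - phi x)) - q +
       frozen_cost x (grad phi x) q alpha t| <= e * t].
Proof.
move=> Tx dphi /andP[q0 q1] e r e0 r0; set p := grad phi x.
have [_ [[_ cT _] _]] := sa.
have nT : nbhs x (~` T) by apply: open_nbhs_nbhs; split => //; exact: closed_openC.
have [rT rT0 hT] := (nbhs_rvP _ _).1 nT.
have [C C0 hC] := trajectory_drift sa (`|x| + 1).
have [L L0 hL] := fl_lipschitz sa (`|x| + 1 + (C + 1)).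
have [B B0 hB] := l_bounded sa (`|x| + 1 + (C + 1)).
have C1 : 0 < C + 1 by rewrite ltr_wpDl // ltW.
pose P := n%:R * `|p|.
have P0 : 0 <= P by rewrite mulr_ge0.
pose e1 := Num.min 1 (e / (4 * (C + 1))).
have e10 : 0 < e1 by rewrite lt_min ltr01 divr_gt0 // mulr_gt0.
have e1C : e1 * (C + 1) <= e / 4.
  have : e1 <= e / (4 * (C + 1)) by rewrite ge_min lexx orbT.
  rewrite ler_pdivlMr ?mulr_gt0 //; lra.
have [rp rp0 hp] := (nbhs_rvP _ _).1 (diff_expansion dphi e10).
pose K1 := P * (C + 1) + (C + 1).
have K10 : 0 <= K1 by rewrite addr_ge0 ?mulr_ge0 // ltW.
pose Q := B ^+ 2 * (1 + K1) + B * K1 + L * (C + 1) + P * (L * (C + 1)) + 1.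
have Q0 : 0 < Q.
  have B0' := ltW B0; have L0' := ltW L0; have C1' := ltW C1.
  have q1' : 0 <= B ^+ 2 * (1 + K1) by apply: mulr_ge0; [exact: exprn_ge0 | exact: addr_ge0].
  have q2' : 0 <= B * K1 by rewrite mulr_ge0.
  have q3' : 0 <= L * (C + 1) by rewrite mulr_ge0.
  have q4' : 0 <= P * (L * (C + 1)) by rewrite mulr_ge0.
  rewrite /Q; lra.
pose rho := Num.min rT (Num.min rp r).
have rho0 : 0 < rho by rewrite !lt_min rT0 rp0 r0.
exists (Num.min 1 (Num.min (rho / (2 * (C + 1))) (e / (2 * Q)))).
  by rewrite !lt_min ltr01 !divr_gt0 // mulr_gt0.
move=> t; rewrite !le_min => /andP[t0 /and3P[t1 t2 t3]].
(* Starting at distance at most [kap * t] from [x] makes the term [dot p (x' - x)] at most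
   [e / 4 * t]. *)
pose kap := Num.min 1 (e / (4 * (P + 1))).
have P1 : 0 < P + 1 by rewrite ltr_wpDl.
have kap0 : 0 < kap by rewrite lt_min ltr01 divr_gt0 // mulr_gt0.
have kap1 : kap <= 1 by rewrite ge_min lexx.
have Pk : P * kap <= e / 4.
  have : kap <= e / (4 * (P + 1)) by rewrite ge_min lexx orbT.
  rewrite ler_pdivlMr ?mulr_gt0 //; lra.
have kt0 : 0 < kap * t by rewrite mulr_gt0.
exists (kap * t) => // x' alpha x'x ca.
have kt1 : kap * t <= t by rewrite ler_piMl // ltW.
have x'r : `|x'| <= `|x| + 1.
  have := ler_normD (x' - x) x; rewrite subrK; lra.
pose y := traj x' alpha.
have yx s : 0 <= s <= t -> `|y s - x| <= (C + 1) * t.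
  move=> /andP[s0 st]; have := hC x' alpha s ca x'r.
  rewrite s0 (le_trans st t1) => /(_ isT) h.
  have := ler_normD (y s - x') (x' - x); rewrite addrA subrK.
  have : C * s <= C * t by rewrite ler_wpM2l // ltW.
  rewrite -/y in h; lra.
have Ct : (C + 1) * t <= rho / 2.
  move: t2; rewrite ler_pdivlMr ?mulr_gt0 //; lra.
have yrho s : 0 <= s <= t -> `|y s - x| < rho by move=> /yx; lra.
have tt : 0 <= t <= t by rewrite ltW /=.
have yr s : 0 <= s <= t -> `|y s| <= `|x| + 1 + (C + 1).
  move=> /yx h; have := ler_normD (y s - x) x; rewrite subrK.
  have : (C + 1) * t <= C + 1 by rewrite ler_piMr // ltW.
  lra.
have xr : `|x| <= `|x| + 1 + (C + 1) by lra.
split.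
- by move=> s /yrho; rewrite /rho !lt_min => /and3P[/hT h _ _]; exact: h.
- by have := yrho _ tt; rewrite /rho !lt_min => /and3P[].
have hphi := hp (y t) _; have {}hphi := hphi ltac:(by have := yrho _ tt; rewrite /rho !lt_min => /and3P[]).
rewrite -/p -/y in hphi *; set De := phi (y t) - phi x in hphi *.
have yxt := yx _ tt; have yxn := normr_ge0 (y t - x).
have D1 : `|De - dot p (y t - x)| <= e / 4 * t.
  apply: le_trans hphi _.
  have : e1 * `|y t - x| <= e1 * ((C + 1) * t) by rewrite ler_wpM2l // ltW.
  have : e1 * (C + 1) * t <= e / 4 * t by rewrite ler_wpM2r // ltW.
  lra.
have D2 : `|dot p (x' - x)| <= e / 4 * t.
  apply: le_trans (le_norm_dot _ _) _; rewrite mulrA -/P.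
  have : P * `|x' - x| <= P * (kap * t) by rewrite ler_wpM2l // ltW.
  have : P * kap * t <= e / 4 * t by rewrite ler_wpM2r // ltW.
  lra.
have cy := trajectory_continuous sa (x := x') ca.
have cx : {within `[0, +oo[, continuous (fun _ : R => x)}.
  by apply: continuous_subspaceT; exact: cst_continuous.
have tf1 := tame_dot_f sa x' p ca.
have tf2 : tame (fun s => dot p (f x (alpha s))).
  by apply: tame_sum => i; apply: tameZ; exact: (tame_f sa i ca cx).
have tl1 := tame_running sa x' ca; have tl2 := tame_l sa ca cx.
have D3 : `|dot p (y t - x') - pint (fun s => dot p (f x (alpha s))) t| <= P * (L * ((C + 1) * t)) * t.
  rewrite /y (trajectory_dot sa x' p ca (ltW t0)) -pintB //.
  apply: pint_norm_le; [exact: ltW | exact: tameB | ].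
  move=> s st; rewrite -dotBr; apply: le_trans (le_norm_dot _ _) _; rewrite mulrA -/P ler_wpM2l //.
  have [hf _] := hL _ _ _ (yr s st) xr (ca.2 s (proj1 (andP st))).
  by apply: le_trans hf _; rewrite ler_wpM2l ?(ltW L0) // yx.
have D4 : `|J x' alpha t - pint (fun s => l x (alpha s)) t| <= L * ((C + 1) * t) * t.
  rewrite /running_cost -pintB //.
  apply: pint_norm_le; [exact: ltW | exact: tameB | ].
  move=> s st; have [_ hl] := hL _ _ _ (yr s st) xr (ca.2 s (proj1 (andP st))).
  by apply: le_trans hl _; rewrite ler_wpM2l ?(ltW L0) // yx.
have J0 : 0 <= J x' alpha t by exact: (running_cost_ge0 sa).
have JB : J x' alpha t <= B * t.
  apply: pint_le_cst => //; first exact: ltW.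
  by move=> s st; apply: hB; [exact: yr | apply: ca.2; case/andP: st].
have DK : `|De| <= K1 * t.
  have h : `|dot p (y t - x)| <= P * ((C + 1) * t).
    by apply: le_trans (le_norm_dot _ _) _; rewrite mulrA -/P ler_wpM2l.
  have h2 : e1 * `|y t - x| <= 1 * ((C + 1) * t).
    by apply: ler_pM => //; [exact: ltW | rewrite ge_min lexx].
  have := ler_normD (De - dot p (y t - x)) (dot p (y t - x)); rewrite subrK.
  rewrite /K1; lra.
have -> : frozen_cost x p q alpha t = pint (fun s => dot p (f x (alpha s))) t + q * pint (fun s => l x (alpha s)) t.
  by rewrite /frozen_cost pintD ?pintZ //; exact: tameZ.
have e2 : dot p (y t - x) = dot p (y t - x') + dot p (x' - x) by rewrite !dotBr; ring.
set If := pint _ t in D3 *; set Il := pint _ t in D4 *; set Jt := J x' alpha t in D4 J0 JB *.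
(* The terms of order [t] cancel. What is left: the quadratic remainder of the exponential, the
   product of cost and increment of [phi], the two freezing errors, the remainder of [phi], and the
   displacement of the starting point. *)
have ident : expR (- Jt) * (q - De) - q + (If + q * Il) =
  (expR (- Jt) - 1 + Jt) * (q - De) + Jt * De - q * (Jt - Il) - ((De - dot p (y t - x)) + dot p (x' - x) + (dot p (y t - x') - If)).
  by rewrite e2; ring.
rewrite ident.
have [E1 E2] := andP (expR_quad J0).
have qD : `|q - De| <= 1 + K1.
  have := ler_normB q De; rewrite (ger0_norm q0).
  have : K1 * t <= K1 by rewrite ler_piMr.
  lra.
have F1 : `|(expR (- Jt) - 1 + Jt) * (q - De)| <= (B * t) ^+ 2 * (1 + K1).
  rewrite normrM (ger0_norm E1); apply: ler_pM => //.
  by apply: le_trans E2 _; rewrite ler_pXn2r // nnegrE // mulr_ge0 // ltW.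
have F2 : `|Jt * De| <= B * t * (K1 * t) by rewrite normrM (ger0_norm J0) ler_pM.
have F3 : `|q * (Jt - Il)| <= L * ((C + 1) * t) * t.
  by rewrite normrM (ger0_norm q0); apply: le_trans D4; rewrite ler_piMl.
have Qt : Q * t * t <= e / 2 * t.
  rewrite ler_wpM2r ?(ltW t0) //; move: t3; rewrite ler_pdivlMr ?mulr_gt0 //; lra.
apply: le_trans (ler_normB _ _) _.
have G1 := ler_normB ((expR (- Jt) - 1 + Jt) * (q - De) + Jt * De) (q * (Jt - Il)).
have G2 := ler_normD ((expR (- Jt) - 1 + Jt) * (q - De)) (Jt * De).
have G3 := ler_normD ((De - dot p (y t - x)) + dot p (x' - x)) (dot p (y t - x') - If).
have G4 := ler_normD (De - dot p (y t - x)) (dot p (x' - x)).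
have := sqr_ge0 t; rewrite /Q in Qt; lra.
Qed.

Section Solution.
Context (W : 'rV[R]_n -> R) (kruzkov_value_itv : forall x, 0 <= W x <= 1).
Context (dpp_sub : forall x a t, A a -> 0 <= t -> avoids x (fun=> a) t (f := f) (T := T) ->
  expR (- J x (fun=> a) t) * (1 - W (traj x (fun=> a) t)) <= 1 - W x).
Context (dpp_super : forall x (e : R), ~ T x -> 0 < e -> exists2 alpha, controls A alpha &
  forall t, 0 <= t -> avoids x alpha t (f := f) (T := T) ->
  1 - W x <= expR (- J x alpha t) * (1 - W (traj x alpha t)) + e).

Lemma outside_notin x : ~ T x -> outside T x.
Proof. by move=> Tx /interior_subset. Qed.

(** Only differentiability at [x] is asked of [phi], because this is also applied to test functions
    of class C^1 on the domain of the value alone. *)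
Lemma dpp_subsolution_at phi x : let v := usc_env (outside T) (EFin \o W) in
  ~ T x -> differentiable phi x ->
  (\forall y \near x, (v y - (phi y)%:E <= v x - (phi x)%:E)%E) ->
  K x (fine (v x)) (grad phi x) <= 0.
Proof.
move=> v Tx dphi near_x; apply/kruzkov_le0 => a Aa; rewrite leNgt; apply/negP => h0.
have vb y : outside T y -> (0 <= v y <= 1)%E.
  by move=> oy; apply: usc_env_fin => // z _ /=; rewrite !lee_fin.
have vfin y : outside T y -> v y = (fine (v y))%:E.
  move=> /vb /andP[h1 h2]; rewrite fineK // fin_numE.
  by apply/andP; split; apply/eqP => e; rewrite e in h1 h2.
have ox := outside_notin Tx.
set q := 1 - fine (v x) in h0 *.
have q01 : 0 <= q <= 1.
  have := vb x ox; rewrite (vfin x ox) !lee_fin /q => /andP[h1 h2]; apply/andP; split; lra.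
set p := grad phi x in h0 *; set h := _ - _ in h0.
have e0 : 0 < h / 4 by rewrite divr_gt0.
have [r r0 hr] := (nbhs_rvP _ _).1 near_x.
have [t0 t00 ht] := short_time_expansion Tx dphi q01 e0 r0.
have [|d d0 hd] := ht t0; first by rewrite t00 lexx.
(* A point [x'] within [h / 4 * t0] of the envelope; this and the expansion error leave half of the
   gain [h * t0]. *)
have : ((fine (v x) - h / 4 * t0)%:E < v x)%E.
  by rewrite [X in (_ < X)%E]vfin // lte_fin gtrBl mulr_gt0.
move=> /usc_env_gt /(_ ((nbhs_rvP _ [set y | `|y - x| < d]).2 (ex_intro2 _ _ d d0 (fun y h => h)))).
move=> [x' [/= x'x ox' Wx']]; rewrite lte_fin in Wx'.
have ca := controls_cst Aa.
have [av yr E] := hd x' _ x'x ca.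
set y := traj x' _ t0 in av yr E.
have Ty : ~ T y by apply: av; rewrite ltW /=.
have oy := outside_notin Ty.
have Wy : W y <= fine (v y).
  by rewrite -lee_fin -(vfin y oy); exact: (le_usc_env (EFin \o W) oy).
have := hr y yr; rewrite (vfin y oy) (vfin x ox) -!EFinB lee_fin => hy.
have := dpp_sub Aa (ltW t00) av; rewrite -/y => h1.
set ee := expR _ in h1 E.
have ee0 : 0 <= ee by exact: expR_ge0.
have h2 : ee * (q - (phi y - phi x)) <= ee * (1 - W y).
  rewrite ler_wpM2l // /q; lra.
have h3 : frozen_cost x p q (fun=> a) t0 = - h * t0.
  by rewrite /frozen_cost pint_cst ?(ltW t00) // /h; congr (_ * _); ring.
move: E; rewrite -/p h3 ler_norml => /andP[E1 _].
have ht0 : 0 < h * t0 by rewrite mulr_gt0.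
have : q = 1 - fine (v x) by [].
lra.
Qed.

Lemma dpp_subsolution : viscosity_subsolution K (~` T) (usc_env (outside T) (EFin \o W)).
Proof. by move=> phi cphi x Tx _; apply: dpp_subsolution_at (cphi x Tx).1. Qed.

Lemma dpp_supersolution : viscosity_supersolution K (~` T) (lsc_env (outside T) (EFin \o W)).
Proof.
move=> phi cphi x Tx _ near_x; apply/kruzkov_ge0 => h0 h00.
apply: contrapT => /forall2NP H.
set v := lsc_env _ _ in near_x H *.
have vb y : outside T y -> (0 <= v y <= 1)%E.
  by move=> oy; apply: lsc_env_fin => // z _ /=; rewrite !lee_fin.
have vfin y : outside T y -> v y = (fine (v y))%:E.
  move=> /vb /andP[h1 h2]; rewrite fineK // fin_numE.
  by apply/andP; split; apply/eqP => e; rewrite e in h1 h2.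
have ox := outside_notin Tx.
set q := 1 - fine (v x) in H *.
have q01 : 0 <= q <= 1.
  have := vb x ox; rewrite (vfin x ox) !lee_fin /q => /andP[h1 h2]; apply/andP; split; lra.
have [dphi _] := cphi x Tx.
set p := grad phi x in H *.
have Ha a : A a -> h0 <= dot p (f x a) + q * l x a.
  by move=> Aa; have [//|/negP] := H a; rewrite -leNgt; lra.
have e0 : 0 < h0 / 4 by rewrite divr_gt0.
have [r r0 hr] := (nbhs_rvP _ _).1 near_x.
have [t0 t00 ht] := short_time_expansion Tx dphi q01 e0 r0.
have [|d d0 hd] := ht t0; first by rewrite t00 lexx.
have : (v x < (fine (v x) + h0 / 4 * t0)%:E)%E.
  by rewrite [X in (X < _)%E]vfin // lte_fin ltrDl mulr_gt0.
have nx : nbhs x [set y | `|y - x| < d /\ ~ T y].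
  have [_ [[_ cT _] _]] := sa.
  have nT : nbhs x (~` T) by apply: open_nbhs_nbhs; split => //; exact: closed_openC.
  have n2 : nbhs x [set y | `|y - x| < d] by apply/nbhs_rvP; exists d.
  by apply: filterS2 nT n2 => y.
move=> /lsc_env_lt /(_ nx) [x' [/= [x'x Tx'] ox' Wx']]; rewrite lte_fin in Wx'.
(* The suboptimality is taken of order [t0], which is legitimate because [t0] has been fixed before
   [x'] and [alpha]. *)
have et : 0 < h0 / 4 * t0 by rewrite mulr_gt0.
have [alpha ca hal] := dpp_super Tx' et.
have [av yr E] := hd x' _ x'x ca.
have := hal t0 (ltW t00) av.
set y := traj x' _ t0 in av yr E * => h1.
have Ty : ~ T y by apply: av; rewrite ltW /=.
have oy := outside_notin Ty.
have Wy : fine (v y) <= W y.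
  by rewrite -lee_fin -(vfin y oy); exact: (lsc_env_le (EFin \o W) oy).
have := hr y yr; rewrite (vfin y oy) (vfin x ox) -!EFinB lee_fin => hy.
set ee := expR _ in h1 E.
have ee0 : 0 <= ee by exact: expR_ge0.
have h2 : ee * (1 - W y) <= ee * (q - (phi y - phi x)).
  rewrite ler_wpM2l // /q; lra.
have h3 : h0 * t0 <= frozen_cost x p q alpha t0.
  apply: pint_ge_cst; [exact: ltW | exact: tame_frozen |].
  by move=> s /andP[s0 _]; apply: Ha; exact: ca.2.
move: E; rewrite -/p ler_norml => /andP[_ E1].
have : q = 1 - fine (v x) by [].
lra.
Qed.

End Solution.

End ViscosityDPP.

(** * Test functions of class C^1 and maxima of semicontinuous functions *)

Section C1Calculus.
Context {R : realType} {n : nat}.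
Implicit Types (O : set 'rV[R]_n) (phi psi : 'rV[R]_n -> R) (x y : 'rV[R]_n).

Lemma diff_lipschitz phi x : differentiable phi x ->
  \forall y \near x, `|phi y - phi x| <= (n%:R * `|grad phi x| + 1) * `|y - x|.
Proof.
move=> /diff_expansion /(_ 1 ltr01); apply: filterS => y h.
have := le_norm_dot (grad phi x) (y - x).
have := ler_normD (phi y - phi x - dot (grad phi x) (y - x)) (dot (grad phi x) (y - x)).
rewrite subrK; lra.
Qed.

Lemma continuous_near_eq (V : topologicalType) (F G : 'rV[R]_n -> V) x :
  {for x, continuous F} -> (\forall y \near x, F y = G y) -> {for x, continuous G}.
Proof.
move=> cF h B; rewrite -(nbhs_singleton h) => /cF FB.
by apply: filterS2 h FB => y /= <-.
Qed.

Lemma gradD phi psi x : differentiable phi x -> differentiable psi x ->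
  differentiable (fun y => phi y + psi y) x /\
  grad (fun y => phi y + psi y) x = grad phi x + grad psi x.
Proof.
move=> d1 d2; apply: diff_of_expansion => e e0.
have e2 : 0 < e / 2 by rewrite divr_gt0.
apply: filterS2 (diff_expansion d1 e2) (diff_expansion d2 e2) => y h1 h2.
rewrite dotDl; have := ler_normD (phi y - phi x - dot (grad phi x) (y - x))
  (psi y - psi x - dot (grad psi x) (y - x)).
rewrite (_ : phi y - phi x - _ + (psi y - psi x - _) =
  phi y + psi y - (phi x + psi x) - (dot (grad phi x) (y - x) + dot (grad psi x) (y - x))); last by ring.
lra.
Qed.

(** A quadratic remainder for [theta] is what the outer functions in use, polynomials of degree two
    and the logarithm, satisfy by elementary inequalities. *)
Lemma grad_comp (theta : R -> R) phi x (d K rho : R) : differentiable phi x ->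
  0 < rho -> 0 <= K ->
  (forall s, `|s - phi x| <= rho -> `|theta s - theta (phi x) - d * (s - phi x)| <= K * (s - phi x) ^+ 2) ->
  differentiable (fun y => theta (phi y)) x /\
  grad (fun y => theta (phi y)) x = d *: grad phi x.
Proof.
move=> dp rho0 K0 ht; apply: diff_of_expansion => e e0.
pose P := n%:R * `|grad phi x| + 1.
have P0 : 0 < P by rewrite ltr_wpDl // mulr_ge0.
have D0 : 0 < 2 * (`|d| + 1) by rewrite mulr_gt0 // ltr_wpDl.
have e1 : 0 < e / (2 * (`|d| + 1)) by rewrite divr_gt0.
have KP0 : 0 < 2 * (K * P ^+ 2 + 1).
  by rewrite mulr_gt0 // ltr_wpDl // mulr_ge0 // exprn_ge0 // ltW.
have h3 : \forall y \near x, `|y - x| < Num.min (rho / P) (e / (2 * (K * P ^+ 2 + 1))).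
  apply/nbhs_rvP; exists (Num.min (rho / P) (e / (2 * (K * P ^+ 2 + 1)))) => //.
  by rewrite lt_min !divr_gt0.
apply: filterS3 (diff_expansion dp e1) (diff_lipschitz dp) h3 => y h1 h2.
rewrite lt_min => /andP[y1 y2]; rewrite -/P in h2.
rewrite ltr_pdivlMr // in y1; rewrite ltr_pdivlMr // in y2.
have hs : `|phi y - phi x| <= rho by apply: le_trans h2 _; rewrite mulrC ltW.
have h4 := ht _ hs.
have h5 : (phi y - phi x) ^+ 2 <= (P * `|y - x|) ^+ 2.
  by rewrite -[leLHS]real_normK ?num_real // ler_pXn2r // nnegrE // mulr_ge0 // ltW.
have h6 : K * (phi y - phi x) ^+ 2 <= e / 2 * `|y - x|.
  have a1 := ler_wpM2l K0 h5; apply: le_trans a1 _.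
  have a2 : `|y - x| * (`|y - x| * (2 * (K * P ^+ 2 + 1))) <= `|y - x| * e.
    by rewrite ler_wpM2l // ltW.
  have := sqr_ge0 `|y - x|; lra.
have h7 : `|d * (phi y - phi x - dot (grad phi x) (y - x))| <= e / 2 * `|y - x|.
  rewrite normrM.
  have a1 : `|d| * `|phi y - phi x - dot (grad phi x) (y - x)| <= (`|d| + 1) * (e / (2 * (`|d| + 1)) * `|y - x|).
    by apply: ler_pM => //; rewrite lerDl.
  apply: le_trans a1 _; rewrite le_eqVlt; apply/orP; left; apply/eqP; field.
  by rewrite gt_eqF // ltr_wpDl.
have := ler_normD (theta (phi y) - theta (phi x) - d * (phi y - phi x))
  (d * (phi y - phi x - dot (grad phi x) (y - x))).
rewrite dotZl (_ : _ + d * _ = theta (phi y) - theta (phi x) - d * dot (grad phi x) (y - x)); last by ring.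
lra.
Qed.

Lemma C1_onD O phi psi : open O -> C1_on O phi -> C1_on O psi ->
  C1_on O (fun y => phi y + psi y) /\
  forall x, O x -> grad (fun y => phi y + psi y) x = grad phi x + grad psi x.
Proof.
move=> oO c1 c2.
have h x : O x -> grad (fun y => phi y + psi y) x = grad phi x + grad psi x.
  by move=> Ox; have [] := gradD (c1 x Ox).1 (c2 x Ox).1.
split; last exact: h.
move=> x Ox; split; first by have [] := gradD (c1 x Ox).1 (c2 x Ox).1.
have ct : {for x, continuous (fun y => grad phi y + grad psi y)}.
  have cg1 : grad phi y @[y --> x] --> grad phi x := (c1 x Ox).2.
  have cg2 : grad psi y @[y --> x] --> grad psi x := (c2 x Ox).2.
  exact: (cvgD cg1 cg2).
apply: (continuous_near_eq ct).
have : nbhs x O by apply: open_nbhs_nbhs; split.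
by apply: filterS => y /h.
Qed.

Lemma C1_on_comp O (theta d : R -> R) phi : open O -> C1_on O phi ->
  (forall x, O x -> {for phi x, continuous d}) ->
  (forall x, O x -> exists K rho, [/\ 0 < rho, 0 <= K & forall s, `|s - phi x| <= rho ->
    `|theta s - theta (phi x) - d (phi x) * (s - phi x)| <= K * (s - phi x) ^+ 2]) ->
  C1_on O (fun y => theta (phi y)) /\
  forall x, O x -> grad (fun y => theta (phi y)) x = d (phi x) *: grad phi x.
Proof.
move=> oO c1 cd ht.
have dg x : O x -> differentiable (fun y => theta (phi y)) x /\
    grad (fun y => theta (phi y)) x = d (phi x) *: grad phi x.
  move=> Ox; have [K [rho [rho0 K0 h]]] := ht x Ox.
  exact: (grad_comp (c1 x Ox).1 rho0 K0 h).
split=> [x Ox|x Ox]; last by have [] := dg x Ox.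
split; first exact: (dg x Ox).1.
have ct : {for x, continuous (fun y => d (phi y) *: grad phi y)}.
  have cphi : {for x, continuous phi} by exact/differentiable_continuous/(c1 x Ox).1.
  have cdp : d (phi y) @[y --> x] --> d (phi x) by exact: (cvg_comp _ _ cphi (cd x Ox)).
  have cg : grad phi y @[y --> x] --> grad phi x := (c1 x Ox).2.
  exact: (cvgZ cdp cg).
apply: (continuous_near_eq ct).
have : nbhs x O by apply: open_nbhs_nbhs; split.
by apply: filterS => y /dg [].
Qed.

(** Taking [c = phi x] leaves the gradient at [x] equal to [a *: grad phi x], while the square
    absorbs second order errors of the exponential. *)
Lemma C1_on_quad O phi (a b c : R) : open O -> C1_on O phi ->
  C1_on O (fun y => a * phi y + b * (phi y - c) ^+ 2) /\
  forall x, O x -> grad (fun y => a * phi y + b * (phi y - c) ^+ 2) x =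
    (a + 2 * b * (phi x - c)) *: grad phi x.
Proof.
move=> oO c1.
apply: (@C1_on_comp O (fun s => a * s + b * (s - c) ^+ 2) (fun s => a + 2 * b * (s - c)) phi oO c1).
  move=> x Ox; apply: cvgD; first exact: cvg_cst.
  apply: cvgM; first exact: cvg_cst.
  by apply: cvgB; [exact: cvg_id | exact: cvg_cst].
move=> x Ox; exists `|b|, 1; split => // s _.
rewrite (_ : _ - _ - _ = b * (s - phi x) ^+ 2); last by ring.
by rewrite normrM ler_wpM2l // ger0_norm ?sqr_ge0.
Qed.

Lemma C1_on_scale O phi (a : R) : open O -> C1_on O phi ->
  C1_on O (fun y => a * phi y) /\
  forall x, O x -> grad (fun y => a * phi y) x = a *: grad phi x.
Proof.
move=> oO c1; have [h1 h2] := C1_on_quad a 0 0 oO c1.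
have e : (fun y => a * phi y + 0 * (phi y - 0) ^+ 2) = (fun y => a * phi y).
  by apply/funext => y; rewrite mul0r addr0.
rewrite e in h1 h2; split => // x Ox; rewrite h2 //; congr (_ *: _); ring.
Qed.

Lemma C1_on_sqdist O (z : 'rV[R]_n) : C1_on O (fun y => dot (y - z) (y - z)) /\
  forall x, grad (fun y => dot (y - z) (y - z)) x = 2 *: (x - z).
Proof.
have h x := (sqdist_diff z x).2.
split => // x Ox; split; first exact: (sqdist_diff z x).1.
have -> : grad (fun y => dot (y - z) (y - z)) = fun x => 2 *: (x - z) by apply/funext.
have c1 : {for x, continuous (fun y : 'rV[R]_n => y - z)}.
  by apply: continuousB; [exact: cvg_id | exact: cst_continuous].
have c0 : {for x, continuous (fun _ : 'rV[R]_n => 2 : R)} by exact: cst_continuous.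
have c2 : (y - z) @[y --> x] --> x - z := c1.
exact: (cvgZ c0 c2).
Qed.

Lemma near_pair (P : set ('rV[R]_n * 'rV[R]_n)) x y (q : R) : 0 < q ->
  (forall u v, `|u - x| < q -> `|v - y| < q -> P (u, v)) -> nbhs (x, y) P.
Proof.
move=> q0 h; exists ([set u : 'rV[R]_n | `|u - x| < q], [set u : 'rV[R]_n | `|u - y| < q]).
  by split; apply/nbhs_rvP; exists q.
by move=> [u v] [/= ux vy]; exact: h.
Qed.

(** The superlevel sets of [Phi] generate a proper filter on [K]; upper semicontinuity makes any of
    its cluster points a maximum. *)
Lemma usc_max (X : topologicalType) (K : set X) (Phi : X -> R) : compact K -> K !=set0 ->
  (forall x : X, K x -> forall e : R, 0 < e -> \forall y \near x, K y -> Phi y < Phi x + e) ->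
  exists2 x : X, K x & forall y : X, K y -> Phi y <= Phi x.
Proof.
move=> cK [x0 Kx0] usc.
pose F := filter_from K (fun z => [set y | K y /\ Phi z <= Phi y]).
have FF : ProperFilter F.
  apply: filter_from_proper; last by move=> z Kz; exists z.
  apply: filter_from_filter; first by exists x0.
  move=> z1 z2 K1 K2; have [h|/ltW h] := leP (Phi z1) (Phi z2).
    by exists z2 => // y [Ky hy]; split; split => //; exact: le_trans hy.
  by exists z1 => // y [Ky hy]; split; split => //; exact: le_trans hy.
have [|x [Kx cx]] := cK F FF; first by exists x0 => // y [].
exists x => // z Kz; rewrite leNgt; apply/negP => xz.
have Fz : F [set y | K y /\ Phi z <= Phi y] by exists z.
have e0 : 0 < Phi z - Phi x by rewrite subr_gt0.
have [y [[Ky zy] /(_ Ky)]] := cx _ _ Fz (usc x Kx _ e0); lra.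
Qed.

End C1Calculus.

Section BoundaryLayer.
Context {R : realType} {n : nat} {T : set 'rV[R]_n}.
Implicit Types (x y : 'rV[R]_n).

(** [b] is the first point of the segment from [x] to [y] that lies in the target. *)
Lemma segment_bdry x y : closed T -> ~ T x -> T y ->
  exists2 b, bdry T b & `|x - b| <= `|x - y|.
Proof.
move=> cT Tx Ty.
pose S := [set s : R | 0 <= s <= 1 /\ T (x + s *: (y - x))].
have S1 : S 1 by rewrite /S /= ler01 lexx scale1r addrC subrK.
have hS : has_inf S by split; [exists 1 | exists 0 => s [/andP[]]].
have S0 : 0 <= inf S by apply: lb_le_inf; [exists 1 | move=> s [/andP[]]].
have Sle1 : inf S <= 1 by apply: ge_inf => //; exact: hS.2.
pose b := x + inf S *: (y - x).
have cs : continuous (fun s : R => x + s *: (y - x)).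
  move=> s; apply: cvgD; first exact: cvg_cst.
  by apply: cvgZl; exact: cvg_id.
have Tb : T b.
  apply: contrapT => nTb.
  have : nbhs (inf S) ((fun s : R => x + s *: (y - x)) @^-1` (~` T)).
    by apply: cs; apply: open_nbhs_nbhs; split => //; exact: closed_openC.
  move=> /nbhs_ballP [e /= e0 he].
  have [s [s01 Ts] se] := inf_adherent e0 hS.
  apply: (he s) => //; rewrite /ball /= ltr_norml.
  have : inf S <= s by apply: ge_inf => //; exact: hS.2.
  move=> h; apply/andP; split; lra.
exists b; last first.
  rewrite /b opprD addrA subrr add0r normrN normrZ (ger0_norm S0) -[leRHS]mul1r distrC.
  by rewrite [`|x - y|]distrC ler_wpM2r.
split; first exact: subset_closure.
rewrite /interior => nT.
have Si : 0 < inf S.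
  rewrite lt_neqAle S0 andbT; apply/eqP => h; apply: Tx; move: Tb; rewrite /b -h scale0r addr0 //.
have : nbhs (inf S) ((fun s : R => x + s *: (y - x)) @^-1` T) by apply: cs.
move=> /nbhs_ballP [e /= e0 he].
pose s := inf S - Num.min (inf S) (e / 2).
have m0 : 0 < Num.min (inf S) (e / 2) by rewrite lt_min Si divr_gt0.
have m1 : Num.min (inf S) (e / 2) <= inf S by rewrite ge_min lexx.
have m2 : Num.min (inf S) (e / 2) <= e / 2 by rewrite ge_min lexx orbT.
have : S s.
  split; first by rewrite /s; apply/andP; split; lra.
  by apply: he; rewrite /ball /= /s opprB addrC subrK ger0_norm; lra.
have : forall z, S z -> inf S <= z by move=> z Sz; apply: ge_inf => //; exact: hS.2.
by move=> h /h; rewrite /s; lra.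
Qed.

End BoundaryLayer.

(** * Comparison principle *)

Section Comparison.
Context {R : realType} {n m : nat} {f : 'rV[R]_n -> 'rV[R]_m -> 'rV[R]_n}
  {l : 'rV[R]_n -> 'rV[R]_m -> R} {A : set 'rV[R]_m} {T : set 'rV[R]_n}.
Context (sa : standing_assumptions f l A T).
Implicit Types (x y p : 'rV[R]_n) (phi : 'rV[R]_n -> R).

(** Semicontinuity at each boundary point and compactness of the boundary give a layer of uniform
    width; [segment_bdry] replaces an almost nearest point of the target by a boundary point. *)
Lemma usc_small_near_bdry (w : 'rV[R]_n -> R) (s : R) : 0 < s ->
  (forall x, outside T x -> forall e, 0 < e -> \forall y \near x, outside T y -> w y < w x + e) ->
  (forall x, bdry T x -> w x <= 0) ->
  exists2 eta : R, 0 < eta & forall x, outside T x -> dist_to T x < eta -> w x < s.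
Proof.
move=> s0 usc wb; have [_ [[_ cT cb] _]] := sa.
have [| |e e0 he] := compact_uniform (P := fun b e => forall x, outside T x -> `|x - b| < e -> w x < s) cb.
- by move=> x e e' _ ee h y oy yx; apply: h => //; exact: lt_le_trans ee.
- move=> b bb; have ob : outside T b by case: bb.
  have s2 : 0 < s / 2 by rewrite divr_gt0.
  have [d d0 hd] := (nbhs_rvP _ _).1 (usc b ob _ s2).
  exists (d / 2); first by rewrite divr_gt0.
  exists (d / 2); first by rewrite divr_gt0.
  move=> c cc cb' x ox xc.
  have : `|x - b| < d.
    have := ler_normD (x - c) (c - b); rewrite addrA subrK; lra.
  by move=> /hd /(_ ox); have := wb b bb; lra.
exists e => // x ox xe; have [Tx|Tx] := pselect (T x).
  by apply: (le_lt_trans _ s0); apply: wb; split => //; exact: subset_closure.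
have [y Ty xy] := dist_to_lt sa xe.
have [b bb xb] := segment_bdry cT Tx Ty.
apply: (he b bb x ox); apply: le_lt_trans xb _; apply: le_lt_trans xy; exact: norm_le_enorm.
Qed.

(* The last clause makes [w1 - e * g] a strict subsolution, up to [s * l], at
   distance at least [eta] from the target. *)
Definition penalty (g : 'rV[R]_n -> R) : Prop :=
  [/\ C1_on (~` T) g, {within outside T, continuous g}, forall x, outside T x -> 0 <= g x,
     forall c, exists r : R, forall x, outside T x -> g x <= c -> `|x| <= r &
     forall eta s : R, 0 < eta -> 0 < s -> exists2 e0 : R, 0 < e0 & forall e, 0 < e < e0 ->
       exists2 k : R, 0 < k & forall x a, ~ T x -> eta <= dist_to T x -> A a ->
         k <= - e * dot (grad g x) (f x a) + s * l x a].

(** At a maximum of the doubled function the values differ by at least [2 * s], so the zero order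
    terms differ by at least [2 * s * l]. One [s * l] is spent on the last clause of [penalty], and
    its constant [k] then beats the errors of the doubling. *)
Lemma comparison (g w1 w2 : 'rV[R]_n -> R) : penalty g ->
  (forall x, outside T x -> forall e, 0 < e -> \forall y \near x, outside T y -> w1 y < w1 x + e) ->
  (forall x, outside T x -> forall e, 0 < e -> \forall y \near x, outside T y -> w2 x - e < w2 y) ->
  (forall x, outside T x -> w1 x <= 1) -> (forall x, outside T x -> 0 <= w2 x) ->
  (forall x, bdry T x -> w1 x <= 0) ->
  (forall phi, C1_on (~` T) phi -> forall x, ~ T x ->
     (\forall y \near x, w1 y - phi y <= w1 x - phi x) ->
     forall a, A a -> - dot (grad phi x) (f x a) - l x a * (1 - w1 x) <= 0) ->
  (forall phi, C1_on (~` T) phi -> forall x, ~ T x -> w2 x < 1 ->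
     (\forall y \near x, w2 x - phi x <= w2 y - phi y) ->
     forall d, 0 < d -> exists2 a, A a & - d < - dot (grad phi x) (f x a) - l x a * (1 - w2 x)) ->
  forall x, outside T x -> w1 x <= w2 x.
Proof.
move=> [gC1 gc g0 gco gk] usc lsc w1le w2ge w1b sub sup x0 ox0.
have [_ [[_ cT _] _]] := sa.
have oT : open (~` T) by exact: closed_openC.
rewrite leNgt; apply/negP => lt0.
pose s := (w1 x0 - w2 x0) / 3.
have s0 : 0 < s by rewrite divr_gt0 // subr_gt0.
have s20 : 0 < 2 * s by rewrite mulr_gt0.
have [eta eta0 heta] := usc_small_near_bdry s20 usc w1b.
have [e0 e00 he0] := gk eta s eta0 s0.
(* [e * g x0 <= s] keeps a gap [2 * s] at [x0] after penalization. *)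
pose e := Num.min (e0 / 2) (s / (g x0 + 1)).
have gx01 : 0 < g x0 + 1 by rewrite ltr_wpDl // g0.
have e_gt0 : 0 < e by rewrite lt_min; apply/andP; split; apply: divr_gt0.
have eg : e * g x0 <= s.
  have : e <= s / (g x0 + 1) by rewrite ge_min lexx orbT.
  rewrite ler_pdivlMr //; have := ltW e_gt0; lra.
have [k k0 hk] : exists2 k : R, 0 < k & forall x a, ~ T x -> eta <= dist_to T x -> A a ->
         k <= - e * dot (grad g x) (f x a) + s * l x a.
  apply: he0; rewrite e_gt0 /=; apply: (@le_lt_trans _ _ (e0 / 2)); first by rewrite ge_min lexx.
  by lra.
have [r hr] := gco e^-1.
(* Off [K] the function [Phi] is at most 0. Either [e * g x > 1], or [x] is within radius [|r|] and
   [y] beyond [|r| + 1], and then the doubling term is at least 1; hence the margin 1. *)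
pose K := [set x | outside T x /\ `|x| <= `|r| + 1].
have coT : closed (outside T) by apply: open_closedC; exact: open_interior.
have cK : compact K.
  apply: (subclosed_compact _ (@compact_closed_ball R n 0 (`|r| + 1))).
    apply: closedI => //; rewrite (_ : (fun _ => _) = (fun y => `|y|) @^-1` [set t : R | t <= `|r| + 1]) //.
    by apply: closed_comp; [move=> y _; exact: norm_continuous | exact: closed_le].
  by move=> x [_ xr]; rewrite /= subr0.
pose Phi (j : nat) (z : 'rV[R]_n * 'rV[R]_n) :=
  w1 z.1 - w2 z.2 - e * g z.1 - j.+1%:R * dot (z.1 - z.2) (z.1 - z.2).
have Kx0 : K x0.
  split => //; apply: le_trans (_ : `|r| <= _); last by rewrite lerDl.
  apply: le_trans (hr x0 ox0 _) (ler_norm _).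
  rewrite -[leRHS]mul1r ler_pdivlMr // mulrC; apply: le_trans eg _.
  rewrite /s ler_pdivrMr //; have := w1le x0 ox0; have := w2ge x0 ox0; lra.
have Phi0 j : 2 * s <= Phi j (x0, x0).
  rewrite /Phi /= subrr dot0l mulr0 subr0; have : w1 x0 - w2 x0 = 3 * s by rewrite /s; field.
  lra.
have gusc x : outside T x -> forall d, 0 < d -> \forall y \near x, outside T y -> `|g x - g y| < d.
  move=> ox d d0; have /subspace_continuousP /(_ x ox) /cvgrPdist_lt /(_ d d0) := gc.
  by rewrite near_withinE.
have maxj j : exists z, [/\ outside T z.1, outside T z.2, `|z.1| <= `|r| + 1, `|z.2| <= `|r| + 1 &
    forall x y, outside T x -> outside T y -> Phi j (x, y) <= Phi j z].
  have [| |[x1 y1] [[ox1 x1r] [oy1 y1r]] hmax] := @usc_max R ('rV[R]_n * 'rV[R]_n)%type (K `*` K) (Phi j) (compact_setX cK cK).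
  - by exists (x0, x0).
  - move=> [x y] [/= [ox xr] [oy yr]] d d0.
    have d4 : 0 < d / 4 by rewrite divr_gt0.
    have d4e : 0 < d / (4 * e) by rewrite divr_gt0 // mulr_gt0.
    have dj : 0 < d / (4 * j.+1%:R) by rewrite divr_gt0 // mulr_gt0.
    have c2 : {for x - y, continuous (fun v : 'rV[R]_n => dot (v - 0) (v - 0))}.
      exact: differentiable_continuous (sqdist_diff 0 (x - y)).1.
    move: c2 => /cvgrPdist_lt /(_ _ dj) /nbhs_rvP [q q0 hq].
    have [q1 q10 h1] := (nbhs_rvP _ _).1 (usc x ox _ d4).
    have [q2 q20 h2] := (nbhs_rvP _ _).1 (lsc y oy _ d4).
    have [q3 q30 h3] := (nbhs_rvP _ _).1 (gusc x ox _ d4e).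
    pose q' := Num.min (Num.min (q / 2) q1) (Num.min q2 q3).
    apply: (@near_pair R n _ x y q'); first by rewrite !lt_min q10 q20 q30 divr_gt0.
    move=> u v; rewrite !lt_min => /andP[/andP[u0 /h1 u1] /andP[_ /h3 u3]].
    move=> /andP[/andP[v0 _] /andP[/h2 v2 _]] [[/= ou _] [/= ov _]].
    have a1 := u1 ou; have a2 := v2 ov; have a3 := u3 ou.
    have a4 : `|dot (x - y) (x - y) - dot (u - v) (u - v)| < d / (4 * j.+1%:R).
      have := hq (u - v); rewrite !subr0; apply.
      have -> : u - v - (x - y) = (u - x) - (v - y).
        by rewrite !opprB addrACA [RHS]addrACA [- v + _]addrC.
      have := ler_normB (u - x) (v - y); clear -u0 v0; lra.
    have j0 : 0 < j.+1%:R :> R by rewrite ltr0n.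
    rewrite ltr_pdivlMr ?mulr_gt0 // in a3; rewrite ltr_pdivlMr ?mulr_gt0 // in a4.
    have b3 : e * (g x - g u) <= e * `|g x - g u| by rewrite ler_wpM2l ?(ltW e_gt0) // ler_norm.
    have b4 : j.+1%:R * (dot (x - y) (x - y) - dot (u - v) (u - v)) <= j.+1%:R * `|dot (x - y) (x - y) - dot (u - v) (u - v)|.
      by rewrite ler_wpM2l ?(ltW j0) // ler_norm.
    rewrite /Phi /=; move: b4 a4; move: (j.+1%:R : R) (dot _ _) (dot _ _) => jj D1 D2; clear -a1 a2 a3 b3; lra.
  exists (x1, y1); split => // x y ox oy.
  have [[xK yK]|nK] := pselect (K x /\ K y); first exact: hmax.
  apply: le_trans (_ : 0 <= _); last by apply: (le_trans _ (hmax (x0, x0) _)) => //; apply: le_trans (Phi0 j); exact: ltW.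
  have w1x := w1le x ox; have w2y := w2ge y oy.
  have eg0 : 0 <= e * g x by rewrite mulr_ge0 ?(ltW e_gt0) // g0.
  have D0 : 0 <= j.+1%:R * dot (x - y) (x - y) by rewrite mulr_ge0 // dot_ge0.
  rewrite /Phi /=; have [gx|gx] := leP (g x) e^-1; last first.
    have : 1 < e * g x by rewrite mulrC -ltr_pdivrMr // mul1r.
    lra.
  have xr := le_trans (hr x ox gx) (ler_norm r).
  have yr : `|r| + 1 < `|y|.
    rewrite ltNge; apply/negP => yr; apply: nK; split; split => //.
    by apply: le_trans xr _; rewrite lerDl.
  have xy1 : 1 <= `|x - y|.
    have := ler_normB x (x - y); rewrite opprB addrC subrK; lra.
  have : 1 <= dot (x - y) (x - y).
    by apply: le_trans (sqr_norm_le_dot _); rewrite expr_ge1.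
  have : dot (x - y) (x - y) <= j.+1%:R * dot (x - y) (x - y).
    by rewrite ler_peMl ?dot_ge0 // ler1n.
  lra.
have [z hz] := choice maxj.
have Pz j : 2 * s <= Phi j (z j).
  by have [_ _ _ _ h] := hz j; apply: le_trans (Phi0 j) (h _ _ _ _).
have eg0 x : outside T x -> 0 <= e * g x by move=> ox; rewrite mulr_ge0 ?(ltW e_gt0) // g0.
have close j : j.+1%:R * dot ((z j).1 - (z j).2) ((z j).1 - (z j).2) <= 1.
  have [ o1 o2 _ _ _] := hz j; have := Pz j; rewrite /Phi.
  have := w1le _ o1; have := w2ge _ o2; have := eg0 _ o1; lra.
have zK j : K (z j).1 by have [ o1 _ h _ _] := hz j.
have [xb [oxb xbr] hxb] := compact_cluster_seq cK zK.
pose L0 := fl_lipschitz sa (`|r| + 1).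
have [L L0' hL] := L0; pose N1 := n%:R * L + 1.
have N10 : 0 < N1 by rewrite ltr_wpDl // mulr_ge0 // ltW.
(* [s / 6] will exclude boundary points as limits of the maxima; [k / (32 * N1)] makes the Lipschitz
   term, at most [6 n L d], smaller than [k / 4]. *)
pose d := Num.min (s / 6) (k / (32 * N1)).
have d0 : 0 < d by rewrite lt_min; apply/andP; split; apply: divr_gt0 => //; exact: mulr_gt0.
have d3 : 0 < d / e by rewrite divr_gt0.
have [r1 r10 h1] := (nbhs_rvP _ _).1 (usc xb oxb d d0).
have [r2 r20 h2] := (nbhs_rvP _ _).1 (lsc xb oxb d d0).
have [r3 r30 h3] := (nbhs_rvP _ _).1 (gusc xb oxb (d / e) d3).
pose rho := Num.min (Num.min r1 r2) (Num.min r3 (k / (4 * L))).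
have rho0 : 0 < rho by rewrite !lt_min r10 r20 r30 divr_gt0 // mulr_gt0.
(* The crude bound 1 on the doubling term brings the two points together. Semicontinuity at their
   common limit [xb], against the value of [Phi] at [(xb, xb)], then improves that bound to
   [3 * d]. *)
have pick (q : R) : 0 < q -> q <= rho -> exists j, [/\ `|(z j).1 - xb| < q, `|(z j).2 - xb| < q, `|(z j).1 - (z j).2| < q &
    j.+1%:R * dot ((z j).1 - (z j).2) ((z j).1 - (z j).2) <= 3 * d /\ 2 * s - 3 * d <= w1 xb - w2 xb - e * g xb].
  move=> q0 qr; have q2 : 0 < q / 2 by rewrite divr_gt0.
  have [j Nj xj] := hxb (q / 2) (Num.truncn ((q / 2) ^- 2)) q2.
  have zz : `|(z j).1 - (z j).2| < q / 2.
    rewrite -(ltr_pXn2r (_ : 0 < 2)%N) ?nnegrE ?(ltW q2) //.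
    apply: le_lt_trans (sqr_norm_le_dot _) _.
    have j0 : 0 < j.+1%:R :> R by rewrite ltr0n.
    apply: (@le_lt_trans _ _ j.+1%:R^-1); first by rewrite -[leRHS]mul1r ler_pdivlMr // mulrC close.
    rewrite invf_plt ?posrE ?exprn_gt0 //; apply: lt_le_trans (truncnS_gt _) _.
    by rewrite ler_nat.
  have zx2 : `|(z j).2 - xb| < q.
    have := ler_normD ((z j).2 - (z j).1) ((z j).1 - xb); rewrite addrA subrK [`|(z j).2 - (z j).1|]distrC; clear -xj zz; lra.
  have zx1 : `|(z j).1 - xb| < q by clear -xj q0; lra.
  have [ o1 o2 _ _ hm] := hz j.
  have rr : [/\ q <= r1, q <= r2 & q <= r3].
    by move: qr; rewrite /rho !le_min => /andP[/andP[-> ->] /andP[-> _]].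
  have [qr1 qr2 qr3] := rr.
  have a1 := h1 _ (lt_le_trans zx1 qr1) o1.
  have a2 := h2 _ (lt_le_trans zx2 qr2) o2.
  have a3 := h3 _ (lt_le_trans zx1 qr3) o1; rewrite ltr_pdivlMr // in a3.
  have b3 : e * (g xb - g (z j).1) <= e * `|g xb - g (z j).1| by rewrite ler_wpM2l ?(ltW e_gt0) // ler_norm.
  have hd := hm xb xb oxb oxb; have hP := Pz j.
  rewrite /Phi /= subrr dot0l mulr0 subr0 in hd hP.
  have D0 : 0 <= j.+1%:R * dot ((z j).1 - (z j).2) ((z j).1 - (z j).2) by rewrite mulr_ge0 // dot_ge0.
  exists j; split => //; first by clear -zz q0; lra.
  by split; clear -hd hP D0 a1 a2 a3 b3; lra.
have d6 : d <= s / 6 by rewrite ge_min lexx.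
have Txb : ~ T xb.
  have [j [_ _ _ [_ h]]] := pick rho rho0 (lexx _).
  move=> Txb; have bxb : bdry T xb by split => //; exact: subset_closure.
  have := w1b xb bxb; have := w2ge xb oxb; have := eg0 xb oxb; clear -h s0 d6; lra.
have [rT rT0 hT] : exists2 rT : R, 0 < rT & forall y, `|y - xb| < rT -> ~ T y.
  by apply/(nbhs_rvP _ (~` T)); apply: open_nbhs_nbhs; split.
have q0 : 0 < Num.min rho rT by rewrite lt_min; apply/andP; split.
have qr : Num.min rho rT <= rho by rewrite ge_min lexx.
have qT : Num.min rho rT <= rT by rewrite ge_min lexx orbT.
have [j [zx1' zx2' zz' [zd _]]] := pick _ q0 qr.
have zx1 := lt_le_trans zx1' qT; have zx2 := lt_le_trans zx2' qT; have zz := lt_le_trans zz' qr.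
have T1 := hT _ zx1; have T2 := hT _ zx2.
have [ o1 o2 b1 b2 hm] := hz j; have hP := Pz j.
set x := (z j).1 in zd zz T1 o1 b1 *; set y := (z j).2 in zd zz T2 o2 b2 *.
have jr0 : 0 < j.+1%:R :> R by rewrite ltr0n.
set J := (j.+1%:R : R) in zd jr0 *.
have ezj : z j = (x, y) by rewrite /x /y; case: (z j).
rewrite ezj /Phi -/J /= in hm hP.
have Dxy : 0 <= J * dot (x - y) (x - y) by rewrite mulr_ge0 ?(ltW jr0) // dot_ge0.
have egx := eg0 x o1; have w2y := w2ge y o2; have w1x := w1le x o1.
have dx : eta <= dist_to T x.
  by rewrite leNgt; apply/negP => /(heta x o1); clear -hP Dxy egx w2y; lra.
have [c1 gr1] := C1_on_scale e oT gC1.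
have [c2 gr2] := C1_on_sqdist (~` T) y.
have [c3 gr3] := C1_on_scale J oT c2.
have [c4 gr4] := C1_onD oT c1 c3.
have [c5 gr5] := C1_on_sqdist (~` T) x.
have [c6 gr6] := C1_on_scale (- J) oT c5.
have near_out v : ~ T v -> \forall u \near v, outside T u.
  move=> Tv; have : nbhs v (~` T) by apply: open_nbhs_nbhs; split.
  by apply: filterS => u; exact: outside_notin.
have hsub : forall a, A a -> - dot (e *: grad g x + J *: (2 *: (x - y))) (f x a) - l x a * (1 - w1 x) <= 0.
  have := sub _ c4 x T1; rewrite gr4 // gr1 // gr3 // gr2; apply.
  apply: filterS (near_out _ T1) => u ou; have := hm u y ou o2; rewrite /=; clear; lra.
have k4 : 0 < k / 4 by rewrite divr_gt0.
(* The gap and [w1 <= 1] place [y] where the supersolution may be tested. *)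
have w2lt : w2 y < 1 by clear -hP Dxy egx w1x s0; lra.
have [a Aa hsup] : exists2 a, A a & - (k / 4) < - dot (J *: (2 *: (x - y))) (f y a) - l y a * (1 - w2 y).
  have := sup _ c6 y T2 w2lt; rewrite gr6 // gr5.
  have -> : - J *: (2 *: (y - x)) = J *: (2 *: (x - y)).
    by apply/rowP => i; rewrite !mxE; ring.
  move=> h; apply: h k4; apply: filterS (near_out _ T2) => u ou.
  have := hm x u o1 ou; rewrite /=.
  have sym (v w : 'rV[R]_n) : dot (v - w) (v - w) = dot (w - v) (w - v) by rewrite -[v - w]opprB dotNl dotNr opprK.
  rewrite (sym u x) (sym y x); clear; lra.
(* Combining both tests with the penalty gives [3 k / 4] strictly below two errors of size [k / 4]
   minus [s * l]. *)
have hs := hsub a Aa; have hkk := hk x a T1 dx Aa.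
have [hf hl] := hL x y a b1 b2 Aa.
rewrite dotDl !dotZl in hs; rewrite !dotZl in hsup.
have F1 : J * (2 * dot (x - y) (f x a - f y a)) <= k / 4.
  have q1 : dot (x - y) (f x a - f y a) <= n%:R * L * dot (x - y) (x - y).
    apply: le_trans (ler_norm _) _; apply: le_trans (le_norm_dot _ _) _.
    rewrite -mulrA ler_wpM2l //; apply: (@le_trans _ _ (`|x - y| * (L * `|x - y|))).
      by rewrite ler_wpM2l.
    rewrite mulrCA -expr2 ler_wpM2l ?(ltW L0') //; exact: sqr_norm_le_dot.
  have q2 : J * (2 * dot (x - y) (f x a - f y a)) <= J * (2 * (n%:R * L * dot (x - y) (x - y))).
    by rewrite ler_wpM2l ?(ltW jr0) // ler_wpM2l.
  have q3 : n%:R * L * (J * dot (x - y) (x - y)) <= n%:R * L * (3 * d).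
    by rewrite ler_wpM2l // mulr_ge0 // ltW.
  have q4 : d * (32 * N1) <= k.
    by rewrite -ler_pdivlMr ?mulr_gt0 // ge_min lexx orbT.
  have := ltW d0; have : 0 <= n%:R * L * d by rewrite !mulr_ge0 // ltW.
  rewrite /N1 in q4; clear -q2 q3 q4; lra.
have F2 : (l y a - l x a) * (1 - w2 y) >= - (k / 4).
  have q1 : `|(l y a - l x a) * (1 - w2 y)| <= k / 4.
    rewrite normrM distrC -[leRHS]mulr1; apply: ler_pM => //.
      apply: le_trans hl _; have : `|x - y| <= k / (4 * L).
        by move: zz; rewrite /rho !lt_min => /andP[_ /andP[_ /ltW]].
      by rewrite ler_pdivlMr ?mulr_gt0 //; clear; lra.
    by rewrite ger0_norm; clear -w2y w2lt; lra.
  by have := ler_norm (- ((l y a - l x a) * (1 - w2 y))); rewrite normrN; clear -q1; lra.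
have F3 : l x a * (2 * s) <= l x a * (w1 x - w2 y).
  by rewrite ler_wpM2l ?(l_ge0 sa) //; clear -hP Dxy egx; lra.
have F4 : 0 <= l x a * s by rewrite mulr_ge0 ?(l_ge0 sa) // ltW.
rewrite dotBr in F1; clear -F1 F2 F3 F4 hs hsup hkk k0; lra.
Qed.

End Comparison.

(** * Penalties built from (SC1) and (SC2) *)

Section Penalties.
Context {R : realType} {n m : nat} {f : 'rV[R]_n -> 'rV[R]_m -> 'rV[R]_n}
  {l : 'rV[R]_n -> 'rV[R]_m -> R} {A : set 'rV[R]_m} {T : set 'rV[R]_n}.
Context (sa : standing_assumptions f l A T).
Implicit Types (x y p : 'rV[R]_n).

Lemma comparison_function_le (c : R -> R) (r s : R) : comparison_function c ->
  0 < r -> r <= s -> c r <= c s.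
Proof. by move=> [_ _ ci] r0; rewrite le_eqVlt => /predU1P[->//|/(ci _ _ r0)/ltW]. Qed.

(** Properness of [U] gives coercivity. Its decrease, at least [c eta] at distance [eta] from the
    target, is strict by itself, so any [e] works and the term [s * l] is only used to be
    nonnegative. *)
Lemma penalty_SC1 : SC1 f A T -> exists g, penalty (f := f) (l := l) (A := A) (T := T) g.
Proof.
move=> [U [c [U0 [ O [oO outO c1]] pd pr [cc hs]]]].
have [[cA A0] _] := sa; exists U; split => //.
- by move=> x /(@outside_notin _ _ T) /outO /c1.
- apply: continuous_in_subspaceT => x; rewrite inE => /outO /c1 [d _].
  exact: differentiable_continuous d.
- move=> b; have cK : compact ((setT `\` T°) `&` U @^-1` `[0, `|b|]).
    by apply: pr; [exact: segment_compact | move=> s; rewrite /= in_itv /= => /andP[]].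
  have [M _ hM] := pinfty_ex_gt0 (compact_bounded cK).
  exists M => x ox xb; apply: hM; split => //=; rewrite in_itv /= U0 //=.
  exact: le_trans xb (ler_norm _).
- move=> eta s eta0 s0; exists 1 => // e /andP[e0 _].
  have c0 : 0 < c eta by case: cc => + _ _; apply.
  exists (e * c eta) => [|x a Tx xeta Aa]; first by rewrite mulr_gt0.
  have [b hb] := hamiltonian_bound sa x (- grad U x) 0.
  have gb a' : A a' -> dot (grad U x) (f x a') <= b.
    by move=> /hb; rewrite dotNl opprK mulr0 subr0.
  have := (sup_image_le A0 gb _).1 (hs x Tx) a Aa.
  have := comparison_function_le cc eta0 xeta => h1 h2.
  have : e * c eta <= e * (- dot (grad U x) (f x a)) by rewrite ler_wpM2l ?(ltW e0) //; lra.
  have : 0 <= s * l x a by rewrite mulr_ge0 ?(ltW s0) // (l_ge0 sa).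
  lra.
Qed.

(** After factoring out [1 + a], the upper bound is [ln (1 + u) <= u]; the lower one is the same
    inequality for the inverse of [1 + u]. *)
Lemma ln_quad (a s : R) : 0 <= a -> `|s - a| <= 1 / 2 ->
  `|ln (1 + s) - ln (1 + a) - (1 + a)^-1 * (s - a)| <= 2 * (s - a) ^+ 2.
Proof.
move=> a0; rewrite ler_norml => /andP[h1 h2].
have a1 : 0 < 1 + a by lra.
have s1 : 0 < 1 + s by lra.
pose u := (1 + a)^-1 * (s - a).
have i1 : 0 < (1 + a)^-1 by rewrite invr_gt0.
have i2 : (1 + a)^-1 <= 1 by rewrite invf_le1 // lerDl.
have ua : `|u| <= `|s - a|.
  by rewrite normrM (gtr0_norm i1) ler_piMl.
have u2 : u ^+ 2 <= (s - a) ^+ 2.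
  by rewrite -[leLHS]real_normK ?num_real // -[leRHS]real_normK ?num_real // ler_pXn2r ?nnegrE.
have ul : `|u| <= 1 / 2 by apply: le_trans ua _; rewrite ler_norml; apply/andP; split.
move: ul; rewrite ler_norml => /andP[u3 u4].
have e1 : 1 + s = (1 + a) * (1 + u).
  by rewrite /u; field; rewrite gt_eqF.
have p1 : 0 < 1 + u by lra.
rewrite e1 lnM ?posrE // -/u [ln (1 + a) + _]addrC addrK.
have l1 : ln (1 + u) <= u by apply: le_ln1Dx; lra.
have l2 : u - 2 * u ^+ 2 <= ln (1 + u).
  have q1 : 0 < (1 + u)^-1 by rewrite invr_gt0.
  have : ln (1 + ((1 + u)^-1 - 1)) <= (1 + u)^-1 - 1 by apply: le_ln1Dx; lra.
  rewrite addrC subrK lnV ?posrE // => h.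
  have : (1 + u)^-1 <= 1 - u + 2 * u ^+ 2.
    rewrite -[leLHS]mul1r ler_pdivrMr //.
    have : 0 <= u ^+ 2 * (1 + 2 * u) by rewrite mulr_ge0 ?sqr_ge0 //; lra.
    lra.
  lra.
rewrite ler_norml; apply/andP; split; last by have := sqr_ge0 (s - a); lra.
by lra.
Qed.

(** Here the strictness comes from [s * l >= s * c eta]. The linear growth of [f] bounds the
    derivative of the logarithm along the dynamics by [C], and [e] is taken so small that [e * C]
    spends at most half of it. *)
Lemma penalty_SC2 : SC2 l A T -> exists g, penalty (f := f) (l := l) (A := A) (T := T) g.
Proof.
move=> [c cc hc]; have [_ [[_ cT _] _]] := sa.
pose N (y : 'rV[R]_n) := dot (y - 0) (y - 0).
have N0 y : 0 <= N y by exact: dot_ge0.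
have [c1 gr1] := C1_on_sqdist setT (0 : 'rV[R]_n).
have [c2 gr2] : C1_on setT (fun y => ln (1 + N y)) /\
    forall x, setT x -> grad (fun y => ln (1 + N y)) x = (1 + N x)^-1 *: grad N x.
  apply: (@C1_on_comp R n setT (fun s => ln (1 + s)) (fun s => (1 + s)^-1) N openT c1).
    move=> x _; apply: cvgV; first by rewrite gt_eqF // ltr_pwDl.
    by apply: cvgD; [exact: cvg_cst | exact: cvg_id].
  move=> x _; exists 2, (1 / 2); split => // s; exact: ln_quad.
exists (fun y => ln (1 + N y)); split.
- by move=> x _; exact: c2.
- apply: continuous_in_subspaceT => x _; exact: differentiable_continuous (c2 x I).1.
- by move=> x _; apply: ln_ge0; rewrite lerDl.
- move=> b; exists (expR b) => x _ xb.
  have h : 1 + N x <= expR b by rewrite -[1 + N x]lnK ?posrE ?ltr_pwDl // ler_expR.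
  have := sqr_norm_le_dot x; have : N x = dot x x by rewrite /N subr0.
  have : 2 * `|x| <= 1 + `|x| ^+ 2 by have := sqr_ge0 (`|x| - 1); rewrite sqrrB1; lra.
  have := N0 x; lra.
- move=> eta s eta0 s0; have [M M0 hM] := f_growth sa.
  pose C := n%:R * (4 * M); have C0 : 0 <= C by rewrite !mulr_ge0 // ltW.
  have c0 : 0 < c eta by case: cc => + _ _; apply.
  have sc : 0 < s * c eta by rewrite mulr_gt0.
  have C1 : 0 < 2 * (C + 1) by lra.
  exists (s * c eta / (2 * (C + 1))); first by rewrite divr_gt0.
  move=> e /andP[e0]; rewrite ltr_pdivlMr // => e1.
  exists (s * c eta / 2) => [|x a Tx xeta Aa]; first by rewrite divr_gt0.
  have h1 := comparison_function_le cc eta0 xeta; have h2 := hc x a Tx Aa.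
  have h3 : s * c eta <= s * l x a by rewrite ler_wpM2l ?(ltW s0) // (le_trans h1).
  have h4 : `|dot (grad (fun y => ln (1 + N y)) x) (f x a)| <= C.
    have -> : grad (fun y => ln (1 + N y)) x = (1 + N x)^-1 *: (2 *: (x - 0)) by rewrite gr2 // gr1.
    apply: le_trans (le_norm_dot _ _) _; rewrite /C ler_wpM2l //.
    have N1 : 0 < 1 + N x by rewrite ltr_pwDl.
    rewrite !normrZ ger0_norm ?invr_ge0 ?(ltW N1) // ger0_norm // subr0 -mulrA.
    rewrite mulrC ler_pdivrMr //.
    have := hM x a Aa => h5.
    have : `|x| * `|f x a| <= `|x| * (M * (1 + `|x|)) by rewrite ler_wpM2l.
    have n1 := sqr_norm_le_dot x; have n2 : N x = dot x x by rewrite /N subr0.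
    have n3 : `|x| * (1 + `|x|) <= 2 * (1 + N x).
      by have := sqr_ge0 (`|x| - 1); rewrite sqrrB1; lra.
    have : M * (`|x| * (1 + `|x|)) <= M * (2 * (1 + N x)) by rewrite ler_wpM2l // ltW.
    lra.
  have h5 : e * dot (grad (fun y => ln (1 + N y)) x) (f x a) <= e * C.
    by rewrite ler_wpM2l ?(ltW e0) // (le_trans (ler_norm _)).
  lra.
Qed.

End Penalties.

(** * The Kruzkov transform *)

Section Kruzkov.
Context {R : realType}.
Implicit Types (u v : \bar R) (a b : R).

(** The value 1 at [-oo] is a default; the order lemmas below assume nonnegative arguments. *)
Definition kruzkov v : R := if v is r%:E then 1 - expR (- r) else 1.

Lemma kruzkov_le1 v : kruzkov v <= 1.
Proof. by case: v => [r||] //=; rewrite gerBl expR_ge0. Qed.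

Lemma kruzkov_itv v : (0 <= v)%E -> 0 <= kruzkov v <= 1.
Proof.
move=> v0; rewrite kruzkov_le1 andbT; case: v v0 => [r||] //=.
by rewrite lee_fin subr_ge0 expR_le1 oppr_le0.
Qed.

Lemma kruzkov_lt v b : (0 <= v)%E -> (kruzkov v < 1 - expR (- b)) = (v < b%:E)%E.
Proof.
case: v => [r||] //= _; first by rewrite ltrD2l ltrN2 ltr_expR ltrN2 lte_fin.
by rewrite ltNge gerBl expR_ge0.
Qed.

Lemma lt_kruzkov v a : (0 <= v)%E -> (1 - expR (- a) < kruzkov v) = (a%:E < v)%E.
Proof.
case: v => [r||] //= _; first by rewrite ltrD2l ltrN2 ltr_expR ltrN2 lte_fin.
by rewrite gtrBl expR_gt0 ltry.
Qed.

Lemma kruzkov_lt1 v : (0 <= v)%E -> (kruzkov v < 1) = (v < +oo)%E.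
Proof. by case: v => [r||] //= _; rewrite ?ltxx // gtrBl expR_gt0 ltry. Qed.

Lemma le_kruzkov u v : (0 <= u)%E -> (0 <= v)%E -> (kruzkov u <= kruzkov v) = (u <= v)%E.
Proof.
case: u => [r||] // u0; case: v => [s||] // v0 /=.
- by rewrite lerD2l lerN2 ler_expR lerN2 lee_fin.
- by rewrite gerBl expR_ge0 leey.
- by rewrite leye_eq leNgt gtrBl expR_gt0.
- by rewrite leey lexx.
Qed.

Lemma kruzkovK v : (0 <= v)%E -> v = (- lne (1 - kruzkov v)%:E)%E.
Proof.
case: v => [r||] // _; rewrite /kruzkov; last by rewrite subrr le0_lneNy.
by rewrite subKr lne_EFin ?expR_gt0 // expRK EFinN oppeK.
Qed.

Lemma kruzkov_small v (e : R) : (0 <= v)%E -> (v <= e%:E)%E -> kruzkov v <= e.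
Proof.
case: v => [r||] //= _; rewrite lee_fin => h.
by have := expR_ge1Dx (- r); lra.
Qed.

End Kruzkov.

Section KruzkovProblem.
Context {R : realType} {n m : nat} {f : 'rV[R]_n -> 'rV[R]_m -> 'rV[R]_n}
  {l : 'rV[R]_n -> 'rV[R]_m -> R} {A : set 'rV[R]_m} {T : set 'rV[R]_n}.
Context (sa : standing_assumptions f l A T).
Implicit Types (x y p : 'rV[R]_n).
Local Notation K := (kruzkov_hamiltonian f l A).
Local Notation V := (value f l A T).
Local Notation out := (outside T).

Lemma near_outside x : ~ T x -> \forall y \near x, out y.
Proof.
have [_ [[_ cT _] _]] := sa => Tx.
have : nbhs x (~` T) by apply: open_nbhs_nbhs; split => //; exact: closed_openC.
by apply: filterS => y; exact: outside_notin.
Qed.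

Lemma bdry_outside x : bdry T x -> out x.
Proof. by case. Qed.

Lemma fine_usc (v : 'rV[R]_n -> \bar R) x (e : R) : (forall y, out y -> (0 <= v y <= 1)%E) ->
  out x -> 0 < e -> \forall y \near x, out y -> fine (usc_env out v y) < fine (usc_env out v x) + e.
Proof.
move=> v01 ox e0.
have vfin y : out y -> usc_env out v y = (fine (usc_env out v y))%:E.
  move=> oy; have /andP[h1 h2] := usc_env_fin (a := 0) (b := 1) oy v01.
  by rewrite fineK // ge0_fin_numE //; exact: le_lt_trans h2 (ltry _).
have : (usc_env out v x < (fine (usc_env out v x) + e)%:E)%E.
  by rewrite [X in (X < _)%E]vfin // lte_fin ltrDl.
by move=> /usc_env_lt; apply: filterS => y [_ h] oy; rewrite -lte_fin -vfin.
Qed.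

Lemma fine_lsc (v : 'rV[R]_n -> \bar R) x (e : R) : (forall y, out y -> (0 <= v y <= 1)%E) ->
  out x -> 0 < e -> \forall y \near x, out y -> fine (lsc_env out v x) - e < fine (lsc_env out v y).
Proof.
move=> v01 ox e0.
have vfin y : out y -> lsc_env out v y = (fine (lsc_env out v y))%:E.
  move=> oy; have /andP[h1 h2] := lsc_env_fin (a := 0) (b := 1) oy v01.
  by rewrite fineK // ge0_fin_numE //; exact: le_lt_trans h2 (ltry _).
have : ((fine (lsc_env out v x) - e)%:E < lsc_env out v x)%E.
  by rewrite [X in (_ < X)%E]vfin // lte_fin gtrBl.
by move=> /lsc_env_gt; apply: filterS => y [_ h] oy; rewrite -lte_fin -vfin.
Qed.

Section Envelopes.
Context {g : 'rV[R]_n -> R} (pg : penalty (f := f) (l := l) (A := A) (T := T) g).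

(** With [W1 = W2] this is continuity; with the roles of two solutions exchanged it is
    uniqueness. *)
Lemma usc_env_le_lsc_env (W1 W2 : 'rV[R]_n -> R) :
  (forall x, out x -> 0 <= W1 x <= 1) -> (forall x, out x -> 0 <= W2 x <= 1) ->
  (forall x, bdry T x -> (usc_env out (EFin \o W1) x <= 0)%E) ->
  viscosity_subsolution K (~` T) (usc_env out (EFin \o W1)) ->
  viscosity_supersolution K (~` T) (lsc_env out (EFin \o W2)) ->
  forall x, out x -> (usc_env out (EFin \o W1) x <= lsc_env out (EFin \o W2) x)%E.
Proof.
move=> b1 b2 wb sub sup x ox.
have e1 y : out y -> (0 <= (EFin \o W1) y <= 1)%E by move=> /b1; rewrite /= !lee_fin.
have e2 y : out y -> (0 <= (EFin \o W2) y <= 1)%E by move=> /b2; rewrite /= !lee_fin.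
have f1 y : out y -> usc_env out (EFin \o W1) y \is a fin_num.
  move=> oy; have /andP[h1 h2] := usc_env_fin (a := 0) (b := 1) oy e1.
  by rewrite ge0_fin_numE //; exact: le_lt_trans h2 (ltry _).
have f2 y : out y -> lsc_env out (EFin \o W2) y \is a fin_num.
  move=> oy; have /andP[h1 h2] := lsc_env_fin (a := 0) (b := 1) oy e2.
  by rewrite ge0_fin_numE //; exact: le_lt_trans h2 (ltry _).
rewrite -[leLHS]fineK ?f1 // -[leRHS]fineK ?f2 // lee_fin.
apply: (comparison sa pg (w1 := fine \o usc_env out (EFin \o W1)) (w2 := fine \o lsc_env out (EFin \o W2))) ox => /=.
- by move=> y oy e; exact: fine_usc.
- by move=> y oy e; exact: fine_lsc.
- by move=> y oy; have /andP[_] := usc_env_fin (a := 0) (b := 1) oy e1; rewrite -[X in (X <= _)%E]fineK ?f1.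
- by move=> y oy; have /andP[+ _] := lsc_env_fin (a := 0) (b := 1) oy e2; rewrite -[X in (_ <= X)%E]fineK ?f2.
- by move=> y /[dup] /bdry_outside oy /wb; rewrite -[X in (X <= _)%E]fineK ?f1.
- move=> phi cphi y Ty h; apply/(kruzkov_le0 sa); apply: (sub phi cphi y Ty); first exact/f1/outside_notin.
  apply: filterS2 h (near_outside Ty) => z hz oz.
  by rewrite -[X in (X - _ <= _)%E]fineK ?f1 // -[X in (_ <= X - _)%E]fineK ?f1 ?lee_fin //; exact: outside_notin.
- move=> phi cphi y Ty _ h; apply/(kruzkov_ge0 sa); apply: (sup phi cphi y Ty); first exact/f2/outside_notin.
  apply: filterS2 h (near_outside Ty) => z hz oz.
  by rewrite -[X in (X - _ <= _)%E]fineK ?f2 // -1?[X in (_ <= X - _)%E]fineK ?f2 ?lee_fin //; exact: outside_notin.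
Qed.

Context (vs : forall x0 (e : R), bdry T x0 -> 0 < e -> \forall x \near x0, out x -> (V x <= e%:E)%E).

Definition kruzkov_value x : R := kruzkov (V x).

Local Notation W := kruzkov_value.

Lemma kruzkov_value_itv x : 0 <= W x <= 1.
Proof. exact/kruzkov_itv/(value_ge0 sa). Qed.

Lemma kruzkov_value_dpp_sub x alpha t : controls A alpha -> 0 <= t -> avoids x alpha t (f := f) (T := T) ->
  expR (- running_cost (f := f) (l := l) x alpha t) * (1 - W (trajectory f x alpha t)) <= 1 - W x.
Proof.
move=> ca t0 av; have := value_le_dpp sa ca t0 av; rewrite /W.
have := value_ge0 sa x; have := value_ge0 sa (trajectory f x alpha t).
case: (V (trajectory f x alpha t)) => [r||] // _; last first.
  by rewrite /= subrr mulr0 subr_ge0 kruzkov_le1.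
case: (V x) => [s||] //= _; rewrite lee_fin => h.
by rewrite !subKr -expRD ler_expR -opprD lerN2.
Qed.

(** For a finite value, a control of cost below [V x + e] suffices, because the exponential turns
    the additive error into one of at most [e]. For an infinite value the left-hand side is 0 and
    any control will do. *)
Lemma kruzkov_value_dpp_super x (e : R) : ~ T x -> 0 < e -> exists2 alpha, controls A alpha &
  forall t, 0 <= t -> avoids x alpha t (f := f) (T := T) ->
  1 - W x <= expR (- running_cost (f := f) (l := l) x alpha t) * (1 - W (trajectory f x alpha t)) + e.
Proof.
move=> Tx e0; have [[cA [a Aa]] _] := sa.
have := value_ge0 sa x; case E : (V x) => [v||] // v0; last first.
  exists (fun=> a) => [|t t0 av]; first exact: controls_cst.
  rewrite /W E /= subrr addr_ge0 ?(ltW e0) // mulr_ge0 ?expR_ge0 // subr_ge0.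
  exact: kruzkov_le1.
have : (V x < (v + e)%:E)%E by rewrite E lte_fin ltrDl.
rewrite value_out // => /ereal_inf_lt [_ [alpha aa <-] ce].
exists alpha => [|t t0 av]; first exact: aa.1.
have := le_lt_trans (cost_ge_dpp sa aa t0 av) ce; rewrite {1}/W E.
rewrite /W; have := value_ge0 sa (trajectory f x alpha t).
case: (V (trajectory f x alpha t)) => [r||] //= _; rewrite lte_fin => h.
rewrite !subKr -expRD.
have v1 : expR (- v) <= 1 by rewrite expR_le1 oppr_le0 -lee_fin.
have h1 : expR (- v) * (1 - e) <= expR (- v) * expR (- e).
  by rewrite ler_wpM2l ?expR_ge0 // expR_ge1Dx.
have h2 : expR (- v) * expR (- e) <= expR (- running_cost (f := f) (l := l) x alpha t + - r).
  by rewrite -expRD ler_expR; lra.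
have : e * expR (- v) <= e * 1 by rewrite ler_wpM2l // ltW.
lra.
Qed.

Lemma kruzkov_value_sub : viscosity_subsolution K (~` T) (usc_env out (EFin \o W)).
Proof.
apply: (dpp_subsolution sa kruzkov_value_itv) => x a t Aa; apply: kruzkov_value_dpp_sub; exact: controls_cst.
Qed.

Lemma kruzkov_value_super : viscosity_supersolution K (~` T) (lsc_env out (EFin \o W)).
Proof. exact: (dpp_supersolution sa kruzkov_value_itv kruzkov_value_dpp_super). Qed.

Lemma kruzkov_value_bdry x : bdry T x -> (usc_env out (EFin \o W) x <= 0)%E.
Proof.
move=> bx; apply/lee_addgt0Pr => e e0; rewrite add0e; apply: usc_env_le.
apply: filterS (vs bx e0) => y h oy /=; rewrite lee_fin.
exact: kruzkov_small (value_ge0 sa y) (h oy).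
Qed.

(** Comparison of the solution with itself puts its upper envelope below its lower one. *)
Lemma kruzkov_value_env x : out x ->
  usc_env out (EFin \o W) x = (W x)%:E /\ lsc_env out (EFin \o W) x = (W x)%:E.
Proof.
move=> ox.
have h := usc_env_le_lsc_env (fun y _ => kruzkov_value_itv y) (fun y _ => kruzkov_value_itv y) kruzkov_value_bdry kruzkov_value_sub kruzkov_value_super ox.
have h1 : ((W x)%:E <= usc_env out (EFin \o W) x)%E := le_usc_env (EFin \o W) ox.
have h2 : (lsc_env out (EFin \o W) x <= (W x)%:E)%E := lsc_env_le (EFin \o W) ox.
by split; apply/le_anti/andP; split=> //; [exact: le_trans h h2 | exact: le_trans h1 h].
Qed.

Lemma kruzkov_value_near x (e : R) : out x -> 0 < e -> \forall y \near x, out y -> `|W x - W y| < e.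
Proof.
move=> ox e0; have [h1 h2] := kruzkov_value_env ox.
have : (usc_env out (EFin \o W) x < (W x + e)%:E)%E by rewrite h1 lte_fin ltrDl.
have : ((W x - e)%:E < lsc_env out (EFin \o W) x)%E by rewrite h2 lte_fin gtrBl.
move=> /lsc_env_gt k2 /usc_env_lt k1.
apply: filterS2 k1 k2 => y [k1 _] [k2 _] oy.
have := k1 oy; have := k2 oy; rewrite /= !lte_fin => a1 a2.
by rewrite ltr_distlC a2 a1.
Qed.

Lemma kruzkov_value_continuous : {within out, continuous W}.
Proof.
apply/subspace_continuousP => x ox; apply/cvgrPdist_lt => e e0.
by rewrite near_withinE; exact: kruzkov_value_near.
Qed.

Lemma locally_bounded_W01 (W' : 'rV[R]_n -> R) : (forall x, out x -> 0 <= W' x <= 1) ->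
  locally_bounded out (EFin \o W').
Proof.
move=> b x ox; exists 1; apply/nbhs_rvP; exists 1 => // y _ /b /andP[h1 h2].
by rewrite /= lee_fin ger0_norm.
Qed.

Lemma kruzkov_value_solution : nonneg_BVPK_solution f l A T W.
Proof.
split; last by move=> x _; case/andP: (kruzkov_value_itv x).
split; first by move=> x _; case/andP: (kruzkov_value_itv x).
split; first by apply: locally_bounded_W01 => x _; exact: kruzkov_value_itv.
split; last by split; [exact: kruzkov_value_super | split; [exact: kruzkov_value_bdry | exact: kruzkov_value_sub]].
by move=> x bx; have [_ ->] := kruzkov_value_env (bdry_outside bx); rewrite lee_fin; case/andP: (kruzkov_value_itv x).
Qed.

Lemma BVPK_solution_unique W' : nonneg_BVPK_solution f l A T W' -> forall x, out x -> W' x = W x.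
Proof.
move=> [[W1 [_ [_ [sup [wb sub]]]]] W0] x ox.
have b y : out y -> 0 <= W' y <= 1 by move=> oy; rewrite W0 // W1.
have [h1 h2] := kruzkov_value_env ox.
have h3 := usc_env_le_lsc_env b (fun y _ => kruzkov_value_itv y) wb sub kruzkov_value_super ox.
have h4 := usc_env_le_lsc_env (fun y _ => kruzkov_value_itv y) b kruzkov_value_bdry kruzkov_value_sub sup ox.
have h5 : ((W' x)%:E <= usc_env out (EFin \o W') x)%E := le_usc_env (EFin \o W') ox.
have h6 : (lsc_env out (EFin \o W') x <= (W' x)%:E)%E := lsc_env_le (EFin \o W') ox.
apply/le_anti; rewrite -!lee_fin; apply/andP; split.
  by rewrite -h2; exact: le_trans h5 h3.
by rewrite -h1; exact: le_trans h4 h6.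
Qed.

Lemma value_lne x : V x = (- lne (1 - W x)%:E)%E.
Proof. exact/kruzkovK/(value_ge0 sa). Qed.

Lemma Dom_value : Dom T V = [set x | out x /\ W x < 1].
Proof.
have e x : (W x < 1) = (V x < +oo)%E by exact/kruzkov_lt1/(value_ge0 sa).
by apply/seteqP; split => x [ox h]; split; rewrite // ?e // -e.
Qed.

End Envelopes.
End KruzkovProblem.

(** * Subsolutions along the flow of a constant control *)

Section Flow.
Context {R : realType} {n m : nat} {f : 'rV[R]_n -> 'rV[R]_m -> 'rV[R]_n}
  {l : 'rV[R]_n -> 'rV[R]_m -> R} {A : set 'rV[R]_m} {T : set 'rV[R]_n}.
Context (sa : standing_assumptions f l A T).
Implicit Types (x y p : 'rV[R]_n).
Local Notation traj := (trajectory f).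

(** The condition [K * h <= 1] keeps the trajectory in the ball of radius [r + 1] on which the
    Lipschitz constant is taken. *)
Lemma flow_expansion (r : R) : 0 <= r -> exists2 K : R, 0 < K & forall x a p h,
  `|x| <= r -> A a -> 0 <= h <= 1 -> K * h <= 1 ->
  let d := traj x (fun=> a) h - x in
  `|d| <= K * h /\
  `|dot p d - h * dot p (f x a)| <= K * `|p| * h ^+ 2.
Proof.
move=> r0; have [C C0 hC] := trajectory_drift sa r.
have [L L0 hL] := fl_lipschitz sa (r + 1).
have K0 : 0 < C + n%:R * (L * C) by rewrite ltr_wpDr // !mulr_ge0 // ltW.
exists (C + n%:R * (L * C)) => // x a p h xr Aa /andP[h0 h1] Kh d.
have ca := controls_cst Aa.
have CK : C <= C + n%:R * (L * C) by rewrite lerDl !mulr_ge0 // ltW.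
have drift s : 0 <= s <= h -> `|traj x (fun=> a) s - x| <= C * s.
  by move=> /andP[s0 sh]; apply: hC => //; rewrite s0 (le_trans sh h1).
have hh : 0 <= h <= h by rewrite h0 lexx.
have dC := drift h hh; split; first by apply: le_trans dC _; rewrite ler_wpM2r.
rewrite (trajectory_dot sa) // -(mulrC (dot p (f x a))) -(pint_cst (dot p (f x a)) h0).
rewrite -pintB //; [|exact: (tame_dot_f sa)|exact: tame_cst].
apply: le_trans (_ : n%:R * (L * C) * `|p| * h * h <= _); last first.
  by rewrite -[leLHS]mulrA -expr2 ler_wpM2r ?sqr_ge0 // ler_wpM2r // lerDr ltW.
apply: pint_norm_le => //; first by apply: tameB; [exact: (tame_dot_f sa)|exact: tame_cst].
move=> s /andP[s0 sh]; rewrite -dotBr; apply: le_trans (le_norm_dot _ _) _.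
have ds := drift s; rewrite s0 sh in ds; have {}ds := ds isT.
have Cs : C * s <= 1.
  by apply: le_trans (_ : (C + n%:R * (L * C)) * h <= _) => //; apply: ler_pM => //; exact: ltW.
have b1 : `|traj x (fun=> a) s| <= r + 1.
  have := ler_normD (traj x (fun=> a) s - x) x; rewrite subrK; lra.
have b2 : `|x| <= r + 1 by lra.
have [hf _] := hL _ _ _ b1 b2 Aa.
rewrite (_ : n%:R * (L * C) * `|p| * h = n%:R * (`|p| * (L * (C * h)))); last by ring.
rewrite ler_wpM2l // ler_wpM2l //; apply: le_trans hf _; rewrite ler_wpM2l ?(ltW L0) //.
by apply: le_trans ds _; rewrite ler_wpM2l // ltW.
Qed.

Lemma near_pair_R (P : set ('rV[R]_n * R)) x (s q : R) : 0 < q ->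
  (forall y u, `|y - x| < q -> `|u - s| < q -> P (y, u)) -> nbhs (x, s) P.
Proof.
move=> q0 h; exists ([set y : 'rV[R]_n | `|y - x| < q], [set u : R | `|u - s| < q]).
  split; first by apply/nbhs_rvP; exists q.
  by apply/nbhs_ballP; exists q => // u /=; rewrite /ball /= distrC.
by move=> [y u] [/= yx us]; exact: h.
Qed.

(** The tube is parametrized by the displacement from [Y s] and the time, so that the compact set is
    a product. *)
Lemma tube_max (beta : R -> R) (W : 'rV[R]_n -> R) (Y : R -> 'rV[R]_n) (k rho t : R) :
  0 <= t -> 0 <= rho -> {within `[0, t], continuous Y} -> continuous beta ->
  (forall s y, 0 <= s <= t -> `|y - Y s| <= rho -> forall e, 0 < e ->
     \forall z \near y, W z < W y + e) ->
  exists eta s, [/\ 0 <= s <= t, `|eta| <= rho &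
    forall eta' s', 0 <= s' <= t -> `|eta'| <= rho ->
      W (Y s' + eta') - k * dot eta' eta' + beta s' <=
      W (Y s + eta) - k * dot eta eta + beta s].
Proof.
move=> t0 rho0 cY cb usc.
pose Phi (z : 'rV[R]_n * R) := W (Y z.2 + z.1) - k * dot z.1 z.1 + beta z.2.
have [| |[eta s] [/= er] st hmax] := @usc_max R ('rV[R]_n * R)%type ([set y | `|y - 0| <= rho] `*` `[0, t]) Phi
   (compact_setX (@compact_closed_ball R n 0 rho) (@segment_compact R 0 t)).
- by exists (0, 0); split => /=; rewrite ?subrr ?normr0 // in_itv /= lexx.
- move=> [eta s] [/= er]; rewrite subr0 in er; rewrite in_itv /= => st e e0.
  have e3 : 0 < e / 3 by rewrite divr_gt0.
  have [|q1 q10 h1] := (nbhs_rvP _ _).1 (usc s (Y s + eta) st _ _ e3).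
    by rewrite addrAC subrr add0r.
  have : {for eta, continuous (fun v : 'rV[R]_n => k * dot (v - 0) (v - 0))}.
    have [c2 _] := C1_on_scale k openT (C1_on_sqdist setT (0 : 'rV[R]_n)).1.
    exact: differentiable_continuous (c2 eta I).1.
  move=> /cvgrPdist_lt /(_ _ e3) /nbhs_rvP [q2 q20 h2].
  have /cvgrPdist_lt /(_ _ e3) /nbhs_ballP [q3 /= q30 h3] := cb s.
  have q12 : 0 < q1 / 2 by rewrite divr_gt0.
  have /subspace_continuousP /(_ s) := cY; rewrite /= in_itv /= => /(_ st).
  move=> /cvgrPdist_lt /(_ _ q12); rewrite near_withinE => /nbhs_ballP [q4 /= q40 h4].
  apply: (@near_pair_R _ eta s (Num.min (Num.min (q1 / 2) q2) (Num.min q3 q4))).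
    by rewrite !lt_min q12 q20 q30 q40.
  move=> y u; rewrite !lt_min => /andP[/andP[y1 y2] _] /andP[_ /andP[u3 u4]] [/= _].
  rewrite in_itv /= => ut.
  have b4 : `|Y s - Y u| < q1 / 2 by apply: h4; rewrite /ball /= ?in_itv /= // distrC.
  have b3 : `|beta s - beta u| < e / 3 by apply: h3; rewrite /ball /= distrC.
  have b2 := h2 y y2; rewrite !subr0 in b2.
  have b1 : W (Y u + y) < W (Y s + eta) + e / 3.
    apply: h1; rewrite (_ : _ - _ = (y - eta) - (Y s - Y u)); last first.
      by rewrite opprB opprD addrACA [RHS]addrC.
    by have := ler_normB (y - eta) (Y s - Y u); clear -b4 y1; lra.
  rewrite /Phi /=; move: b2 b3; rewrite !ltr_norml => /andP[c1 c2] /andP[c3 c4].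
  clear -b1 c1 c2 c3 c4; lra.
exists eta, s; rewrite /= in_itv /= in st; rewrite subr0 in er; split => // eta' s' s't er'.
by apply: (hmax (eta', s')); split; rewrite /= ?subr0 // in_itv.
Qed.

(* If the bound failed at time [t], then [1 - W y + k |y - Y s|^2 - kappa exp (C s)]
   would attain a negative minimum over a tube around the trajectory [Y] at some
   [s < t]; varying [s] forwards contradicts the viscosity test in [y]. *)
Lemma subsolution_flow (r : R) : 0 <= r -> exists2 C : R, 0 < C &
  forall (W : 'rV[R]_n -> R) (N : set 'rV[R]_n) a x0 t kappa, open N -> A a -> 0 <= t ->
  (forall s, 0 <= s <= t -> N (traj x0 (fun=> a) s) /\ `|traj x0 (fun=> a) s| <= r) ->
  (forall x, N x -> W x <= 1 /\ forall e, 0 < e -> \forall y \near x, W y < W x + e) ->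
  (forall phi, C1_on setT phi -> forall x, N x ->
     (\forall y \near x, W y - phi y <= W x - phi x) ->
     - dot (grad phi x) (f x a) - l x a * (1 - W x) <= 0) ->
  1 - W x0 < kappa -> 1 - W (traj x0 (fun=> a) t) <= kappa * expR (C * t).
Proof.
move=> r0; have [L L0 hL] := fl_lipschitz sa (r + 1).
have [B B0 hB] := l_bounded sa (r + 1).
have r10 : 0 <= r + 1 by lra.
have [K K0 hK] := flow_expansion r0.
(* [B] pays for the zero order term, [2 n L] for the deviation of the dynamics from the trajectory,
   and 1 gives slack. *)
pose C := B + 2 * n%:R * L + 1.
have nL : 0 <= n%:R * L by rewrite mulr_ge0 // ltW.
have C0 : 0 < C by rewrite /C; lra.
exists C => // W N a x0 t kappa oN Aa t0 hN hW sub hk.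
have ca := controls_cst Aa; set Y := traj x0 (fun=> a) in hN *.
have Y0 : Y 0 = x0 by rewrite /Y (trajectory0 sa).
have kappa0 : 0 < kappa.
  have [|N0 _] := hN 0; first by rewrite lexx.
  by rewrite Y0 in N0; have [w1 _] := hW _ N0; lra.
pose beta s := kappa * expR (C * s).
have beta0 s : 0 < beta s by rewrite mulr_gt0 // expR_gt0.
have beta_le s : s <= t -> beta s <= beta t.
  by move=> st; rewrite /beta ler_wpM2l ?(ltW kappa0) // ler_expR ler_wpM2l // ltW.
rewrite leNgt -/(beta t); apply/negP => viol.
have cY : {within `[0, t], continuous Y}.
  apply: continuous_subspaceW (trajectory_continuous sa (x := x0) ca) => s.
  by rewrite /= !in_itv /= => /andP[->].
have cK : compact (Y @` `[0, t]) by apply: continuous_compact cY (@segment_compact R 0 t).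
have [| |rho1 rho10 hrho1] := @compact_uniform R n _ (fun x e => forall y, `|y - x| < e -> N y) cK.
- by move=> x e e' _ ee' h y yx; apply: h; exact: lt_le_trans yx ee'.
- move=> _ [s + <-]; rewrite /= in_itv /= => st.
  have [e e0 he] := (nbhs_rvP (Y s) N).1 (open_nbhs_nbhs (conj oN (hN s st).1)).
  have e2 : 0 < e / 2 by rewrite divr_gt0.
  exists (e / 2) => //; exists (e / 2) => // y _ yY z zy; apply: he.
  by have := ler_normD (z - y) (y - Y s); rewrite addrA subrK; lra.
pose rho := Num.min (rho1 / 2) 1.
have rho0 : 0 < rho by rewrite lt_min divr_gt0 //=.
have rho_1 : rho <= 1 by rewrite ge_min lexx orbT.
have rho_r : rho < rho1 by apply: (@le_lt_trans _ _ (rho1 / 2)); [rewrite ge_min lexx | lra].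
have tube s y : 0 <= s <= t -> `|y - Y s| <= rho -> N y.
  move=> st yY; apply: (hrho1 (Y s)); last exact: le_lt_trans yY rho_r.
  by exists s => //; rewrite /= in_itv.
have Nt := (hN t); rewrite t0 lexx /= in Nt; have [{}Nt _] := Nt isT.
have v0 : 0 < 1 - W (Y t) - beta t by lra.
have [q q0 hq] := (nbhs_rvP _ _).1 ((hW _ Nt).2 _ v0).
pose q1 := Num.min q rho.
have q10 : 0 < q1 by rewrite lt_min q0.
clearbody rho.
(* A negative minimum satisfies [k * dot eta eta < beta t], which now forces [|eta| < q1]. It is
   thus inside the tube, and not at time [t], since [1 - W] exceeds [beta t] within distance [q] of
   [Y t]. *)
pose k := beta t / q1 ^+ 2.
have k0 : 0 < k by rewrite divr_gt0 // exprn_gt0.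
have [|eta [s [st er hmax]]] := @tube_max beta W Y k rho t t0 (ltW rho0) cY _
  (fun s y st yY => (hW y (tube s y st yY)).2).
  by move=> s; apply: cvgM; [exact: cvg_cst | apply: (cvg_comp _ expR); [apply: cvgM; [exact: cvg_cst | exact: cvg_id] | exact: continuous_expR]].
have /andP[s0 s_t] := st.
set x := Y s + eta in hmax.
have xY : x - Y s = eta by rewrite /x addrAC subrr add0r.
have Nx : N x by apply: (tube s) => //; rewrite xY.
have [wx1 uscx] := hW x Nx.
have hz : 1 - W x + k * dot eta eta < beta s.
  have := hmax 0 0; rewrite lexx t0 normr0 (ltW rho0) dot0l mulr0 subr0 addr0 Y0 => /(_ isT isT).
  by rewrite {1}/beta mulr0 expR0 mulr1; lra.
have kD0 : 0 <= k * dot eta eta by rewrite mulr_ge0 ?(ltW k0) // dot_ge0.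
have eq1 : `|eta| < q1.
  rewrite -(ltr_pXn2r (_ : 0 < 2)%N) ?nnegrE ?(ltW q10) //.
  apply: le_lt_trans (sqr_norm_le_dot _) _.
  have bt := beta_le s s_t.
  have : k * dot eta eta < beta t by clear -hz wx1 bt; lra.
  by rewrite /k mulrAC ltr_pdivrMr ?exprn_gt0 // ltr_pM2l.
have s_lt : s < t.
  rewrite lt_neqAle s_t andbT; apply/eqP => e; subst s.
  have : W x < W (Y t) + (1 - W (Y t) - beta t).
    by apply: hq; rewrite xY; apply: lt_le_trans eq1 _; rewrite ge_min lexx.
  by clear -hz kD0; lra.
have er' : `|eta| < rho by apply: lt_le_trans eq1 _; rewrite ge_min lexx orbT.
have [c1 gr1] := C1_on_sqdist setT (Y s).
have [c2 gr2] := C1_on_scale k openT c1.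
have hsub : - dot (k *: (2 *: eta)) (f x a) - l x a * (1 - W x) <= 0.
  have := sub _ c2 x Nx; rewrite gr2 // gr1 xY; apply.
  have d0 : 0 < rho - `|eta| by rewrite subr_gt0.
  apply/nbhs_rvP; exists (rho - `|eta|) => // y yx.
  have yY : `|y - Y s| <= rho.
    have := ler_normD (y - x) (x - Y s); rewrite addrA subrK xY; clear -yx; lra.
  by have := hmax (y - Y s) s st yY; rewrite subrKC; clear; lra.
rewrite !dotZl in hsub.
have Ys := (hN s st).2.
(* At time [s + h] the displacement [eta - d] represents the same point [x], so [W] cancels and only
   the quadratic term and [beta] vary. Dividing by [h] gives the time part of the optimality
   condition, one-sided since [s] may be 0. *)
have drift : C * beta s <= - (2 * k) * dot eta (f (Y s) a).
  rewrite leNgt; apply/negP; rewrite -subr_gt0; set D := _ - _ => D0.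
  pose Q := k * (2 * (K * `|eta|) + n%:R * K ^+ 2).
  have Q0 : 0 <= Q by rewrite mulr_ge0 ?(ltW k0) // addr_ge0 // !mulr_ge0 ?sqr_ge0 // ltW.
  have Q1 : 0 < Q + 1 by lra.
  pose h := Num.min (Num.min (t - s) 1) (Num.min (Num.min (K^-1) ((rho - `|eta|) / K)) (D / (Q + 1))).
  have h0 : 0 < h.
    by rewrite !lt_min subr_gt0 s_lt ltr01 invr_gt0 K0 divr_gt0 ?subr_gt0 //= divr_gt0.
  have : h <= h by [].
  rewrite {2}/h !le_min => /andP[/andP[h1 h2] /andP[/andP[h3 h4] h5]]; clearbody h.
  have h01 : 0 <= h <= 1 by rewrite (ltW h0).
  have Kh : K * h <= 1 by rewrite mulrC -ler_pdivlMr // div1r.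
  have [d1 d2] := hK (Y s) a eta h Ys Aa h01 Kh.
  rewrite (_ : traj (Y s) (fun=> a) h = Y (s + h)) in d1 d2; last first.
    by have := traj_shift sa x0 ca s0 (ltW h0); rewrite -/Y => <-.
  have sh : 0 <= s + h <= t by apply/andP; split; clear -s0 h0 h1; lra.
  set d := Y (s + h) - Y s in d1 d2.
  have ed : `|eta - d| <= rho.
    apply: le_trans (ler_normB _ _) _; rewrite ler_pdivlMr // in h4; clear -d1 h4; lra.
  have := hmax (eta - d) (s + h) sh ed.
  have -> : Y (s + h) + (eta - d) = x by rewrite /d /x opprB addrCA [Y (s + h) + _]addrC addrNK addrC.
  have b1 : beta s * (1 + C * h) <= beta (s + h).
    rewrite /beta [C * (s + h)]mulrDr expRD [leRHS]mulrA ler_wpM2l //; first exact/ltW/beta0.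
    exact: expR_ge1Dx.
  have dd : dot d d <= n%:R * K ^+ 2 * h ^+ 2.
    apply: le_trans (dot_le_norm _) _; rewrite -mulrA ler_wpM2l // -exprMn.
    by rewrite ler_pXn2r ?nnegrE // mulr_ge0 // ltW.
  rewrite dot_sqrD dotNl !dotNr opprK => hm.
  move: d2; rewrite ler_norml => /andP[d2 _].
  have m1 : k * dot d d <= k * (n%:R * K ^+ 2 * h ^+ 2) by rewrite ler_wpM2l // ltW.
  have m2 : k * (- (K * `|eta| * h ^+ 2)) <= k * (dot eta d - h * dot eta (f (Y s) a)) by rewrite ler_wpM2l // ltW.
  have m3 : D * h <= Q * h * h by rewrite /D /Q; clear -hm b1 m1 m2; lra.
  rewrite ler_pdivlMr // in h5.
  have : h * D <= h * (Q * h) by clear -m3; lra.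
  rewrite ler_pM2l // => m4; clear -m4 h5 h0; lra.
have xr : `|x| <= r + 1.
  have := ler_normD (Y s) eta; rewrite -/x; clear -Ys er' rho_1; lra.
have Yr : `|Y s| <= r + 1 by clear -Ys; lra.
have [hf _] := hL _ _ _ xr Yr Aa.
have F1 : 2 * k * dot eta (f x a - f (Y s) a) <= 2 * n%:R * L * (k * dot eta eta).
  have q2 : dot eta (f x a - f (Y s) a) <= n%:R * L * dot eta eta.
    apply: le_trans (ler_norm _) _; apply: le_trans (le_norm_dot _ _) _.
    rewrite -mulrA ler_wpM2l //; apply: (@le_trans _ _ (`|eta| * (L * `|eta|))).
      by rewrite ler_wpM2l // -[eta in leRHS]xY.
    rewrite mulrCA -expr2 ler_wpM2l ?(ltW L0) //; exact: sqr_norm_le_dot.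
  have : k * dot eta (f x a - f (Y s) a) <= k * (n%:R * L * dot eta eta) by rewrite ler_wpM2l // ltW.
  clear; lra.
have F2 : l x a * (1 - W x) <= B * (1 - W x) by rewrite ler_wpM2r ?hB // subr_ge0.
have F3 : C * (1 - W x + k * dot eta eta) < C * beta s by rewrite ltr_pM2l.
have F4 : 0 <= B * (k * dot eta eta) by rewrite mulr_ge0 // ltW.
have F5 : 0 <= n%:R * L * (1 - W x) by rewrite mulr_ge0 // subr_ge0.
rewrite dotBr in F1; rewrite {1}/C in F3.
clear -F1 F2 F3 F4 F5 drift hsub kD0 wx1; lra.
Qed.

End Flow.

(** * Order of the extended reals and bounds for the exponential *)

Section ExtendedOrder.
Context {R : realType}.
Implicit Types (u v : \bar R).

Lemma lee_of_lt u v : (forall a : R, a%:E < u -> a%:E <= v)%E -> (u <= v)%E.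
Proof.
case: u => [r||] h; last exact: leNye.
  apply/lee_subgt0Pr => e e0; rewrite -EFinB; apply: h; rewrite lte_fin; lra.
case: v h => [s||] h //.
  by have := h (s + 1) (ltry _); rewrite lee_fin => h'; exfalso; lra.
by have := h 0 (ltry _).
Qed.

Lemma lee_of_gt u v : (forall b : R, u < b%:E -> v <= b%:E)%E -> (v <= u)%E.
Proof.
move=> h; rewrite -leeN2; apply: lee_of_lt => a; rewrite lteNr -EFinN => /h.
by rewrite EFinN leeNr.
Qed.

End ExtendedOrder.

Section ExpBounds.
Context {R : realType}.
Implicit Types s r t : R.

Lemma expR_le_quad s : `|s| <= 1 / 2 -> expR (- s) <= 1 - s + 2 * s ^+ 2.
Proof.
rewrite ler_norml => /andP[h1 h2].
have e1 : expR (- s) * expR s = 1 by rewrite -expRD addNr expR0.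
have : expR (- s) * (1 + s) <= 1 by rewrite -[leRHS]e1 ler_wpM2l ?expR_ge0 // expR_ge1Dx.
have p : 0 < 1 + s by lra.
rewrite -ler_pdivlMr // div1r => h; apply: le_trans h _.
rewrite -[leLHS]mul1r ler_pdivrMr //.
have : 0 <= s ^+ 2 * (1 + 2 * s) by rewrite mulr_ge0 ?sqr_ge0 //; lra.
lra.
Qed.

(** This is [- ln (1 - s) <= s + 2 * s ^+ 2] for [s <= 1 / 2]; it bounds a test from above when the
    transform is undone. *)
Lemma expR_le_sub s : s <= 1 / 2 -> expR (- (s + 2 * s ^+ 2)) <= 1 - s.
Proof.
move=> h; set q := s + _.
have e1 : expR (- q) * expR q = 1 by rewrite -expRD addNr expR0.
have h1 : expR (- q) * (1 + q) <= 1 by rewrite -[leRHS]e1 ler_wpM2l ?expR_ge0 // expR_ge1Dx.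
have p : 0 < 1 + q by have := sqr_ge0 (s + 1 / 4); rewrite /q sqrrD; lra.
move: h1; rewrite -ler_pdivlMr // div1r => h1; apply: le_trans h1 _.
rewrite -[leLHS]mul1r ler_pdivrMr //.
have : 0 <= s ^+ 2 * (1 - 2 * s) by rewrite mulr_ge0 ?sqr_ge0 //; lra.
rewrite /q; lra.
Qed.

(** The transform is concave, so a test from above is carried to it by the factor [expR (- r)]
    alone. Tests from below need a quadratic correction. *)
Lemma expR_tangent_le r t p q : t - q <= r - p ->
  1 - expR (- t) - expR (- r) * q <= 1 - expR (- r) - expR (- r) * p.
Proof.
move=> h; have : expR (- r) * (1 - (q - p)) <= expR (- r) * expR (- (q - p)).
  by rewrite ler_wpM2l ?expR_ge0 // expR_ge1Dx.
have : expR (- r) * expR (- (q - p)) <= expR (- t) by rewrite -expRD ler_expR; lra.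
by move: (expR (- r)) (expR (- t)) (expR _) => E F G; lra.
Qed.

End ExpBounds.

(** * The value as a solution of (BVP) *)

Section OptimalValue.
Context {R : realType} {n m : nat} {f : 'rV[R]_n -> 'rV[R]_m -> 'rV[R]_n}
  {l : 'rV[R]_n -> 'rV[R]_m -> R} {A : set 'rV[R]_m} {T : set 'rV[R]_n}.
Context (sa : standing_assumptions f l A T).
Implicit Types (x y p : 'rV[R]_n).
Local Notation V := (value f l A T).
Local Notation W := (kruzkov_value (f := f) (l := l) (A := A) (T := T)).
Local Notation out := (outside T).

(** The homogeneity behind the transform: at [r = 1 - q] and gradient [q *: p], the new Hamiltonian
    is [q] times the old one at [p]. *)
Lemma scaled_le0 x p (q : R) a : 0 < q -> - dot (q *: p) (f x a) - l x a * q <= 0 <->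
  - dot p (f x a) - l x a * 1 <= 0.
Proof.
move=> q0; rewrite dotZl (_ : _ - _ = q * (- dot p (f x a) - l x a * 1)); last by ring.
by rewrite pmulr_rle0.
Qed.

Lemma scaled_ge0 x p (q : R) : 0 < q ->
  (forall d, 0 < d -> exists2 a, A a & - d < - dot (q *: p) (f x a) - l x a * q) <->
  (forall d, 0 < d -> exists2 a, A a & - d < - dot p (f x a) - l x a * 1).
Proof.
move=> q0; split=> h d d0.
  have [|a Aa] := h (q * d); first by rewrite mulr_gt0.
  rewrite dotZl (_ : _ - _ = q * (- dot p (f x a) - l x a * 1)); last by ring.
  by rewrite -mulrN ltr_pM2l // => ha; exists a.
have [|a Aa ha] := h (d / q); first by rewrite divr_gt0.
exists a => //; rewrite dotZl (_ : _ - l x a * q = q * (- dot p (f x a) - l x a * 1)); last by ring.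
by move: ha; rewrite -(ltr_pM2l q0) mulrN [q * (d / q)]mulrC divfK // gt_eqF.
Qed.

Context {g : 'rV[R]_n -> R} (pg : penalty (f := f) (l := l) (A := A) (T := T) g).
Context (vs : forall x0 (e : R), bdry T x0 -> 0 < e -> \forall x \near x0, out x -> (V x <= e%:E)%E).

Lemma value_near_gt x (a : R) : out x -> (a%:E < V x)%E -> \forall y \near x, out y -> (a%:E < V y)%E.
Proof.
move=> ox ax; have e0 : 0 < W x - (1 - expR (- a)) by rewrite subr_gt0 lt_kruzkov ?(value_ge0 sa).
apply: filterS (kruzkov_value_near sa pg vs ox e0) => y h oy; rewrite -(lt_kruzkov a (value_ge0 sa y)).
by have := h oy; rewrite ltr_norml => /andP[_]; rewrite ltrD2l ltrN2.
Qed.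

Lemma value_near_lt x (b : R) : out x -> (V x < b%:E)%E -> \forall y \near x, out y -> (V y < b%:E)%E.
Proof.
move=> ox bx; have e0 : 0 < 1 - expR (- b) - W x by rewrite subr_gt0 kruzkov_lt ?(value_ge0 sa).
apply: filterS (kruzkov_value_near sa pg vs ox e0) => y h oy; rewrite -(kruzkov_lt b (value_ge0 sa y)).
by have := h oy; rewrite ltr_norml opprB => /andP[+ _]; rewrite ltrD2l ltrN2.
Qed.

Lemma value_fin x : (V x < +oo)%E -> V x = (fine (V x))%:E.
Proof. by move=> h; rewrite fineK // ge0_fin_numE ?(value_ge0 sa). Qed.

Lemma value_near_fin x : out x -> (V x < +oo)%E -> \forall y \near x, out y -> (V y < +oo)%E.
Proof.
move=> ox h; have : (V x < (fine (V x) + 1)%:E)%E by rewrite {1}value_fin // lte_fin ltrDl.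
by move=> /(value_near_lt ox); apply: filterS => y hy /hy hh; exact: lt_trans hh (ltry _).
Qed.

Lemma value_continuous : {within out, continuous V}.
Proof.
apply/subspace_continuousP => x ox.
suff : V y @[y --> within out (nbhs x)] --> V x by [].
have := value_ge0 sa x; case E : (V x) => [r||] // _.
  apply/fine_cvgP; split.
    have h : (V x < +oo)%E by rewrite E ltry.
    rewrite near_withinE; apply: filterS (value_near_fin ox h) => y hy /hy.
    by rewrite ge0_fin_numE ?(value_ge0 sa).
  apply/cvgrPdist_lt => e e0; rewrite near_withinE.
  have h1 : (V x < (r + e)%:E)%E by rewrite E lte_fin ltrDl.
  have h2 : ((r - e)%:E < V x)%E by rewrite E lte_fin gtrBl.
  apply: filterS2 (value_near_lt ox h1) (value_near_gt ox h2) => y k1 k2 oy.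
  have := k1 oy; have := k2 oy => /=; case: (V y) => [s||] //=; rewrite !lte_fin => a1 a2.
  rewrite ltr_norml; apply/andP; split; lra.
apply/cvgeyPge => a; rewrite near_withinE.
by apply: filterS (value_near_gt ox (_ : (a%:E < V x)%E)) => [y h /h /ltW //|]; rewrite E ltry.
Qed.

Lemma lsc_env_value x : out x -> lsc_env out V x = V x.
Proof.
move=> ox; apply/le_anti/andP; split; first exact: lsc_env_le.
apply: lee_of_lt => a /(value_near_gt ox) h; apply: lsc_env_ge.
by apply: filterS h => y h /h /ltW.
Qed.

Lemma Dom_setE (u : 'rV[R]_n -> \bar R) : (forall x, bdry T x -> (u x < +oo)%E) ->
  (Dom T u `|` T) `\` T° = Dom T u.
Proof.
move=> h; apply/seteqP; split => x; last by move=> [ox ux]; split => //; left.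
by move=> [[//|Tx] ox]; split => //; apply: h; split => //; exact: subset_closure.
Qed.

Lemma value_bdry x : bdry T x -> V x = 0%E.
Proof. by have [_ [[_ cT _] _]] := sa; move=> [/cT Tx _]; rewrite value_in. Qed.

Lemma Dom_value_setE : (Dom T V `|` T) `\` T° = Dom T V.
Proof. by apply: Dom_setE => x bx; rewrite value_bdry // ltry. Qed.

Lemma usc_env_value x : Dom T V x -> usc_env (Dom T V) V x = V x.
Proof.
move=> [ox Vx]; apply/le_anti/andP; split; last exact: (@le_usc_env _ _ (Dom T V)).
apply: lee_of_gt => b /(value_near_lt ox) h; apply: usc_env_le.
by apply: filterS h => y h [/h /ltW].
Qed.

Lemma open_Dom_value : open (Dom T V `|` T).
Proof.
have [_ [[_ cT _] _]] := sa.
rewrite openE => x [[ox Vx]|Tx].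
  apply: filterS (value_near_fin ox Vx) => y hy.
  have [oy|noy] := pselect (out y); last by right; exact: (interior_subset (contrapT noy)).
  by left; split; [exact: oy | exact: hy oy].
have [ox|nox] := pselect (out x); last first.
  have : nbhs x T by exact: (contrapT nox).
  by apply: filterS => y; right.
have bx : bdry T x by split => //; exact: subset_closure.
apply: filterS (vs bx ltr01) => y hy.
have [oy|noy] := pselect (out y); last by right; exact: (interior_subset (contrapT noy)).
by left; split => //; apply: le_lt_trans (hy oy) (ltry _).
Qed.

Lemma kruzkov_value_sub_at phi x : ~ T x -> differentiable phi x ->
  (\forall y \near x, W y - phi y <= W x - phi x) ->
  forall a, A a -> - dot (grad phi x) (f x a) - l x a * (1 - W x) <= 0.
Proof.
move=> Tx dphi h; have ox := outside_notin Tx; have [e1 _] := kruzkov_value_env sa pg vs ox.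
have := dpp_subsolution_at sa (kruzkov_value_itv sa) (fun x a t Aa => @kruzkov_value_dpp_sub _ _ _ _ _ _ _ sa x _ t (controls_cst Aa)) (phi := phi) Tx dphi.
rewrite /= e1 => k; apply/(kruzkov_le0 sa)/k.
apply: filterS2 h (near_outside sa Tx) => y hy oy.
by have [-> _] := kruzkov_value_env sa pg vs oy; rewrite -!EFinB lee_fin; exact: hy.
Qed.

Lemma kruzkov_value_super_at phi x : ~ T x -> C1_on (~` T) phi ->
  (\forall y \near x, W x - phi x <= W y - phi y) ->
  forall d, 0 < d -> exists2 a, A a & - d < - dot (grad phi x) (f x a) - l x a * (1 - W x).
Proof.
move=> Tx cphi h; have ox := outside_notin Tx; have [_ e1] := kruzkov_value_env sa pg vs ox.
have := kruzkov_value_super sa cphi Tx; rewrite /= e1 => k; apply/(kruzkov_ge0 sa)/k => //.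
apply: filterS2 h (near_outside sa Tx) => y hy oy.
by have [_ ->] := kruzkov_value_env sa pg vs oy; rewrite -!EFinB lee_fin; exact: hy.
Qed.

Lemma near_small (phi : 'rV[R]_n -> R) x (e : R) : differentiable phi x -> 0 < e ->
  \forall y \near x, `|phi y - phi x| <= e.
Proof.
move=> /differentiable_continuous /cvgrPdist_lt h e0; apply: filterS (h e e0) => y.
by rewrite distrC => /ltW.
Qed.

Lemma value_supersolution : viscosity_supersolution (fun x _ p => hamiltonian f l A x p) (~` T) (lsc_env out V).
Proof.
have [_ [[_ cT _] _]] := sa.
move=> phi cphi x Tx; have ox := outside_notin Tx; rewrite lsc_env_value // => Vx h.
have oT : open (~` T) by exact: closed_openC.
set r := fine (V x); have Vr : V x = r%:E by rewrite fineK.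
have q0 : 0 < expR (- r) by exact: expR_gt0.
apply/(hamiltonian_ge0 sa)/(scaled_ge0 x (grad phi x) q0).
(* The coefficient [- 2 * expR (- r)] cancels the square in [expR_le_quad]. *)
have [c1 gr1] := C1_on_quad (expR (- r)) (- 2 * expR (- r)) (phi x) oT cphi.
have Wx : 1 - W x = expR (- r) by rewrite /kruzkov_value Vr /= subKr.
have := kruzkov_value_super_at Tx c1; rewrite gr1 // subrr mulr0 addr0 Wx; apply.
have h2 : (0 : R) < 1 / 2 by rewrite divr_gt0.
apply: filterS3 h (near_outside sa Tx) (near_small (cphi x Tx).1 h2) => y hy oy sy.
move: hy; rewrite lsc_env_value // /kruzkov_value Vr; set s := phi y - phi x in sy *.
have := expR_le_quad sy; rewrite -(ler_pM2l q0).
have := value_ge0 sa y; case: (V y) => [t||] //= _; last first.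
  move=> h0 _; have : 0 <= expR (- r) * expR (- s) by rewrite mulr_ge0 ?expR_ge0.
  move: h0; rewrite ?subrr expr0n /= mulr0 addr0 /s.
  by move: (expR (- r)) (expR _) (phi x) (phi y) => E F px py; lra.
rewrite lee_fin => e1 e2.
have : expR (- t) <= expR (- r) * expR (- s) by rewrite -expRD ler_expR /s; clear -e2; lra.
move: e1; rewrite ?subrr expr0n /= mulr0 addr0 /s.
by move: (expR (- r)) (expR (- t)) (expR _) (phi x) (phi y) => E F G px py; lra.
Qed.

Lemma value_subsolution : viscosity_subsolution (fun x _ p => hamiltonian f l A x p)
  ((Dom T V `|` T) `\` T) (usc_env (Dom T V) V).
Proof.
have [_ [[_ cT _] _]] := sa.
have oO : open ((Dom T V `|` T) `\` T) by apply: openI; [exact: open_Dom_value | exact: closed_openC].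
have OD y : ((Dom T V `|` T) `\` T) y -> Dom T V y by move=> [[|]].
move=> phi cphi x Ox; have [_ Tx] := Ox; have Dx := OD x Ox; have [ox Vx] := Dx.
rewrite usc_env_value // => _ h; set r := fine (V x); have Vr : V x = r%:E by rewrite -value_fin.
have q0 : 0 < expR (- r) by exact: expR_gt0.
apply/(hamiltonian_le0 sa) => a Aa; apply/(scaled_le0 x (grad phi x) a q0).
have [c1 gr1] := C1_on_scale (expR (- r)) oO cphi.
have Wx : 1 - W x = expR (- r) by rewrite /kruzkov_value Vr /= subKr.
have := kruzkov_value_sub_at Tx (c1 x Ox).1; rewrite gr1 // Wx; apply => //.
have nO : nbhs x ((Dom T V `|` T) `\` T) by apply: open_nbhs_nbhs; split.
apply: filterS2 h nO => y hy Oy; have Dy := OD y Oy; have [oy Vy] := Dy.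
by move: hy; rewrite usc_env_value // /kruzkov_value Vr (value_fin Vy) /= lee_fin; exact: expR_tangent_le.
Qed.

Lemma value_solution : nonneg_blowup_BVP_solution f l A T V.
Proof.
split; last first.
- move=> x0 [[ox0 _] cD].
  have cV : V y @[y --> within out (nbhs x0)] --> V x0.
    by move/subspace_continuousP: value_continuous => /(_ x0 ox0).
  (* Finiteness of the value propagates to neighbours, so it cannot be finite on the relative
     boundary of its domain. *)
  suff Vx0 : V x0 = +oo%E by rewrite Vx0 in cV.
  apply/eqP; rewrite -leye_eq leNgt; apply/negP => h.
  have [y [[oy nD] /(_ oy) hy]] := cD _ (value_near_fin ox0 h).
  by apply: nD; split.
- by move=> x _; exact: (value_ge0 sa).
split; first by split; [exact: open_Dom_value | move=> x Tx; right].
split; first by move=> x _; rewrite -ltNye; exact: lt_le_trans (ltNyr 0) (value_ge0 sa x).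
split; first by move=> x bx; rewrite lsc_env_value ?value_bdry //; case: bx.
split; first exact: value_supersolution.
rewrite Dom_value_setE; split; first by move=> x [_ Vx]; rewrite ge0_fin_numE ?(value_ge0 sa).
split.
  move=> x [ox Vx]; exists (fine (V x) + 1).
  have h : (V x < (fine (V x) + 1)%:E)%E by rewrite {1}value_fin // lte_fin ltrDl.
  apply: filterS (value_near_lt ox h) => y hy [/hy /ltW hl _].
  by rewrite gee0_abs ?(value_ge0 sa).
split; last exact: value_subsolution.
move=> x bx; rewrite usc_env_value ?value_bdry //; split; first by case: bx.
by rewrite value_bdry // ltry.
Qed.

End OptimalValue.

(** * Uniqueness for (BVP) *)

Section BlowupUniqueness.
Context {R : realType} {n m : nat} {f : 'rV[R]_n -> 'rV[R]_m -> 'rV[R]_n}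
  {l : 'rV[R]_n -> 'rV[R]_m -> R} {A : set 'rV[R]_m} {T : set 'rV[R]_n}.
Context (sa : standing_assumptions f l A T).
Implicit Types (x y p : 'rV[R]_n).
Local Notation V := (value f l A T).
Local Notation W := (kruzkov_value (f := f) (l := l) (A := A) (T := T)).
Local Notation out := (outside T).
Local Notation traj := (trajectory f).

Context {g : 'rV[R]_n -> R} (pg : penalty (f := f) (l := l) (A := A) (T := T) g).
Context (vs : forall x0 (e : R), bdry T x0 -> 0 < e -> \forall x \near x0, out x -> (V x <= e%:E)%E).
Context {u : 'rV[R]_n -> \bar R} (su : nonneg_blowup_BVP_solution f l A T u).

Let D := Dom T u.
Let Om := D `|` T.
Let upper := usc_env D u.
Let lower := lsc_env out u.

Let u0 x : out x -> (0 <= u x)%E. Proof. by case: su => _ + _; apply. Qed.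

Let setE : Om `\` T° = D.
Proof.
apply: Dom_setE => x [cx ox]; have [[_ [_ [_ [_ [fin _]]]]] _ _] := su.
have [_ [[_ cT _] _]] := sa.
have : u x \is a fin_num by apply: fin; split => //; right; exact: cT.
by rewrite fin_numElt => /andP[].
Qed.

Let open_Om : open Om. Proof. by have [[[]]] := su. Qed.

Let D_in x : Om x -> out x -> D x. Proof. by move=> Ox ox; rewrite -setE. Qed.

Let upper_fin x : D x -> (0 <= upper x)%E /\ upper x = (fine (upper x))%:E.
Proof.
move=> Dx; have [ox ux] := Dx.
have U0 : (0 <= upper x)%E by apply: le_trans (u0 ox) (le_usc_env u Dx).
split => //; rewrite fineK // ge0_fin_numE //.
have [[_ [_ [_ [_ [_ [lb _]]]]]] _ _] := su.
rewrite setE in lb; have [c hc] := lb x Dx.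
apply: le_lt_trans (ltry c); apply: usc_env_le.
by apply: filterS hc => y hc Dy; have := hc Dy; rewrite gee0_abs // u0 //; case: Dy.
Qed.

Let lower_ge0 x : out x -> (0 <= lower x)%E.
Proof.
move=> ox; apply: lsc_env_ge; apply/nbhs_rvP; exists 1 => // y _; exact: u0.
Qed.

Let kruzkov_level (c : R) : c < 1 -> c = 1 - expR (- (- ln (1 - c))).
Proof. by move=> c1; rewrite opprK lnK ?posrE ?subr_gt0 // subKr. Qed.

(** The lower envelope of [u] may be [+oo]; such points have transform 1, where [comparison] asks
    for no test. *)
Lemma value_le_lsc_env x : out x -> (V x <= lower x)%E.
Proof.
have [_ [[_ cT _] _]] := sa; have oT : open (~` T) by exact: closed_openC.
have [[_ [_ [_ [sup _]]]] _ _] := su.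
move=> ox; rewrite -le_kruzkov ?(value_ge0 sa) ?lower_ge0 //.
apply: (comparison sa pg (w1 := W) (w2 := fun y => kruzkov (lower y))) ox => {x}.
- move=> x ox e e0; apply: filterS (kruzkov_value_near sa pg vs ox e0) => y h /h.
  by rewrite ltr_distlC => /andP[].
- move=> x ox e e0; set c := kruzkov _ - e.
  have c1 : c < 1 by rewrite /c; have := kruzkov_le1 (lower x); lra.
  have : 1 - expR (- (- ln (1 - c))) < kruzkov (lower x) by rewrite -kruzkov_level // /c gtrBl.
  rewrite lt_kruzkov ?lower_ge0 // => /lsc_env_gt; apply: filterS => y [_ h] oy.
  by rewrite [ltLHS](kruzkov_level c1) lt_kruzkov ?lower_ge0.
- by move=> x _; case/andP: (kruzkov_value_itv sa x).
- by move=> x ox; case/andP: (kruzkov_itv (lower_ge0 ox)).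
- by move=> x bx; rewrite /kruzkov_value (value_bdry sa bx) /= oppr0 expR0 subrr.
- by move=> phi cphi x Tx h; apply: (kruzkov_value_sub_at sa pg vs Tx (cphi x Tx).1 h).
move=> phi cphi x Tx; have ox := outside_notin Tx.
rewrite kruzkov_lt1 ?lower_ge0 // => Lx h.
set r := fine (lower x); have Lr : lower x = r%:E by rewrite fineK // ge0_fin_numE // lower_ge0.
have q0 : 0 < expR (- r) by exact: expR_gt0.
have [c1 gr1] := C1_on_scale (expR r) oT cphi.
have -> : 1 - kruzkov (lower x) = expR (- r) by rewrite Lr /= subKr.
have -> : grad phi x = expR (- r) *: (expR r *: grad phi x) by rewrite scalerA -expRD addNr expR0 scale1r.
apply/(scaled_ge0 x (expR r *: grad phi x) q0)/(hamiltonian_ge0 sa); rewrite -gr1 //.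
apply: (sup _ c1 x Tx); first by rewrite -/lower Lr.
apply: filterS2 h (near_outside sa Tx) => y hy oy; rewrite -/lower Lr.
move: hy; rewrite Lr; have := lower_ge0 oy; case: (lower y) => [t||] //= _ hy; rewrite ?leey // lee_fin.
set s := expR r * (phi y - phi x).
have h1 : expR (- t) <= expR (- r) * (1 - s).
  have -> : expR (- r) * (1 - s) = expR (- r) - (expR (- r) * expR r) * (phi y - phi x).
    by rewrite /s; ring.
  by rewrite -[expR (- r) * expR r]expRD addNr expR0 mul1r; move: hy; move: (expR (- r)) (expR (- t)) => E F; lra.
have h2 : expR (- t) <= expR (- r) * expR (- s).
  by apply: le_trans h1 _; rewrite ler_wpM2l ?(ltW q0) // expR_ge1Dx.
by move: h2; rewrite -expRD ler_expR /s; move: (expR r) => E; lra.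
Qed.

Let w1 x : R := if x \in Om then kruzkov (upper x) else 1.

Let w1E x : Om x -> w1 x = kruzkov (upper x).
Proof. by move=> Ox; rewrite /w1 mem_set. Qed.

Let w1_notin x : ~ Om x -> w1 x = 1.
Proof. by move=> Ox; rewrite /w1 memNset. Qed.

Let w1_le1 x : w1 x <= 1.
Proof. by rewrite /w1; case: ifP => // _; exact: kruzkov_le1. Qed.

(** Off the open set [Om] the function has its greatest value 1, so gluing cannot break upper
    semicontinuity. *)
Let w1_usc x (e : R) : out x -> 0 < e -> \forall y \near x, out y -> w1 y < w1 x + e.
Proof.
move=> ox e0; have [Ox|Ox] := pselect (Om x); last first.
  by apply/nbhs_rvP; exists 1 => // y _ _; rewrite (w1_notin Ox); have := w1_le1 y; lra.
have [U0 Ur] := upper_fin (D_in Ox ox).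
have w1x : w1 x < 1 by rewrite w1E // kruzkov_lt1 // Ur ltry.
(* The level is capped below 1, since only such levels are transforms of real numbers. *)
pose c := Num.min (w1 x + e) ((1 + w1 x) / 2).
have c1 : c < 1 by rewrite gt_min; apply/orP; right; lra.
have cx : w1 x < c by rewrite lt_min; apply/andP; split; lra.
have ce : c <= w1 x + e by rewrite ge_min lexx.
move: cx; rewrite {1}w1E // [ltRHS](kruzkov_level c1) kruzkov_lt // => /usc_env_lt h.
apply: filterS2 h (open_nbhs_nbhs (conj open_Om Ox)) => y [_ h] Oy oy.
apply: lt_le_trans ce; rewrite w1E // [ltRHS](kruzkov_level c1) kruzkov_lt //.
exact: (upper_fin (D_in Oy oy)).1.
Qed.

Let w1_sub_in phi x a : C1_on (~` T) phi -> ~ T x -> Om x -> A a ->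
  (\forall y \near x, w1 y - phi y <= w1 x - phi x) ->
  - dot (grad phi x) (f x a) - l x a * (1 - w1 x) <= 0.
Proof.
move=> cphi Tx Ox Aa h; have [_ [[_ cT _] _]] := sa.
have oT : open (~` T) by exact: closed_openC.
have ox := outside_notin Tx; have Dx := D_in Ox ox.
have [U0 Ur] := upper_fin Dx; set r := fine (upper x) in Ur.
have q0 : 0 < expR (- r) by exact: expR_gt0.
have [[_ [_ [_ [_ [_ [_ [_ sub]]]]]]] _ _] := su.
rewrite setE in sub.
(* With [s = expR r * (phi y - phi x)] the new test increment is [s + 2 * s ^+ 2], the quantity in
   [expR_le_sub]. *)
have [c1 gr1] := C1_on_quad (expR r) (2 * expR r ^+ 2) (phi x) oT cphi.
have -> : 1 - w1 x = expR (- r) by rewrite w1E // Ur /= subKr.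
have -> : grad phi x = expR (- r) *: (expR r *: grad phi x) by rewrite scalerA -expRD addNr expR0 scale1r.
apply/(scaled_le0 x (expR r *: grad phi x) a q0).
have -> : expR r *: grad phi x = grad (fun y => expR r * phi y + 2 * expR r ^+ 2 * (phi y - phi x) ^+ 2) x.
  by rewrite gr1 // subrr mulr0 addr0.
apply: (hamiltonian_le0 sa x _).1 => //; apply: (sub _ _ x).
- by move=> y [_ Ty]; exact: c1.
- by split.
- by rewrite -/upper Ur.
have s2 : 0 < 1 / 2 * expR (- r) by rewrite mulr_gt0 // divr_gt0.
apply: filterS3 h (open_nbhs_nbhs (conj open_Om Ox)) (filterI (near_outside sa Tx) (near_small (cphi x Tx).1 s2)).
move=> y hy Oy [oy sy]; rewrite -/upper; have [_ Uy] := upper_fin (D_in Oy oy).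
move: hy; rewrite !w1E // Ur Uy /= lee_fin; set t := fine (upper y) => hy.
set s := expR r * (phi y - phi x).
have s_le : s <= 1 / 2.
  have : expR r * (phi y - phi x) <= expR r * (1 / 2 * expR (- r)).
    by rewrite ler_wpM2l ?expR_ge0 //; apply: le_trans (ler_norm _) sy.
  by rewrite mulrCA -expRD subrr expR0 mulr1.
have h1 : expR (- r) * (1 - s) <= expR (- t).
  have -> : expR (- r) * (1 - s) = expR (- r) - (expR (- r) * expR r) * (phi y - phi x).
    by rewrite /s; ring.
  by rewrite -[expR (- r) * expR r]expRD addNr expR0 mul1r; move: hy; move: (expR (- r)) (expR (- t)) => E F; lra.
have h2 : expR (- r) * expR (- (s + 2 * s ^+ 2)) <= expR (- t).
  by apply: le_trans h1; rewrite ler_wpM2l ?(ltW q0) // expR_le_sub.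
move: h2; rewrite -expRD ler_expR subrr expr0n /= mulr0 addr0 /s exprMn => h2'.
clear hy h1 s2 s_le sy q0; move: (expR r) h2' => E; lra.
Qed.

(* Otherwise [phi], hence [w1], would decrease along the flow of [a], which would
   therefore enter [Dom u] at once; flowing from points ever closer to [x], where
   [1 - w1] is arbitrarily small, contradicts [subsolution_flow]. *)
Let w1_sub_notin phi x a : C1_on (~` T) phi -> ~ T x -> ~ Om x -> A a ->
  (\forall y \near x, w1 y - phi y <= w1 x - phi x) ->
  0 <= dot (grad phi x) (f x a).
Proof.
move=> cphi Tx Ox Aa near_x; have [_ [[_ cT _] _]] := sa.
have oT : open (~` T) by exact: closed_openC.
rewrite leNgt; apply/negP; rewrite -oppr_gt0; set h := - _ => h0.
have ca := controls_cst Aa; set Y := traj x (fun=> a); set p := grad phi x in h h0.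
have r0 : 0 <= `|x| + 1 by rewrite addr_ge0.
have xr : `|x| <= `|x| + 1 by rewrite lerDl.
have [K K0 hK] := flow_expansion sa r0.
have [C C0 hC] := subsolution_flow sa r0.
have e0 : 0 < h / (4 * K) by rewrite divr_gt0 // mulr_gt0.
have [d1 d10 hd1] := (nbhs_rvP _ _).1 (diff_expansion (cphi x Tx).1 e0).
have [d2 d20 hd2] := (nbhs_rvP _ _).1 near_x.
have [d3 d30 hd3] := (nbhs_rvP x (~` T)).1 (open_nbhs_nbhs (conj oT Tx)).
have P0 : 0 < 4 * (K * (`|p| + 1)) by rewrite !mulr_gt0 // ltr_wpDl.
pose t0 := Num.min (Num.min 1 (1 / K)) (Num.min (Num.min (d1 / (2 * K)) (d2 / (2 * K)))
  (Num.min (d3 / (2 * K)) (h / (4 * (K * (`|p| + 1)))))).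
have K2 : 0 < 2 * K by rewrite mulr_gt0.
have t00 : 0 < t0.
  by rewrite !lt_min ltr01 /= divr_gt0 //= !divr_gt0.
have small s : 0 <= s <= t0 -> [/\ `|Y s - x| <= K * s, `|Y s - x| < d1, `|Y s - x| < d2 /\ `|Y s - x| < d3,
    `|Y s| <= `|x| + 1 & `|dot p (Y s - x) - s * dot p (f x a)| <= h / 4 * s].
  move=> /andP[s0]; rewrite !le_min => /andP[/andP[s1 s2] /andP[/andP[s3 s4] /andP[s5 s6]]].
  rewrite ler_pdivlMr // in s2; rewrite ler_pdivlMr // in s3; rewrite ler_pdivlMr // in s4.
  rewrite ler_pdivlMr // in s5; rewrite ler_pdivlMr // in s6.
  have h01 : 0 <= s <= 1 by rewrite s0.
  have Ks : K * s <= 1 by rewrite mulrC.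
  have [k1 k2] := hK x a p s xr Aa h01 Ks.
  rewrite -/Y in k1 k2; split => //.
  - by lra.
  - by split; lra.
  - by have := ler_normD (Y s - x) x; rewrite subrK; lra.
  apply: le_trans k2 _; rewrite expr2.
  have : s * (s * (4 * (K * (`|p| + 1)))) <= s * h by rewrite ler_wpM2l.
  have : 0 <= K * s * s by rewrite !mulr_ge0 // ltW.
  lra.
(* The touching inequality gives [w1 (Y s) <= 1 + phi (Y s) - phi x]; the increment of [phi] is
   [- h * s] up to two errors of [h * s / 4]. *)
have decr s : 0 < s <= t0 -> w1 (Y s) < 1.
  move=> /andP[s0 st]; have [|k1 k2 [k3 _] _ k4] := small s; first by rewrite (ltW s0).
  have := hd2 _ k3; rewrite (w1_notin Ox) => h1.
  have := hd1 _ k2; rewrite -/p => h2.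
  have h3 : h / (4 * K) * `|Y s - x| <= h / 4 * s.
    apply: (@le_trans _ _ (h / (4 * K) * (K * s))); first by rewrite ler_wpM2l // ltW.
    by rewrite le_eqVlt; apply/orP; left; apply/eqP; field; rewrite gt_eqF.
  have hs : 0 < h * s by rewrite mulr_gt0.
  move: k4 h2; rewrite !ler_norml => /andP[_ k4] /andP[_ h2].
  have eh : dot p (f x a) = - h by rewrite /h opprK.
  rewrite eh in k4; lra.
pose N := Om `&` ~` T.
have oN : open N by exact: openI.
have NY s : 0 < s <= t0 -> N (Y s).
  move=> st; have [s0 s1] := andP st; split.
    by apply: contrapT => /w1_notin e; have := decr s st; rewrite e ltxx.
  by have [|_ _ [_ /hd3]] := small s; rewrite ?(ltW s0).
(* [kappa * expR (C * t0)] is half of [1 - w1 (Y t0)], too small for the bound that the flow will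
   impose. *)
have kp : 0 < (1 - w1 (Y t0)) / (2 * expR (C * t0)).
  by rewrite divr_gt0 ?mulr_gt0 ?expR_gt0 // subr_gt0 decr // t00 lexx.
set kappa := _ / _ in kp.
(* [Y s] is in the domain for small positive [s], so [x] is on its relative boundary and [u] blows
   up there. *)
have rb : rel_bdry out D x.
  split; last by apply: subset_closure; split; [exact: outside_notin | move=> Dx; apply: Ox; left].
  split; first exact: outside_notin.
  move=> B /nbhs_rvP [e e_gt0 he].
  pose s := Num.min t0 (e / (2 * K)).
  have s0 : 0 < s by rewrite lt_min t00 divr_gt0.
  have st : 0 < s <= t0 by rewrite s0 ge_min lexx.
  have [|k1 _ _ _ _] := small s; first by rewrite (ltW s0); case/andP: st.
  exists (Y s); split.
    by have [Os Ts] := NY s st; apply: D_in Os (outside_notin Ts).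
  apply: he; have : s <= e / (2 * K) by rewrite ge_min lexx orbT.
  by rewrite ler_pdivlMr // => k2; lra.
have [_ _ bu] := su.
(* Above the level [- ln kappa] the transform satisfies [1 - w1 < kappa]; the added 1 makes the
   inequality strict. *)
have /cvgeyPge /(_ (- ln kappa + 1)) := bu x rb.
rewrite near_withinE => /nbhs_rvP [e e_gt0 he].
pose s := Num.min t0 (e / (2 * K)).
have s0 : 0 < s by rewrite lt_min t00 divr_gt0.
have sle : s <= t0 by rewrite ge_min lexx.
have st : 0 < s <= t0 by rewrite s0.
have [|k1 _ _ _ _] := small s; first by rewrite (ltW s0).
have [Ns1 Ns2] := NY s st; have os := outside_notin Ns2; have Ds := D_in Ns1 os.
have se : `|Y s - x| < e.
  have : s <= e / (2 * K) by rewrite ge_min lexx orbT.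
  by rewrite ler_pdivlMr // => k2; lra.
have us := he _ se os.
have ks : 1 - w1 (Y s) < kappa.
  have [Us _] := upper_fin Ds.
  have : ((- ln kappa)%:E < upper (Y s))%E.
    apply: lt_le_trans (le_usc_env u Ds); apply: lt_le_trans us.
    by rewrite lte_fin ltrDl.
  by rewrite -lt_kruzkov // opprK lnK ?posrE // -w1E //; lra.
have shift q : 0 <= q -> traj (Y s) (fun=> a) q = Y (s + q).
  by move=> q0; have := traj_shift sa x ca (ltW s0) q0; rewrite -/Y => <-.
have ts : 0 <= t0 - s by rewrite subr_ge0.
have := @hC w1 N a (Y s) (t0 - s) kappa oN Aa ts.
rewrite shift // subrKC => flow.
have : 1 - w1 (Y t0) <= kappa * expR (C * (t0 - s)).
  apply: flow => //.
  - move=> q /andP[q0 qt]; rewrite shift //.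
    have sq : 0 < s + q <= t0 by apply/andP; split; lra.
    split; first exact: NY.
    by have [|_ _ _ ->] := small (s + q); first by case/andP: sq => /ltW -> ->.
  - move=> y [Oy Ty]; split; first exact: w1_le1.
    move=> e' e'0; apply: filterS2 (w1_usc (outside_notin Ty) e'0) (near_outside sa Ty) => z h1 h2.
    exact: h1.
  by move=> psi cpsi y [Oy Ty] hy; exact: (w1_sub_in (fun z _ => cpsi z I) Ty Oy Aa hy).
have : kappa * expR (C * (t0 - s)) <= kappa * expR (C * t0).
  by rewrite ler_wpM2l ?(ltW kp) // ler_expR ler_wpM2l ?(ltW C0) // gerBl ltW.
have : kappa * expR (C * t0) = (1 - w1 (Y t0)) / 2.
  by rewrite /kappa; field; rewrite gt_eqF // expR_gt0.
have z0 : 0 < 1 - w1 (Y t0) by rewrite subr_gt0 decr // t00 lexx.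
move=> -> le1 le2; have := le_trans le2 le1.
by rewrite leNgt ltr_pdivrMr // ltr_pMr // ltr1n.
Qed.

Lemma blowup_solution_le_value x : out x -> (u x <= V x)%E.
Proof.
have [[_ [_ [_ [_ [_ [_ [ub _]]]]]]] _ _] := su; rewrite setE in ub.
move=> ox; have : w1 x <= W x.
  apply: (comparison sa pg (w1 := w1) (w2 := W)) ox => {x}.
  - by move=> x ox e; exact: w1_usc.
  - move=> x ox e e0; apply: filterS (kruzkov_value_near sa pg vs ox e0) => y h /h.
    by rewrite ltr_distlC => /andP[].
  - by move=> x _; exact: w1_le1.
  - by move=> x _; case/andP: (kruzkov_value_itv sa x).
  - move=> x bx; have [_ [[_ cT _] _]] := sa.
    have Ox : Om x by right; apply: cT; case: bx.
    rewrite w1E //; apply: kruzkov_small; last exact: ub.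
    by apply: (upper_fin (D_in Ox _)).1; case: bx.
  - move=> phi cphi x Tx h a Aa; have [Ox|Ox] := pselect (Om x); first exact: w1_sub_in.
    (* Where [w1] is 1 the zero order term vanishes, and only the sign of the derivative along [f]
       remains. *)
    rewrite (w1_notin Ox) subrr mulr0 subr0 oppr_le0; exact: w1_sub_notin.
  - by move=> phi cphi x Tx _; exact: (kruzkov_value_super_at sa pg vs Tx cphi).
have [Ox|Ox] := pselect (Om x).
  have Dx := D_in Ox ox; have [U0 _] := upper_fin Dx.
  rewrite w1E // le_kruzkov ?(value_ge0 sa) //; apply: le_trans; exact: le_usc_env.
(* Off [Om] the comparison reads [1 <= W x], which forces the value to be infinite. *)
rewrite w1_notin // leNgt kruzkov_lt1 ?(value_ge0 sa) // -leNgt leye_eq => /eqP ->.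
exact: leey.
Qed.

Lemma blowup_unique x : out x -> u x = V x.
Proof.
move=> ox; apply/le_anti; rewrite blowup_solution_le_value //=.
exact: le_trans (value_le_lsc_env ox) (lsc_env_le u ox).
Qed.

End BlowupUniqueness.

Theorem corollary2p1 (R : realType) (n m : nat)
    (f : 'rV[R]_n -> 'rV[R]_m -> 'rV[R]_n)
    (l : 'rV[R]_n -> 'rV[R]_m -> R)
    (A : set 'rV[R]_m) (T : set 'rV[R]_n) :
  standing_assumptions f l A T ->
  LACL f A T l ->
  SC1 f A T \/ SC2 l A T ->
  (CV f l A ->
     (exists W : 'rV[R]_n -> R,
        [/\ nonneg_BVPK_solution f l A T W,
            forall W' : 'rV[R]_n -> R, nonneg_BVPK_solution f l A T W' ->
              forall x, outside T x -> W' x = W x,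
            {within outside T, continuous W},
            forall x, outside T x -> value f l A T x = (- lne (1 - W x)%:E)%E &
            Dom T (value f l A T) = [set x | outside T x /\ W x < 1]]) /\
     [/\ nonneg_blowup_BVP_solution f l A T (value f l A T),
         forall u : 'rV[R]_n -> \bar R, nonneg_blowup_BVP_solution f l A T u ->
           forall x, outside T x -> u x = value f l A T x &
         {within outside T, continuous (value f l A T)}]) /\
  ((exists W : 'rV[R]_n -> R,
      [/\ nonneg_BVPK_solution f l A T W,
          forall W' : 'rV[R]_n -> R, nonneg_BVPK_solution f l A T W' ->
            {within outside T, continuous W'} ->
            forall x, outside T x -> W' x = W x,
          {within outside T, continuous W},
          forall x, outside T x -> value f l A T x = (- lne (1 - W x)%:E)%E &
          Dom T (value f l A T) = [set x | outside T x /\ W x < 1]]) /\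
   [/\ nonneg_blowup_BVP_solution f l A T (value f l A T),
       forall u : 'rV[R]_n -> \bar R, nonneg_blowup_BVP_solution f l A T u ->
         {within Dom T u, continuous u} ->
         forall x, outside T x -> u x = value f l A T x &
       {within outside T, continuous (value f l A T)}]).
Proof.
move=> sa [Om [U [[oOm TOm] [U0 [cU [sc [pd [pr [_ [k k0 hk]]]]]]]]]] sc12.
have decr x : (Om `\` T) x -> forall p, limiting_gradients (Om `\` T) U x p ->
    exists2 a, A a & dot p (f x a) + k * l x a < 0.
  by move=> Ox p Dp; have [a Aa [_ ha]] := hk x Ox p Dp; exists a.
have vs x0 (e : R) : bdry T x0 -> 0 < e -> \forall x \near x0, outside T x ->
    (value f l A T x <= e%:E)%E.
  exact: (value_small sa oOm TOm U0 cU sc pd pr k0 decr).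
have [g pg] : exists g, penalty (f := f) (l := l) (A := A) (T := T) g.
  by case: sc12; [exact: penalty_SC1 | exact: penalty_SC2].
have W_ok := kruzkov_value_solution sa pg vs; have V_ok := value_solution sa pg vs.
have Wc := kruzkov_value_continuous sa pg vs; have Vc := value_continuous sa pg vs.
split=> [_|]; split.
- exists (kruzkov_value (f := f) (l := l) (A := A) (T := T)); split => //.
  + by move=> W' sW' x; exact: (BVPK_solution_unique sa pg vs).
  + by move=> x _; exact: value_lne.
  + exact: Dom_value.
- by split => // u su x; exact: (blowup_unique sa pg vs su).
- exists (kruzkov_value (f := f) (l := l) (A := A) (T := T)); split => //.
  + by move=> W' sW' _ x; exact: (BVPK_solution_unique sa pg vs).
  + by move=> x _; exact: value_lne.
  + exact: Dom_value.
- by split => // u su _ x; exact: (blowup_unique sa pg vs su).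
Qed.
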